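(* Let $n,m\geqslant 1$ be integers. Let $\phi(r)=\sum_{i=0}^{\infty}A_i\,r^i$ be a transcendental growth function, i.e. $A_i>0$ for all $i\geqslant 0$ and $\lim_{i\to\infty}A_{i+1}/A_i=0$. Let $\{\theta_i\}_{i\geqslant 1}$ be countably many directions in the unit sphere $\mathbb{S}^{2n-1}\subset\mathbb{C}^n$. Then there exists a universal holomorphic map $F:\mathbb{C}^n\to\mathbb{C}^m$ with slow growth $$\|F(z)\|\leqslant \phi(\|z\|)\qquad (\forall\, z\in\mathbb{C}^n),$$ such that the hypercyclic directions of $F$ include $\{\theta_i\}_{i\geqslant 1}$; namely, $F$ is hypercyclic for $\mathsf{T}_a$ for every $a$ lying in some ray $\mathbb{R}_+\cdot\theta_i$, $i\geqslant 1$.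
   Context: $\|\cdot\|$ is the standard Euclidean norm on $\mathbb{C}^k$ for any $k$, and $\mathbb{R}_+=(0,\infty)$. The space $\mathsf{Hol}(\mathbb{C}^n,\mathbb{C}^m)$ of holomorphic maps carries the compact-open topology (uniform convergence on compact sets). For $a\in\mathbb{C}^n\setminus\{\mathbf{0}\}$, the translation operator $\mathsf{T}_a$ on $\mathsf{Hol}(\mathbb{C}^n,\mathbb{C}^m)$ is $\mathsf{T}_a(f)(\bullet)=f(\bullet+a)$. An element $f$ is hypercyclic for $\mathsf{T}_a$ if the orbit $\{f,\mathsf{T}_a(f),\mathsf{T}_a^{2}(f),\dots\}$ is dense in $\mathsf{Hol}(\mathbb{C}^n,\mathbb{C}^m)$. A map $F$ is universal if every $H\in\mathsf{Hol}(\mathbb{C}^n,\mathbb{C}^m)$ is a limit (uniform on compact sets) of translates $F(\bullet+a_i)$ for some sequence $\{a_i\}$ in $\mathbb{C}^n$. The hypercyclic directions of $F$ are the $a\in\mathbb{S}^{2n-1}$ such that $F$ is hypercyclic for $\mathsf{T}_a$. *)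

(* Defs.v *)
(* The real numbers are an arbitrary R : realType, the complex numbers R[i]. *)
From HB Require Import structures.
From mathcomp Require Import all_boot all_order all_algebra complex.
From mathcomp Require Import all_classical all_reals all_analysis.

Set Implicit Arguments.
Unset Strict Implicit.
Unset Printing Implicit Defensive.

Import Order.TTheory GRing.Theory Num.Theory numFieldNormedType.Exports.

Local Open Scope classical_set_scope.
Local Open Scope ring_scope.
Local Open Scope complex_scope.

(* R[i] is not given a topology by the libraries; this is the one of its
   modulus, as for any numFieldType. *)
HB.instance Definition _ (R : rcfType) := NormedModule.copy R[i] R[i]^o.

(* The library norm on 'rV_k is the sup norm; it is only used for the
   topology and for differentiability. *)
Definition enorm (R : realType) (k : nat) (z : 'rV[R[i]]_k) : R :=
  Num.sqrt (\sum_(j < k) ComplexField.Normc.normc (z ord0 j) ^+ 2).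

(* The scalars are R[i], so the differentials are C-linear. *)
Definition holomorphic (R : realType) (n m : nat)
    (f : 'rV[R[i]]_n -> 'rV[R[i]]_m) : Prop :=
  forall z, differentiable f z.

(* The subspace topology of the compact-open topology; holomorphic maps being
   continuous, it is that of uniform convergence on compact sets
   (compact_open_fam_compactP). *)
Definition hol (R : realType) (n m : nat) : topologicalType :=
  set_type [set f : {compact-open, 'rV[R[i]]_n -> 'rV[R[i]]_m} |
              holomorphic (f : 'rV[R[i]]_n -> 'rV[R[i]]_m)].

Definition hol_fun (R : realType) (n m : nat) (F : hol R n m) :
  'rV[R[i]]_n -> 'rV[R[i]]_m := set_val F.

Lemma holomorphic_translate (R : realType) (n m : nat) (a : 'rV[R[i]]_n)
    (f : 'rV[R[i]]_n -> 'rV[R[i]]_m) :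
  holomorphic f -> holomorphic (fun z => f (z + a)).
Proof.
move=> hf z; apply: (@differentiable_comp _ _ _ _ (fun z => z + a) f).
  exact: differentiableD.
exact: hf.
Qed.

Definition translate (R : realType) (n m : nat) (a : 'rV[R[i]]_n)
    (F : hol R n m) : hol R n m :=
  exist _ (fun z => hol_fun F (z + a))
    (mem_set (holomorphic_translate a (set_mem (valP F)))).

Definition hypercyclic (R : realType) (n m : nat) (a : 'rV[R[i]]_n)
    (F : hol R n m) : Prop :=
  dense [set iter k (translate a) F | k in [set: nat]].

Definition universal (R : realType) (n m : nat) (F : hol R n m) : Prop :=
  forall H : hol R n m, exists a : nat -> 'rV[R[i]]_n,
    translate (a i) F @[i --> \oo] --> H.

Definition hypercyclic_directions (R : realType) (n m : nat) (F : hol R n m) :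
    set 'rV[R[i]]_n :=
  [set a | enorm a = 1 /\ hypercyclic a F].

Definition transcendental_growth (R : realType) (A : nat -> R) : Prop :=
  (forall i, 0 < A i) /\ A i.+1 / A i @[i --> \oo] --> (0 : R).

(* The series converges for every r when transcendental_growth A holds
   (ratio test). *)
Definition growth_fun (R : realType) (A : nat -> R) (r : R) : R :=
  limn (pseries A r).

(* Main.v *)
Require Import Defs.
From HB Require Import structures.
From mathcomp Require Import all_boot all_order all_algebra complex.
From mathcomp Require Import all_classical all_reals all_analysis.
From mathcomp Require Import ring lra.

Set Implicit Arguments.
Unset Strict Implicit.
Unset Printing Implicit Defensive.

Import Order.TTheory GRing.Theory Num.Theory numFieldNormedType.Exports.

Local Open Scope classical_set_scope.
Local Open Scope ring_scope.
Local Open Scope complex_scope.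

(** The map F is a sum of polynomial corrections. A transcendental growth function
phi dominates a positive multiple of every monomial ([growth_fun_ge]), so that a
polynomial whose coefficients are small enough for its degree lies below phi. Stage
s treats one direction theta and one polynomial target Q with rational coefficients,
and adds a correction which

- is below phi / 2^(s+1) everywhere, so that the sum stays below phi;
- is below 1 / 2^(s+1) on a ball that contains the balls of all earlier stages;
- makes, for every t in [1/(s+1), s+1] at once, some translate of the partial sum
  by a multiple of t theta close to Q on the ball of radius s.

Every pair (theta, Q) is treated at infinitely many stages, and the targets are
dense. Hence F is hypercyclic for every t theta, t > 0; universality follows from
a single direction.

A stage ([approximation_step]) rests on three facts.

- [ladder]: there are finitely many heights y_i on the real line, as widely spaced
  as desired, such that for every N >= 0 and every t of a given compact interval
  of positive numbers some N + y_i is almost a multiple of t. The ladder does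
  not depend on N; this is what allows uncountably many t to be treated by
  finitely many balls.
- [runge_discs]: one polynomial map G approximates Q (z - y_i theta) on all balls
  around the points y_i theta. It is glued by bumps in one complex coordinate,
  namely explicit polynomials ([bump_polynomial]).
- [far_modification]: for a large, G (z - a theta) can be approximated on a large ball
  around a theta by adding to a given polynomial map F a correction p. With
  w the coordinate along theta, p is the product of G (z - a theta) - F z, whose
  coefficients are O(a^D), and of 1 - (1 - (w/a)^M)^K, which is O((w/a)^M) near the
  origin and 1 - O(a^-K) near a theta. For M, K > D the degree of p does not depend on
  a while its coefficients tend to 0.

Complex analysis enters twice: polynomials are dense among entire maps
([entire_approximable]), and the locally uniform limit F of polynomial maps is
holomorphic ([weierstrass]). Both are applications of Cauchy's estimates in one
variable ([cauchy_taylor]) to restrictions to complex lines. As holomorphy means mere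
differentiability, these start from Goursat's theorem ([goursat]), proved by
bisection. In the coordinate log z a circle becomes a vertical segment, so Goursat's
theorem for rectangles is enough: the integral over a circle does not depend on the
radius, by periodicity in the imaginary direction. Applied to the difference quotient
of f at z0, which is differentiable off z0 and at first merely continuous at z0, this
gives Cauchy's formula ([circle_int_eq0]). *)

Local Notation nc := ComplexField.Normc.normc.

(** * Complex numbers and their topology *)

Section Modulus.
Variable R : realType.
Local Notation C := R[i].
Implicit Types x y z : C.

Lemma ncE z : nc z = Num.sqrt (complex.Re z ^+ 2 + complex.Im z ^+ 2).
Proof. by case: z. Qed.

Lemma nc_ge0 z : 0 <= nc z.
Proof. by rewrite ncE sqrtr_ge0. Qed.

Lemma ncM x y : nc (x * y) = nc x * nc y.
Proof. exact: ComplexField.Normc.normcM. Qed.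

Lemma ncD x y : nc (x + y) <= nc x + nc y.
Proof. exact: le_normcD. Qed.

Lemma ncN x : nc (- x) = nc x.
Proof. exact: normcN. Qed.

Lemma ncB x y : nc (x - y) <= nc x + nc y.
Proof. by rewrite -(ncN y) ncD. Qed.

Lemma ncBC x y : nc (x - y) = nc (y - x).
Proof. by rewrite -ncN opprB. Qed.

Lemma nc0 : nc (0 : C) = 0.
Proof. exact: ComplexField.Normc.normc0. Qed.

Lemma nc1 : nc (1 : C) = 1.
Proof. exact: ComplexField.Normc.normc1. Qed.

Lemma ncV x : nc x^-1 = (nc x)^-1.
Proof. exact: ComplexField.Normc.normcV. Qed.

Lemma nc_eq0 z : (nc z == 0) = (z == 0).
Proof.
apply/eqP/eqP => [|->]; last exact: nc0.
exact: ComplexField.Normc.eq0_normc.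
Qed.

Lemma nc_gt0 z : (0 < nc z) = (z != 0).
Proof. by rewrite lt_def nc_ge0 andbT nc_eq0. Qed.

Lemma ncX z k : nc (z ^+ k) = nc z ^+ k.
Proof. by elim: k => [|k IH]; rewrite ?expr0 ?nc1// !exprS ncM IH. Qed.

Lemma nc_real (r : R) : nc (r%:C) = `|r|.
Proof. by rewrite ncE /= expr0n addr0 sqrtr_sqr. Qed.

Lemma nc_i : nc ('i : C) = 1.
Proof. by rewrite ncE /= expr0n add0r expr1n sqrtr1. Qed.

Lemma nc_sum (I : Type) (s : seq I) (P : pred I) (f : I -> C) :
  nc (\sum_(i <- s | P i) f i) <= \sum_(i <- s | P i) nc (f i).
Proof.
elim/big_ind2 : _ => [|a b c d ha hb|i _]; rewrite ?nc0//.
exact: le_trans (ncD _ _) (lerD ha hb).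
Qed.

Lemma nc_sub_norm x y : `|nc x - nc y| <= nc (x - y).
Proof.
have h (u v : C) : nc u - nc v <= nc (u - v).
  by rewrite lerBlDr -{1}(subrK v u) ncD.
by rewrite ler_norml h andbT lerNl opprB ncBC h.
Qed.

Lemma nc_Re z : `|complex.Re z| <= nc z.
Proof. by rewrite ncE -sqrtr_sqr ler_wsqrtr// lerDl sqr_ge0. Qed.

Lemma nc_Im z : `|complex.Im z| <= nc z.
Proof. by rewrite ncE -sqrtr_sqr ler_wsqrtr// lerDr sqr_ge0. Qed.

Lemma complexE2 (a b : R) : a +i* b = a%:C + 'i * b%:C.
Proof. by apply/eqP; rewrite eq_complex /= !(mul0r, mul1r, mulr0, addr0, add0r, subr0) !eqxx. Qed.

Lemma nc_le_ReIm z : nc z <= `|complex.Re z| + `|complex.Im z|.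
Proof.
case: z => a b; rewrite complexE2; apply: le_trans (ncD _ _) _.
by rewrite ncM nc_i mul1r !nc_real /= !(mul0r, mul1r, mulr0, addr0, add0r, subr0).
Qed.

Lemma RCD (a b : R) : (a + b)%:C = a%:C + b%:C.
Proof. by rewrite -rmorphD. Qed.
Lemma RCM (a b : R) : (a * b)%:C = a%:C * b%:C.
Proof. by rewrite -rmorphM. Qed.
Lemma RCB (a b : R) : (a - b)%:C = a%:C - b%:C.
Proof. by rewrite -rmorphB. Qed.

Lemma norm_nc z : `|z| = (nc z)%:C.
Proof. by []. Qed.

Lemma gt0_complexE z : 0 < z -> z = (complex.Re z)%:C /\ 0 < complex.Re z.
Proof.
move=> z0; have zE : z = (complex.Re z)%:C.
  have : z \is Num.real by rewrite gtr0_real.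
  by move=> /complex_realP[k ->].
by split => //; rewrite zE ltcR in z0.
Qed.

Lemma cReD x y : complex.Re (x + y) = complex.Re x + complex.Re y.
Proof. by case: x; case: y. Qed.

Lemma cImD x y : complex.Im (x + y) = complex.Im x + complex.Im y.
Proof. by case: x; case: y. Qed.

Lemma cReB x y : complex.Re (x - y) = complex.Re x - complex.Re y.
Proof. by case: x; case: y. Qed.

Lemma cImB x y : complex.Im (x - y) = complex.Im x - complex.Im y.
Proof. by case: x; case: y. Qed.

Lemma cReM x y : complex.Re (x * y) =
  complex.Re x * complex.Re y - complex.Im x * complex.Im y.
Proof. by case: x; case: y. Qed.

Lemma cImM x y : complex.Im (x * y) =
  complex.Re x * complex.Im y + complex.Im x * complex.Re y.
Proof. by case: x; case: y. Qed.

Lemma eq_ReIm x y : complex.Re x = complex.Re y ->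
  complex.Im x = complex.Im y -> x = y.
Proof. by case: x; case: y => a b c d /= -> ->. Qed.

Lemma continuous_ncP (T : topologicalType) (f : T -> C) (t : T) :
  {for t, continuous f} <->
  forall e : R, 0 < e -> \forall s \near t, nc (f s - f t) < e.
Proof.
split=> [/cvgrPdist_lt H e e0|H].
  have e0' : (0 : C) < e%:C by rewrite ltcR.
  have := H _ e0'; apply: filterS => s /=.
  by rewrite norm_nc ltcR ncBC.
apply/cvgrPdist_lt => e e0.
have [eE e0'] := gt0_complexE e0.
have := H _ e0'; apply: filterS => s /=.
by rewrite norm_nc eE ltcR ncBC.
Qed.

Lemma nbhs_ncP z (P : C -> Prop) : (\forall y \near z, P y) <->
  exists2 d : R, 0 < d & forall y, nc (y - z) < d -> P y.
Proof.
split=> [/nbhs_ballP[d /= d0 H]|[d d0 H]].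
  have [dE d0'] := gt0_complexE d0; exists (complex.Re d) => //.
  move=> y yd; apply: H; rewrite -ball_normE /ball_ /= norm_nc dE ltcR.
  by rewrite ncBC.
apply/nbhs_ballP; exists d%:C => /=; first by rewrite ltcR.
move=> y; rewrite -ball_normE /ball_ /= norm_nc ltcR ncBC; exact: H.
Qed.

Lemma continuous_epsP (f : C -> C) z : {for z, continuous f} <->
  forall e : R, 0 < e -> exists2 d : R, 0 < d &
     forall y, nc (y - z) < d -> nc (f y - f z) < e.
Proof.
by split=> [/continuous_ncP H e /H/nbhs_ncP|H]//; apply/continuous_ncP => e /H/nbhs_ncP.
Qed.

Lemma nbhs_RP (t : R) (P : R -> Prop) : (\forall s \near t, P s) <->
  exists2 d : R, 0 < d & forall s, `|s - t| < d -> P s.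
Proof.
split=> [/nbhs_ballP[d /= d0 H]|[d d0 H]].
  by exists d => // s sd; apply: H; rewrite -ball_normE /ball_ /= distrC.
apply/nbhs_ballP; exists d => //= s; rewrite -ball_normE /ball_ /= distrC; exact: H.
Qed.

Lemma Re_continuous (T : topologicalType) (f : T -> C) (t : T) :
  {for t, continuous f} -> {for t, continuous (fun s => complex.Re (f s))}.
Proof.
move=> /continuous_ncP H; apply/cvgrPdist_lt => e /H; apply: filterS => s.
by apply: le_lt_trans; rewrite distrC -cReB; exact: nc_Re.
Qed.

Lemma Im_continuous (T : topologicalType) (f : T -> C) (t : T) :
  {for t, continuous f} -> {for t, continuous (fun s => complex.Im (f s))}.
Proof.
move=> /continuous_ncP H; apply/cvgrPdist_lt => e /H; apply: filterS => s.
by apply: le_lt_trans; rewrite distrC -cImB; exact: nc_Im.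
Qed.

Lemma horizontal_continuous (b : R) : continuous (fun s : R => s +i* b).
Proof.
move=> t; apply/continuous_ncP => e e0; apply/nbhs_RP; exists e => // s se.
apply: le_lt_trans (nc_le_ReIm _) _; by rewrite /= subrr normr0 addr0.
Qed.

Lemma vertical_continuous (a : R) : continuous (fun s : R => a +i* s).
Proof.
move=> t; apply/continuous_ncP => e e0; apply/nbhs_RP; exists e => // s se.
apply: le_lt_trans (nc_le_ReIm _) _; by rewrite /= subrr normr0 add0r.
Qed.

Section ContinuousOps.
Variable T : topologicalType.
Implicit Types f g : T -> C.

Lemma contD f g : continuous f -> continuous g -> continuous (fun s => f s + g s).
Proof. by move=> cf cg s; exact: (continuousD (cf s) (cg s)). Qed.

Lemma contM f g : continuous f -> continuous g -> continuous (fun s => f s * g s).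
Proof. by move=> cf cg s; exact: (continuousM (cf s) (cg s)). Qed.

Lemma contB f g : continuous f -> continuous g -> continuous (fun s => f s - g s).
Proof. by move=> cf cg s; exact: (continuousB (cf s) (cg s)). Qed.

Lemma contC (c : C) : continuous (fun _ : T => c).
Proof. by move=> s; exact: cst_continuous. Qed.

Lemma contX f k : continuous f -> continuous (fun s => f s ^+ k).
Proof.
move=> cf; elim: k => [|k IH]; first exact: contC.
by under eq_fun do rewrite exprS; exact: contM.
Qed.

End ContinuousOps.

End Modulus.

(** * Integrals of complex functions of a real variable *)

Section ComplexIntegral.
Variable R : realType.
Local Notation C := R[i].
Local Notation mu := (@lebesgue_measure R).

Definition cint (f : R -> C) (a b : R) : C :=
  (\int[mu]_(x in `[a, b]) complex.Re (f x)) +i*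
  (\int[mu]_(x in `[a, b]) complex.Im (f x)).

Lemma integrable_continuous (f : R -> R) (a b : R) : continuous f ->
  mu.-integrable `[a, b] (EFin \o f).
Proof.
move=> cf; apply: continuous_compact_integrable; first exact: segment_compact.
exact: continuous_subspaceT.
Qed.

Lemma integrable_Re (f : R -> C) (a b : R) : continuous f ->
  mu.-integrable `[a, b] (EFin \o (fun x => complex.Re (f x))).
Proof. by move=> cf; apply: integrable_continuous => x; exact: Re_continuous (cf x). Qed.

Lemma integrable_Im (f : R -> C) (a b : R) : continuous f ->
  mu.-integrable `[a, b] (EFin \o (fun x => complex.Im (f x))).
Proof. by move=> cf; apply: integrable_continuous => x; exact: Im_continuous (cf x). Qed.

Lemma cintD (f g : R -> C) a b : continuous f -> continuous g ->
  cint (fun x => f x + g x) a b = cint f a b + cint g a b.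
Proof.
move=> cf cg; apply: eq_ReIm; rewrite ?cReD ?cImD /cint /= -RintegralD//;
  try exact: integrable_Re; try exact: integrable_Im;
  by apply: eq_Rintegral => x _; rewrite ?cReD ?cImD.
Qed.

Lemma eq_cint (f g : R -> C) a b : (forall x, a <= x <= b -> f x = g x) ->
  cint f a b = cint g a b.
Proof.
by move=> fg; apply: eq_ReIm; apply: eq_Rintegral => x;
  rewrite inE /= in_itv /= => /fg ->.
Qed.

Lemma cintZ (c : C) (f : R -> C) a b : continuous f ->
  cint (fun x => c * f x) a b = c * cint f a b.
Proof.
move=> cf; have iR := integrable_Re a b cf; have iI := integrable_Im a b cf.
have iRZ (k : R) : mu.-integrable `[a, b] (EFin \o (fun x => k * complex.Re (f x))).
  apply: integrable_continuous => x.
  exact: (continuousM (@cst_continuous _ _ k x) (Re_continuous (cf x))).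
have iIZ (k : R) : mu.-integrable `[a, b] (EFin \o (fun x => k * complex.Im (f x))).
  apply: integrable_continuous => x.
  exact: (continuousM (@cst_continuous _ _ k x) (Im_continuous (cf x))).
apply: eq_ReIm; rewrite ?cReM ?cImM /cint /= -!RintegralZl//.
  by rewrite -RintegralB//; apply: eq_Rintegral => x _; rewrite cReM.
by rewrite -RintegralD//; apply: eq_Rintegral => x _; rewrite cImM.
Qed.

Lemma cintB (f g : R -> C) a b : continuous f -> continuous g ->
  cint (fun x => f x - g x) a b = cint f a b - cint g a b.
Proof.
move=> cf cg.
have cNg : continuous (fun x => -1 * g x) by exact: (contM (@contC R R (-1)) cg).
have -> : cint f a b - cint g a b = cint f a b + cint (fun x => -1 * g x) a b.
  by rewrite cintZ// mulN1r.
by rewrite -cintD//; apply: eq_cint => x _; rewrite mulN1r.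
Qed.

Lemma Rint_cst (a b r : R) : a <= b ->
  \int[mu]_(_ in `[a, b]) r = r * (b - a).
Proof.
move=> ab; rewrite Rintegral_cst; last exact: measurable_itv.
congr (_ * _); transitivity (fine (lebesgue_measure [set` `[a, b]])) => //.
rewrite lebesgue_measure_itv /= lte_fin.
case: ltP => //= ba.
have -> : a = b by apply/le_anti; rewrite ab ba.
by rewrite subrr.
Qed.

Lemma Rint_le (f : R -> R) (a b M : R) : a <= b -> continuous f ->
  (forall x, a <= x <= b -> `|f x| <= M) ->
  `|\int[mu]_(x in `[a, b]) f x| <= M * (b - a).
Proof.
move=> ab cf fM.
have iN : mu.-integrable `[a, b] (EFin \o (fun x => `|f x|)).
  apply: integrable_continuous => x.
  by apply: continuous_comp; [exact: cf|exact: norm_continuous].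
have := @le_normr_Rintegral _ _ R mu _ f (measurable_itv _) (integrable_continuous a b cf).
move=> /le_trans; apply.
apply: (@le_trans _ _ (\int[mu]_(x in `[a, b]) M)).
  apply: le_Rintegral; [exact: measurable_itv|exact: iN| |].
    by apply: integrable_continuous => x; exact: cst_continuous.
  by move=> x; rewrite /= in_itv /= => /fM.
by rewrite Rint_cst.
Qed.

Lemma nc_cint_le (f : R -> C) (a b M : R) : a <= b -> continuous f ->
  (forall x, a <= x <= b -> nc (f x) <= M) ->
  nc (cint f a b) <= 2 * M * (b - a).
Proof.
move=> ab cf fM; apply: le_trans (nc_le_ReIm _) _; rewrite -mulrA [2 * _]mulr_natl mulr2n.
apply: lerD; apply: Rint_le => //.
- by move=> x; exact: Re_continuous (cf x).
- by move=> x /fM; apply: le_trans; exact: nc_Re.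
- by move=> x; exact: Im_continuous (cf x).
- by move=> x /fM; apply: le_trans; exact: nc_Im.
Qed.

Lemma Rint_split (f : R -> R) (a m b : R) : a <= m -> m <= b -> continuous f ->
  \int[mu]_(x in `[a, b]) f x =
  \int[mu]_(x in `[a, m]) f x + \int[mu]_(x in `[m, b]) f x.
Proof.
move=> am mb cf; have i x y := integrable_continuous x y cf.
have := @Rintegral_itvB R f (BLeft a) (BRight b) m (i _ _).
rewrite !bnd_simp => /(_ am mb); rewrite Rintegral_itv_obnd_cbnd.
  by move=> <-; rewrite addrC subrK.
apply: integrableS (i m b) => //; apply: subset_itvr; by rewrite bnd_simp.
Qed.

Lemma cint_split (f : R -> C) (a m b : R) : a <= m -> m <= b -> continuous f ->
  cint f a b = cint f a m + cint f m b.
Proof.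
move=> am mb cf; apply: eq_ReIm; rewrite ?cReD ?cImD /= (@Rint_split _ a m b)// => x.
  exact: Re_continuous (cf x).
exact: Im_continuous (cf x).
Qed.

Lemma Rint_id (a b : R) : a <= b ->
  \int[mu]_(x in `[a, b]) x = (b ^+ 2 - a ^+ 2) / 2.
Proof.
rewrite le_eqVlt => /orP[/eqP->|ab]; first by rewrite set_itv1 Rintegral_set1 subrr mul0r.
have dF (x : R) : derivable (fun x : R => x ^+ 2 / 2) x 1 by apply: derivableM.
have cF : continuous (fun x : R => x ^+ 2 / 2).
  by move=> x; apply: differentiable_continuous; exact/derivable1_diffP.
rewrite /Rintegral (@continuous_FTC2 R id (fun x => x ^+ 2 / 2) a b ab)//=.
- by rewrite mulrBl.
- apply: (@continuous_subspaceT _ _ _ (id : R -> R)) => x; exact: cvg_id.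
- split.
  + by move=> x _; exact: dF.
  + by apply: cvg_at_right_filter; exact: cF.
  + by apply: cvg_at_left_filter; exact: cF.
- move=> x _; rewrite derive1E deriveM//= derive_cst scaler0 add0r.
  rewrite exp_derive /= expr1 /GRing.scale /= mulr1; by field.
Qed.

Lemma cint_cst (c : C) a b : a <= b -> cint (fun=> c) a b = c * (b - a)%:C.
Proof.
move=> ab.
by apply: eq_ReIm; rewrite ?cReM ?cImM /= Rint_cst// mulr0 ?subr0 ?add0r.
Qed.

Lemma cint_id a b : a <= b ->
  cint (fun x => x%:C) a b = ((b ^+ 2 - a ^+ 2) / 2)%:C.
Proof.
move=> ab; apply: eq_ReIm => /=; first exact: Rint_id.
by rewrite Rint_cst// mul0r.
Qed.

End ComplexIntegral.

(** * Goursat's theorem *)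

Section Goursat.
Variable R : realType.
Local Notation C := R[i].

Lemma nat_above (x : R) : exists k : nat, (0 < k)%N /\ x <= k%:R.
Proof.
exists (Num.truncn `|x|).+1; split => //.
have /andP[_ h] := truncn_itv (normr_ge0 x).
exact: le_trans (ler_norm x) (ltW h).
Qed.

Lemma nested_intervals (lo hi : nat -> R) :
  (forall k, lo k <= lo k.+1) -> (forall k, hi k.+1 <= hi k) ->
  (forall k, lo k <= hi k) -> exists x, forall k, lo k <= x <= hi k.
Proof.
move=> lo_incr hi_decr lohi.
have loM j k : (j <= k)%N -> lo j <= lo k.
  elim: k => [|k IH]; first by rewrite leqn0 => /eqP->.
  rewrite leq_eqVlt => /orP[/eqP->//|]; rewrite ltnS => /IH h; exact: le_trans h (lo_incr k).
have hiM j k : (j <= k)%N -> hi k <= hi j.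
  elim: k => [|k IH]; first by rewrite leqn0 => /eqP->.
  rewrite leq_eqVlt => /orP[/eqP->//|]; rewrite ltnS => /IH h; exact: le_trans (hi_decr k) h.
have cross j k : lo j <= hi k.
  case/orP: (leq_total j k) => jk.
    exact: le_trans (loM _ _ jk) (lohi k).
  exact: le_trans (lohi j) (hiM _ _ jk).
exists (sup (range lo)) => k; apply/andP; split.
  apply: ub_le_sup; last by exists k.
  by exists (hi 0%N) => _ [j _ <-].
by apply: ge_sup; [exists (lo 0%N); exists 0%N|move=> _ [j _ <-]].
Qed.

Lemma half_pow_small (w e : R) : 0 < e -> exists k : nat, w / 2 ^+ k < e.
Proof.
move=> e0; have [k [_ kw]] := nat_above (w / e).
exists k; rewrite ltr_pdivrMr ?exprn_gt0// mulrC -ltr_pdivrMr//.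
by apply: le_lt_trans kw _; rewrite -natrX ltr_nat ltn_expl.
Qed.

(** Otherwise the property would fail on nested quarters, down to the common point
    of all these rectangles. *)
Lemma quarter_induction (P : R -> R -> R -> R -> Prop) (a c w h : R) :
  0 <= w -> 0 <= h ->
  (forall a' c' w' h', 0 <= w' -> 0 <= h' ->
    P a' c' w' h' -> P (a' + w') c' w' h' ->
    P a' (c' + h') w' h' -> P (a' + w') (c' + h') w' h' ->
    P a' c' (w' + w') (h' + h')) ->
  (forall x y, a <= x <= a + w -> c <= y <= c + h ->
    exists2 d : R, 0 < d & forall a' c' w' h',
      a' <= x <= a' + w' -> c' <= y <= c' + h' -> w' + h' < d ->
      P a' c' w' h') ->
  P a c w h.
Proof.
move=> w0 h0 Pquarter Plocal; apply: contrapT => nP.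
pose W k := w / 2 ^+ k; pose H k := h / 2 ^+ k.
have WS k : W k = W k.+1 + W k.+1.
  by rewrite /W exprS; field; rewrite expf_neq0.
have HS k : H k = H k.+1 + H k.+1.
  by rewrite /H exprS; field; rewrite expf_neq0.
have W_ge0 k : 0 <= W k by rewrite divr_ge0// exprn_ge0.
have H_ge0 k : 0 <= H k by rewrite divr_ge0// exprn_ge0.
have step (kp : nat * (R * R)) : exists p' : R * R,
    ~ P kp.2.1 kp.2.2 (W kp.1) (H kp.1) ->
    [/\ ~ P p'.1 p'.2 (W kp.1.+1) (H kp.1.+1),
        kp.2.1 <= p'.1, p'.1 <= kp.2.1 + W kp.1.+1,
        kp.2.2 <= p'.2 & p'.2 <= kp.2.2 + H kp.1.+1].
  case: kp => k [a' c'] /=.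
  set b := a' + W k.+1; set d := c' + H k.+1.
  have [P1|N1] := pselect (P a' c' (W k.+1) (H k.+1)); last first.
    by exists (a', c') => _; split; rewrite //= ?lexx ?lerDl.
  have [P2|N2] := pselect (P b c' (W k.+1) (H k.+1)); last first.
    by exists (b, c') => _; split; rewrite //= ?lexx ?lerDl.
  have [P3|N3] := pselect (P a' d (W k.+1) (H k.+1)); last first.
    by exists (a', d) => _; split; rewrite //= ?lexx ?lerDl.
  have [P4|N4] := pselect (P b d (W k.+1) (H k.+1)); last first.
    by exists (b, d) => _; split; rewrite //= ?lexx ?lerDl.
  by exists (a', c'); case; rewrite WS HS; exact: Pquarter.
have [f fP] := choice step.
pose u := fix u k := if k is k'.+1 then f (k', u k') else (a, c).
have uN k : ~ P (u k).1 (u k).2 (W k) (H k).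
  elim: k => [|k IH]; first by rewrite /W /H expr0 !divr1.
  by have [] := fP (k, u k) IH.
have uP k := fP (k, u k) (uN k).
have [x xP] : exists x, forall k, (u k).1 <= x <= (u k).1 + W k.
  apply: nested_intervals => k.
  - by have [] := uP k.
  - by have [_ _ + _ _] := uP k; rewrite (WS k) /= => ?; rewrite addrA lerD2r.
  - by rewrite lerDl.
have [y yP] : exists y, forall k, (u k).2 <= y <= (u k).2 + H k.
  apply: nested_intervals => k.
  - by have [] := uP k.
  - by have [_ _ _ _ +] := uP k; rewrite (HS k) /= => ?; rewrite addrA lerD2r.
  - by rewrite lerDl.
have := xP 0%N; have := yP 0%N; rewrite /W /H expr0 !divr1 /= => ycd xab.
have [d d0 dP] := Plocal x y xab ycd.
have [k kd] := half_pow_small (w + h) d0.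
by apply: (uN k); apply: dP => //; rewrite /W /H -mulrDl.
Qed.

(** Caratheodory's form of complex differentiability: the difference quotient
    extends continuously. Sums, products and composites then need no estimate. *)
Definition cderivable (f : C -> C) (z : C) :=
  exists q : C -> C, {for z, continuous q} /\
    forall y, f y - f z = (y - z) * q y.

Lemma cont_id : continuous (fun z : C => z).
Proof. by move=> z; exact: cvg_id. Qed.

Definition hint (g : C -> C) (c a b : R) := cint (fun x => g (x +i* c)) a b.
Definition vint (g : C -> C) (a c d : R) := cint (fun y => g (a +i* y)) c d.
(** The contour integral along the rectangle with lower left corner [(a, c)],
    width [w] and height [h], counterclockwise; each side is parametrized by a
    coordinate, hence the factors ['i] on the vertical sides. *)
Definition boundary_int (g : C -> C) (a c w h : R) : C :=
  hint g c a (a + w) + 'i * vint g (a + w) c (c + h)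
  - hint g (c + h) a (a + w) - 'i * vint g a c (c + h).

Lemma cont_h (g : C -> C) c : continuous g -> continuous (fun x : R => g (x +i* c)).
Proof. by move=> cg x; exact: (continuous_comp (@horizontal_continuous R c x) (cg _)). Qed.

Lemma cont_v (g : C -> C) a : continuous g -> continuous (fun y : R => g (a +i* y)).
Proof. by move=> cg y; exact: (continuous_comp (@vertical_continuous R a y) (cg _)). Qed.

Lemma boundary_int_quarters g a c w h : continuous g -> 0 <= w -> 0 <= h ->
  boundary_int g a c (w + w) (h + h) =
  boundary_int g a c w h + boundary_int g (a + w) c w h +
  boundary_int g a (c + h) w h + boundary_int g (a + w) (c + h) w h.
Proof.
move=> cg w0 h0; rewrite /boundary_int !addrA.
have hs y : hint g y a (a + w + w) = hint g y a (a + w) + hint g y (a + w) (a + w + w).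
  by apply: cint_split; rewrite ?lerDl//; exact: cont_h.
have vs x : vint g x c (c + h + h) = vint g x c (c + h) + vint g x (c + h) (c + h + h).
  by apply: cint_split; rewrite ?lerDl//; exact: cont_v.
rewrite !hs !vs; ring.
Qed.

Lemma boundary_int_le g a c w h M : continuous g -> 0 <= w -> 0 <= h ->
  (forall x y, a <= x <= a + w -> c <= y <= c + h -> nc (g (x +i* y)) <= M) ->
  nc (boundary_int g a c w h) <= 4 * M * (w + h).
Proof.
move=> cg w0 h0 gM.
have hle y : c <= y <= c + h -> nc (hint g y a (a + w)) <= 2 * M * w.
  move=> yP; have := @nc_cint_le R (fun x => g (x +i* y)) a (a + w) M.
  rewrite [a + w - a]addrAC subrr add0r; apply; rewrite ?lerDl//; first exact: cont_h.
  by move=> x xP; exact: gM.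
have vle x : a <= x <= a + w -> nc ('i * vint g x c (c + h)) <= 2 * M * h.
  move=> xP; rewrite ncM nc_i mul1r.
  have := @nc_cint_le R (fun y => g (x +i* y)) c (c + h) M.
  rewrite [c + h - c]addrAC subrr add0r; apply; rewrite ?lerDl//; first exact: cont_v.
  by move=> y yP; exact: gM.
have ac : a <= a <= a + w by rewrite lexx lerDl.
have aw : a <= a + w <= a + w by rewrite lexx lerDl w0.
have cc : c <= c <= c + h by rewrite lexx lerDl.
have ch : c <= c + h <= c + h by rewrite lexx lerDl h0.
have h1 := hle _ cc; have h2 := hle _ ch; have v1 := vle _ ac; have v2 := vle _ aw.
apply: le_trans (ncB _ _) _.
apply: le_trans (lerD (le_trans (ncB _ _) (lerD (ncD _ _) (lexx _))) (lexx _)) _.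
lra.
Qed.

Lemma boundary_intB (f g : C -> C) a c w h : continuous f -> continuous g ->
  boundary_int (fun z => f z - g z) a c w h =
  boundary_int f a c w h - boundary_int g a c w h.
Proof.
move=> cf cg.
have hB y : hint (fun z => f z - g z) y a (a + w) = hint f y a (a + w) - hint g y a (a + w).
  exact (@cintB R (fun x => f (x +i* y)) (fun x => g (x +i* y)) a (a + w) (cont_h cf) (cont_h cg)).
have vB x : vint (fun z => f z - g z) x c (c + h) = vint f x c (c + h) - vint g x c (c + h).
  exact (@cintB R (fun y => f (x +i* y)) (fun y => g (x +i* y)) c (c + h) (cont_v cf) (cont_v cg)).
rewrite /boundary_int !hB !vB mulrBr; ring.
Qed.

Lemma boundary_int_affine (al be : C) a c w h : 0 <= w -> 0 <= h ->
  boundary_int (fun z => al + be * z) a c w h = 0.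
Proof.
move=> w0 h0.
have cid : continuous (fun x : R => x%:C) by exact: horizontal_continuous.
have hE y : hint (fun z => al + be * z) y a (a + w) =
    (al + be * ('i * y%:C)) * w%:C + be * (((a + w) ^+ 2 - a ^+ 2) / 2)%:C.
  rewrite /hint.
  under eq_cint => x _ do rewrite complexE2 mulrDr addrCA addrC.
  rewrite cintD; [|exact: contC|exact: (contM (@contC _ R be) cid)].
  rewrite cint_cst ?lerDl// cintZ// cint_id ?lerDl//.
  by rewrite [a + w - a]addrAC subrr add0r.
have vE x : vint (fun z => al + be * z) x c (c + h) =
    (al + be * x%:C) * h%:C + be * 'i * (((c + h) ^+ 2 - c ^+ 2) / 2)%:C.
  rewrite /vint.
  under eq_cint => y _ do rewrite complexE2 mulrDr addrA mulrA.
  rewrite cintD; [|exact: contC|exact: (contM (@contC _ R (be * 'i)) cid)].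
  rewrite cint_cst ?lerDl// cintZ// cint_id ?lerDl//.
  by rewrite [c + h - c]addrAC subrr add0r.
rewrite /boundary_int !hE !vE !RCD; ring.
Qed.

(** On a rectangle small enough around a point of differentiability, [g] is an
    affine function, which integrates to 0, plus an error that is small compared
    with the side lengths; bisection makes this estimate global. *)
Lemma goursat (g : C -> C) (a c w h : R) : continuous g -> 0 <= w -> 0 <= h ->
  (forall x y, a <= x <= a + w -> c <= y <= c + h -> cderivable g (x +i* y)) ->
  boundary_int g a c w h = 0.
Proof.
move=> cg w0 h0 dg; apply/eqP; rewrite -nc_eq0; apply/eqP/le_anti.
rewrite nc_ge0 andbT; apply/ler_addgt0Pr => e e0; rewrite add0r.
suff H (e' : R) : 0 < e' -> nc (boundary_int g a c w h) <= e' * (w + h) ^+ 2.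
  have d0 : 0 < (w + h) ^+ 2 + 1 by rewrite ltr_wpDl ?sqr_ge0.
  apply: le_trans (H (e / ((w + h) ^+ 2 + 1)) (divr_gt0 e0 d0)) _.
  by rewrite mulrAC ler_pdivrMr// ler_wpM2l// ?lerDl// ltW.
move=> {}e0.
apply: (@quarter_induction (fun a c w h => nc (boundary_int g a c w h) <= e' * (w + h) ^+ 2)) => //.
  move=> a' c' w' h' w'0 h'0 p1 p2 p3 p4; rewrite boundary_int_quarters//.
  apply: le_trans (ncD _ _) _.
  apply: le_trans (lerD (le_trans (ncD _ _) (lerD (ncD _ _) (lexx _))) (lexx _)) _.
  apply: le_trans (lerD (lerD (lerD p1 p2) p3) p4) _.
  by rewrite le_eqVlt; apply/orP; left; apply/eqP; ring.
move=> x y xP yP; have [q [cq qE]] := dg x y xP yP.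
set p := x +i* y in cq qE.
have e4 : 0 < e' / 4 by rewrite divr_gt0.
have [d d0 dq] := (continuous_epsP q p).1 cq _ e4.
exists d => // a' c' w' h' xP' yP' wh.
have w'0 : 0 <= w' by move/andP: xP' => [h1 h2]; have := le_trans h1 h2; rewrite lerDl.
have h'0 : 0 <= h' by move/andP: yP' => [h1 h2]; have := le_trans h1 h2; rewrite lerDl.
pose A (z : C) := (g p - q p * p) + q p * z.
have cA : continuous A := contD (@contC _ C (g p - q p * p)) (contM (@contC _ C (q p)) cont_id).
have -> : boundary_int g a' c' w' h' = boundary_int (fun z => g z - A z) a' c' w' h'.
  by rewrite boundary_intB// boundary_int_affine// subr0.
have -> : e' * (w' + h') ^+ 2 = 4 * (e' / 4 * (w' + h')) * (w' + h') by field.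
apply: (boundary_int_le (contB cg cA) w'0 h'0).
move=> s t sP tP.
have -> : g (s +i* t) - A (s +i* t) = (s +i* t - p) * (q (s +i* t) - q p).
  rewrite mulrBr -qE /A; ring.
rewrite ncM mulrC.
have stp : nc (s +i* t - p) <= w' + h'.
  apply: le_trans (nc_le_ReIm _) _ => /=; apply: lerD.
    by rewrite ler_norml; apply/andP; split; lra.
  by rewrite ler_norml; apply/andP; split; lra.
apply: ler_pM; rewrite ?nc_ge0//; apply/ltW/dq; exact: le_lt_trans wh.
Qed.

End Goursat.

(** * Complex differentiability *)

Section CDerivable.
Variable R : realType.
Local Notation C := R[i].

Lemma cont_sub (u z : C) : {for z, continuous (fun y : C => y - u)}.
Proof. by have h := contB (@cont_id R) (@contC R C u); exact: h. Qed.

Lemma contV_at (f : C -> C) (z : C) : f z != 0 -> {for z, continuous f} ->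
  {for z, continuous (fun y => (f y)^-1)}.
Proof. by move=> f0 cf; exact: (continuousV f0 cf). Qed.

Lemma cderivable_continuous (f : C -> C) z : cderivable f z -> {for z, continuous f}.
Proof.
move=> [q [cq qE]].
have -> : f = (fun y => f z + (y - z) * q y).
  by apply/funext => y; rewrite -qE addrC subrK.
have c1 : {for z, continuous (fun y : C => y - z)}.
  exact: cont_sub.
exact: (continuousD (@cst_continuous _ _ (f z) z) (continuousM c1 cq)).
Qed.

Lemma cderivable_cst (c z : C) : cderivable (fun=> c) z.
Proof.
exists (fun=> 0); split; first exact: cst_continuous.
by move=> y; rewrite subrr mulr0.
Qed.

Lemma cderivable_id (z : C) : cderivable (fun y => y) z.
Proof.
exists (fun=> 1); split; first exact: cst_continuous.
by move=> y; rewrite mulr1.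
Qed.

Lemma cderivableD (f g : C -> C) z : cderivable f z -> cderivable g z ->
  cderivable (fun y => f y + g y) z.
Proof.
move=> [p [cp pE]] [q [cq qE]]; exists (fun y => p y + q y); split.
  exact: (continuousD cp cq).
by move=> y; rewrite mulrDr -pE -qE; ring.
Qed.

Lemma cderivableM (f g : C -> C) z : cderivable f z -> cderivable g z ->
  cderivable (fun y => f y * g y) z.
Proof.
move=> [p [cp pE]] /[dup] /cderivable_continuous cg [q [cq qE]].
exists (fun y => p y * g y + f z * q y); split.
  exact: (continuousD (continuousM cp cg) (continuousM (@cst_continuous _ _ (f z) z) cq)).
move=> y; rewrite mulrDr mulrA -pE mulrCA -qE; ring.
Qed.

Lemma cderivableX (f : C -> C) k z : cderivable f z -> cderivable (fun y => f y ^+ k) z.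
Proof.
move=> df; elim: k => [|k IH]; first exact: cderivable_cst.
by under eq_fun do rewrite exprS; exact: cderivableM.
Qed.

Lemma cderivable_comp (f g : C -> C) z : cderivable g z -> cderivable f (g z) ->
  cderivable (fun y => f (g y)) z.
Proof.
move=> /[dup] /cderivable_continuous cg [q [cq qE]] [p [cp pE]].
exists (fun y => q y * p (g y)); split.
  exact: (continuousM cq (continuous_comp cg cp)).
by move=> y; rewrite mulrA -qE pE.
Qed.

Lemma cderivable_eps (f : C -> C) (l z : C) :
  (forall e : R, 0 < e -> exists2 d : R, 0 < d & forall y, nc (y - z) < d ->
     nc (f y - f z - l * (y - z)) <= e * nc (y - z)) -> cderivable f z.
Proof.
move=> H; pose q y := if y == z then l else (f y - f z) / (y - z).
exists q; split; last first.
  move=> y; rewrite /q; case: eqVneq => [->|yz]; first by rewrite !subrr mul0r.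
  by rewrite mulrC divfK// subr_eq0.
apply/continuous_epsP => e e0.
have e2 : 0 < e / 2 by rewrite divr_gt0.
have [d d0 dP] := H _ e2; exists d => // y yd.
have [->|yz] := eqVneq y z; first by rewrite subrr nc0.
rewrite /q eqxx (negbTE yz).
have yz0 : 0 < nc (y - z) by rewrite nc_gt0 subr_eq0.
apply: (@le_lt_trans _ _ (e / 2)); last lra.
rewrite -(ler_pM2r yz0) -ncM mulrBl divfK ?subr_eq0//; exact: dP.
Qed.

(** The difference quotient of an everywhere differentiable function at [z0] is
    continuous everywhere and differentiable off [z0]: this is all that is known
    before holomorphic functions are shown to be analytic. *)
Lemma difference_quotient (f : C -> C) (z0 : C) : (forall z, cderivable f z) ->
  exists q : C -> C, [/\ continuous q, forall z, z != z0 -> cderivable q z &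
    forall y, f y - f z0 = (y - z0) * q y].
Proof.
move=> df; have [q [cq0 qE]] := df z0; exists q.
have cq z : {for z, continuous q}.
  have [->//|zz0] := eqVneq z z0.
  have [p [cp pE]] := df z.
  pose r y := q z + (y - z) * (p y - q z) * (y - z0)^-1.
  have rq y : y != z0 -> r y = q y.
    move=> yz0; have yz0' : y - z0 != 0 by rewrite subr_eq0.
    apply: (mulfI yz0'); rewrite /r mulrDr mulrCA divff// mulr1 -qE mulrBr -pE.
    have -> : f y = f z0 + (y - z0) * q y by rewrite -qE addrC subrK.
    have -> : f z = f z0 + (z - z0) * q z by rewrite -qE addrC subrK.
    ring.
  have cr : {for z, continuous r}.
    have c1 (u : C) : {for z, continuous (fun y : C => y - u)} by exact: cont_sub.
    have c2 := continuousB cp (@cst_continuous _ _ (q z) z).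
    have zz0' : z - z0 != 0 by rewrite subr_eq0.
    have c3 := contV_at (f := fun y => y - z0) zz0' (c1 z0).
    exact: (continuousD (@cst_continuous _ _ (q z) z) (continuousM (continuousM (c1 z) c2) c3)).
  apply/continuous_epsP => e /(proj1 (continuous_epsP _ _) cr)[d d0 dP].
  have zz0' : 0 < nc (z - z0) by rewrite nc_gt0 subr_eq0.
  exists (Num.min d (nc (z - z0))); first by rewrite lt_min d0.
  move=> y; rewrite lt_min => /andP[yd yz]; rewrite -!rq//; first exact: dP.
  by apply: contraTneq yz => ->; rewrite ncBC ltxx.
split => // z zz0; have [p [cp pE]] := df z.
have zz0' : z - z0 != 0 by rewrite subr_eq0.
exists (fun y => (p y - q y) * (z - z0)^-1); split.
  exact: (continuousM (continuousB cp (cq z)) (@cst_continuous _ _ (z - z0)^-1 z)).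
move=> y; apply: (mulfI zz0'); rewrite mulrCA [X in (y - z) * X]mulrCA divff// mulr1.
rewrite [RHS]mulrBr -pE.
have -> : f y = f z0 + (y - z0) * q y by rewrite -qE addrC subrK.
have -> : f z = f z0 + (z - z0) * q z by rewrite -qE addrC subrK.
ring.
Qed.

End CDerivable.

(** * The complex exponential *)

Section ComplexExponential.
Variable R : realType.
Local Notation C := R[i].

Definition cexp (z : C) : C :=
  (expR (complex.Re z) * cos (complex.Im z)) +i*
  (expR (complex.Re z) * sin (complex.Im z)).

Lemma cexpD x y : cexp (x + y) = cexp x * cexp y.
Proof.
by apply: eq_ReIm; rewrite ?cReM ?cImM /= cReD cImD expRD ?cosD ?sinD; ring.
Qed.

Lemma cexp0 : cexp 0 = 1.
Proof. by apply: eq_ReIm => /=; rewrite expR0 mul1r ?cos0 ?sin0. Qed.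

Lemma nc_cexp z : nc (cexp z) = expR (complex.Re z).
Proof.
rewrite ncE /=; set a := complex.Re z; set b := complex.Im z.
have -> : (expR a * cos b) ^+ 2 + (expR a * sin b) ^+ 2 = expR a ^+ 2 * (cos b ^+ 2 + sin b ^+ 2) by ring.
by rewrite cos2Dsin2 mulr1 sqrtr_sqr ger0_norm// expR_ge0.
Qed.

Lemma cexp_2pi a : cexp (a +i* (pi *+ 2)) = cexp (a +i* 0).
Proof. by rewrite /cexp /= cos2pi sin2pi cos0 sin0. Qed.

Lemma real_derive_eps (f : R -> R) (x l : R) : is_derive x 1 f l ->
  forall e : R, 0 < e -> exists2 d : R, 0 < d & forall h, `|h| < d ->
     `|f (x + h) - f x - l * h| <= e * `|h|.
Proof.
move=> [df dl] e e0.
have : h^-1 *: ((f \o shift x) (h *: (1 : R)) - f x) @[h --> 0^'] --> l.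
  by rewrite -dl; exact: df.
move=> /cvgrPdist_le /(_ e e0) /nbhs_RP [d d0 dP].
exists d => // h hd; have [->|h0] := eqVneq h 0.
  by rewrite addr0 subrr mulr0 subrr normr0 mulr0.
have := dP h; rewrite subr0 => /(_ hd h0) /=.
have hp : 0 < `|h| by rewrite normr_gt0.
rewrite -(ler_pM2r hp) -normrM distrC; apply: le_trans.
rewrite /GRing.scale /= mulr1 [h + x]addrC mulrBl.
by rewrite mulrAC mulVf// mul1r.
Qed.

(** The derivative of the complex exponential at 0, from the real derivatives of
    exp, cos and sin at 0. *)
Lemma cexp_near0 (e : R) : 0 < e -> exists2 d : R, 0 < d & forall h : C, nc h < d ->
  nc (cexp h - 1 - h) <= e * nc h.
Proof.
move=> e0; pose e' := Num.min 1 (e / 6).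
have e'0 : 0 < e' by rewrite lt_min ltr01 divr_gt0.
have [d1 d10 H1] := real_derive_eps (@is_derive_expR R 0) e'0.
have [d2 d20 H2] := real_derive_eps (@is_derive_cos R 0) e'0.
have [d3 d30 H3] := real_derive_eps (@is_derive_sin R 0) e'0.
exists (Num.min (Num.min d1 d2) (Num.min d3 (e' / 2))).
  by rewrite !lt_min d10 d20 d30 divr_gt0.
move=> h; rewrite !lt_min => /andP[/andP[hd1 hd2] /andP[hd3 he]].
have hx := nc_Re h; have hy := nc_Im h.
set x := complex.Re h in hx *; set y := complex.Im h in hy *.
have {}H1 := H1 x (le_lt_trans hx hd1).
have {}H2 := H2 y (le_lt_trans hy hd2).
have {}H3 := H3 y (le_lt_trans hy hd3).
rewrite expR0 mul1r add0r in H1.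
rewrite cos0 sin0 oppr0 mul0r subr0 add0r in H2.
rewrite sin0 cos0 mul1r subr0 add0r in H3.
have e'1 : e' <= 1 by rewrite ge_min lexx.
have e'6 : e' <= e / 6 by rewrite ge_min lexx orbT.
have xe : `|x| < e' / 2 by exact: le_lt_trans he.
have E1 : `|expR x - 1| <= e'.
  have -> : expR x - 1 = (expR x - 1 - x) + x by ring.
  apply: le_trans (ler_normD _ _) _.
  have : e' * `|x| <= 1 * `|x| by rewrite ler_wpM2r.
  lra.
have E2 : `|expR x| <= 2.
  have -> : expR x = (expR x - 1) + 1 by ring.
  by apply: le_trans (ler_normD _ _) _; rewrite normr1; lra.
have h0 := nc_ge0 h.
apply: le_trans (nc_le_ReIm _) _; rewrite !cReB !cImB /= -/x -/y subr0.
have -> : expR x * cos y - 1 - x = (expR x - 1 - x) + expR x * (cos y - 1) by ring.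
have -> : expR x * sin y - y = expR x * (sin y - y) + (expR x - 1) * y by ring.
have A1 : `|expR x * (cos y - 1)| <= 2 * (e' * nc h).
  by rewrite normrM ler_pM// (le_trans H2)// ler_wpM2l// ltW.
have A2 : `|expR x * (sin y - y)| <= 2 * (e' * nc h).
  by rewrite normrM ler_pM// (le_trans H3)// ler_wpM2l// ltW.
have A3 : `|(expR x - 1) * y| <= e' * nc h by rewrite normrM ler_pM.
have A4 : `|expR x - 1 - x| <= e' * nc h.
  by rewrite (le_trans H1)// ler_wpM2l// ltW.
have A5 : e' * nc h <= e / 6 * nc h by rewrite ler_wpM2r.
apply: le_trans (lerD (ler_normD _ _) (ler_normD _ _)) _.
lra.
Qed.

Lemma cexp_cderivable z : cderivable cexp z.
Proof.
apply: (@cderivable_eps _ _ (cexp z)) => e e0.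
have c0 : 0 < nc (cexp z) by rewrite nc_cexp expR_gt0.
have e1 : 0 < e / nc (cexp z) by rewrite divr_gt0.
have [d d0 dP] := cexp_near0 e1; exists d => // y yd.
have -> : cexp y - cexp z - cexp z * (y - z) = cexp z * (cexp (y - z) - 1 - (y - z)).
  rewrite -{1}(subrK z y) cexpD; ring.
rewrite ncM; apply: le_trans (ler_wpM2l (nc_ge0 _) (dP _ yd)) _.
by rewrite mulrA [nc (cexp z) * _]mulrC divfK// gt_eqF.
Qed.

Lemma cexp_continuous : continuous cexp.
Proof. by move=> z; exact: cderivable_continuous (cexp_cderivable z). Qed.

End ComplexExponential.

(** * Cauchy's estimates *)

Section CauchyTaylor.
Variable R : realType.
Local Notation C := R[i].
Local Notation T := (pi *+ 2 : R).

Lemma T_gt0 : 0 < T.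
Proof. by rewrite mulrn_wgt0// pi_gt0. Qed.

(** The integral of [h] over the circle of radius [expR s] with respect to the
    angle, written as a vertical integral of [h \o cexp]. *)
Definition circle_int (h : C -> C) (s : R) : C := vint (fun w => h (cexp w)) s 0 T.

Lemma cont_cexp (h : C -> C) : continuous h -> continuous (fun w => h (cexp w)).
Proof. by move=> ch w; exact: (continuous_comp (@cexp_continuous R w) (ch _)). Qed.

(** Goursat's theorem on a rectangle of height [2 * pi] in the logarithmic
    coordinate: by periodicity the horizontal sides cancel. *)
Lemma circle_int_const (h : C -> C) (s1 s2 : R) : continuous h -> s1 <= s2 ->
  (forall z, expR s1 <= nc z <= expR s2 -> cderivable h z) ->
  circle_int h s1 = circle_int h s2.
Proof.
move=> ch s12 dh; have cg := cont_cexp ch.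
have w0 : 0 <= s2 - s1 by rewrite subr_ge0.
have := @goursat R _ s1 0 (s2 - s1) T cg w0 (ltW T_gt0).
have -> : s1 + (s2 - s1) = s2 by rewrite addrC subrK.
move=> G; have {}G : boundary_int (fun w => h (cexp w)) s1 0 (s2 - s1) T = 0.
  apply: G => x y xs _; apply: cderivable_comp; first exact: cexp_cderivable.
  by apply: dh; rewrite nc_cexp /= !ler_expR.
move: G; rewrite /boundary_int !add0r.
have -> : s1 + (s2 - s1) = s2 by rewrite addrC subrK.
have -> : hint (fun w => h (cexp w)) T s1 s2 = hint (fun w => h (cexp w)) 0 s1 s2.
  by apply: eq_cint => x _; rewrite cexp_2pi.
rewrite -/(circle_int h s1) -/(circle_int h s2).
rewrite [hint _ _ _ _ + _]addrC addrK -mulrBr => /eqP.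
by rewrite mulf_eq0 -nc_eq0 nc_i oner_eq0 /= subr_eq0 => /eqP ->.
Qed.

Lemma circle_int_cvg (h : C -> C) (s e : R) : continuous h -> 0 < e ->
  exists2 d : R, 0 < d & forall s', `|s' - s| < d ->
    nc (circle_int h s' - circle_int h s) <= e.
Proof.
move=> ch e0; have cg := cont_cexp ch.
pose e' := e / (2 * T).
have T2 : 0 < 2 * T by rewrite mulr_gt0// T_gt0.
have e'0 : 0 < e' by rewrite divr_gt0.
pose g (x t : R) := h (cexp (x +i* t)).
have : \forall s' \near s, forall t, `[0, T]%classic t -> nc (g s' t - g s t) < e'.
  have := @compact_near_coveringP _ `[0, T]%classic.
  move=> [/(_ (@segment_compact R 0 T)) + _].
  move=> /(_ R (nbhs s) (fun s' t => nc (g s' t - g s t) < e') _); apply.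
  move=> t _.
  have [d d0 dP] := (continuous_epsP _ (s +i* t)).1 (cg _) _ (divr_gt0 e'0 (ltr0Sn R 1)).
  have d2 : 0 < d / 2 by rewrite divr_gt0.
  exists (`]t - d / 2, t + d / 2[%classic, `]s - d / 2, s + d / 2[%classic).
    split; apply: near_in_itvoo; rewrite in_itv /=; apply/andP; split; lra.
  move=> [t' s'] /= [+ +]; rewrite !in_itv /= => tt' ss'.
  rewrite /g; set a := cexp (s' +i* t'); set b := cexp (s +i* t').
  have -> : h a - h b = (h a - h (cexp (s +i* t))) - (h b - h (cexp (s +i* t))) by ring.
  have H1 : nc (h a - h (cexp (s +i* t))) < e' / 2.
    apply: dP; apply: le_lt_trans (nc_le_ReIm _) _; rewrite /= .
    have : `|s' - s| < d / 2 by rewrite ltr_norml; apply/andP; split; lra.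
    have : `|t' - t| < d / 2 by rewrite ltr_norml; apply/andP; split; lra.
    lra.
  have H2 : nc (h b - h (cexp (s +i* t))) < e' / 2.
    apply: dP; apply: le_lt_trans (nc_le_ReIm _) _; rewrite /= subrr normr0.
    have : `|t' - t| < d / 2 by rewrite ltr_norml; apply/andP; split; lra.
    lra.
  apply: le_lt_trans (ncB _ _) _; lra.
move=> /nbhs_RP[d d0 dP]; exists d => // s' /dP H.
rewrite /circle_int /vint.
have c1 (x : R) : continuous (fun t => g x t) by exact: (@cont_v R (fun w => h (cexp w)) x cg).
have -> : cint (fun y => h (cexp (s' +i* y))) 0 T - cint (fun y => h (cexp (s +i* y))) 0 T
  = cint (fun t => g s' t - g s t) 0 T.
  exact: (esym (cintB 0 T (c1 s') (c1 s))).
have -> : e = 2 * e' * (T - 0) by rewrite subr0 mulrAC mulrC divfK// gt_eqF.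
apply: (nc_cint_le (ltW T_gt0) (contB (c1 s') (c1 s))) => t tT.
by apply/ltW/H; rewrite /= in_itv.
Qed.

(** The circle means are constant on both sides of the circle through [z0],
    continuous across it, and tend to 0 at the origin since [h] does. For
    [h z = (f z - f z0) / (z - z0) * z] this is Cauchy's formula. *)
Lemma circle_int_eq0 (h : C -> C) (z0 : C) (s : R) : continuous h -> h 0 = 0 ->
  (forall z, nc z != nc z0 -> cderivable h z) -> circle_int h s = 0.
Proof.
move=> ch h0 dh.
have small (e : R) : 0 < e -> exists S, forall s', s' <= S -> nc (circle_int h s') <= e.
  move=> e0; have e'0 : 0 < e / (2 * T) by rewrite divr_gt0// mulr_gt0// T_gt0.
  have [d d0 dP] := (continuous_epsP h 0).1 (ch 0) _ e'0.
  exists (ln (d / 2)) => s' s'S.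
  have -> : e = 2 * (e / (2 * T)) * (T - 0) by rewrite subr0 mulrAC mulrC divfK// gt_eqF// mulr_gt0// T_gt0.
  apply: (nc_cint_le (ltW T_gt0) (@cont_v R (fun w => h (cexp w)) s' (cont_cexp ch))) => t _.
  have := dP (cexp (s' +i* t)); rewrite h0 !subr0 nc_cexp /= => H; apply/ltW/H.
  have : expR s' <= d / 2 by rewrite -[d / 2]lnK ?ler_expR// posrE divr_gt0.
  lra.
have eq0 x : (forall e : R, 0 < e -> nc (circle_int h x) <= e) -> circle_int h x = 0.
  move=> H; apply/eqP; rewrite -nc_eq0; apply/eqP/le_anti; rewrite nc_ge0 andbT.
  by apply/ler_addgt0Pr => e /H; rewrite add0r.
have below x : expR x < nc z0 \/ z0 = 0 -> circle_int h x = 0.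
  move=> xz; apply: eq0 => e /small [S HS].
  have -> : circle_int h x = circle_int h (Num.min x S).
    apply/esym; apply: circle_int_const => //; first by rewrite ge_min lexx.
    move=> z /andP[z1 z2]; apply: dh; apply/eqP => zz.
    case: xz => [|z00]; first by rewrite -zz ltNge z2.
    by move: z1; rewrite zz z00 nc0 leNgt expR_gt0.
  by apply: HS; rewrite ge_min lexx orbT.
have [z00|z00] := eqVneq z0 0; first by apply: below; right.
have nz0 : 0 < nc z0 by rewrite nc_gt0.
pose s0 := ln (nc z0).
have es0 : expR s0 = nc z0 by rewrite lnK.
have at0 : circle_int h s0 = 0.
  apply: eq0 => e e0; have [d d0 dP] := circle_int_cvg s0 ch e0.
  have := dP (s0 - d / 2); rewrite (below (s0 - d / 2)).
    rewrite sub0r ncN; apply; rewrite addrAC subrr add0r normrN ger0_norm; lra.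
  by left; rewrite -es0 ltr_expR; lra.
have [ss0|ss0|->//] := ltgtP s s0.
  by apply: below; left; rewrite -es0 ltr_expR.
apply: eq0 => e e0; have [d d0 dP] := circle_int_cvg s0 ch e0.
pose s' := Num.min s (s0 + d / 2).
have s's0 : s0 < s' by rewrite lt_min ss0; lra.
have <- : circle_int h s' = circle_int h s.
  apply: circle_int_const => //; first by rewrite ge_min lexx.
  move=> z /andP[z1 _]; apply: dh; rewrite gt_eqF//.
  by rewrite -es0; apply: lt_le_trans z1; rewrite ltr_expR.
have := dP s'; rewrite at0 subr0; apply.
have : s' <= s0 + d / 2 by rewrite ge_min lexx orbT.
by move=> ?; rewrite ger0_norm; lra.
Qed.

Lemma RCX (a : R) k : (a ^+ k)%:C = a%:C ^+ k.
Proof. by rewrite rmorphXn. Qed.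

Lemma negRC (x t : R) : -1 * (x +i* t) = (- x) +i* (- t).
Proof. by apply: eq_ReIm => /=; ring. Qed.

Definition einv (s t : R) : C := cexp ((- s) +i* (- t)).

Lemma einvP s t : cexp (s +i* t) * einv s t = 1.
Proof.
rewrite /einv -cexpD -cexp0; congr cexp.
by apply: eq_ReIm; rewrite /= subrr.
Qed.

Lemma cont_circle (s : R) : continuous (fun t : R => cexp (s +i* t)).
Proof. exact: (@cont_v R (@cexp R) s (@cexp_continuous R)). Qed.

Lemma cont_einv (s : R) : continuous (einv s).
Proof.
have -> : einv s = fun t => cexp (-1 * (s +i* t)).
  by apply/funext => t; rewrite negRC.
have c1 : continuous (fun z : C => cexp (-1 * z)).
  have c2 := contM (@contC R C (-1)) (@cont_id R).
  by move=> z; exact: (continuous_comp (c2 z) (@cexp_continuous R _)).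
exact: (@cont_v R (fun z => cexp (-1 * z)) s c1).
Qed.

(** By Goursat's theorem this integral does not depend on the radius [expR s],
    yet it is homogeneous of degree [- k] in the radius. *)
Lemma int_einvX (s : R) k : (0 < k)%N -> cint (fun t => einv s t ^+ k) 0 T = 0.
Proof.
move=> k0.
pose g (z : C) := cexp (-1 * z) ^+ k.
have dg z : cderivable g z.
  apply: cderivableX; apply: (@cderivable_comp _ _ (fun z => -1 * z)); last exact: cexp_cderivable.
  by apply: cderivableM; [exact: cderivable_cst|exact: cderivable_id].
have cg : continuous g by move=> z; exact: cderivable_continuous.
have gE (x t : R) : g (x +i* t) = einv x t ^+ k.
  by rewrite /g negRC.
have VE x : vint g x 0 T = (expR (- x) ^+ k)%:C * cint (fun t => einv 0 t ^+ k) 0 T.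
  rewrite -cintZ; last exact: (contX (@cont_einv 0)).
  apply: eq_cint => t _; rewrite gE RCX -exprMn; congr (_ ^+ k).
  have -> : (expR (- x))%:C = cexp ((- x)%:C).
    by apply: eq_ReIm => /=; rewrite ?cos0 ?sin0 ?mulr0 ?mulr1.
  by rewrite -cexpD; congr cexp; apply: eq_ReIm => /=; rewrite ?oppr0 ?addr0 ?add0r.
suff V0 : cint (fun t => einv 0 t ^+ k) 0 T = 0.
  transitivity (vint g s 0 T); first by apply: eq_cint => t _; rewrite gE.
  by rewrite VE V0 mulr0.
have := @goursat R g 0 0 1 T cg ler01 (ltW T_gt0) (fun _ _ _ _ => dg _).
rewrite /boundary_int !add0r.
have -> : hint g T 0 1 = hint g 0 0 1.
  apply: eq_cint => x _; congr (_ ^+ k).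
  by rewrite !negRC oppr0 /cexp /= cosN sinN cos2pi sin2pi cos0 sin0 oppr0.
rewrite [hint _ _ _ _ + _]addrC addrK -mulrBr => /eqP.
rewrite mulf_eq0 -nc_eq0 nc_i oner_eq0 /= !VE -mulrBl mulf_eq0 => /orP[|/eqP//].
rewrite -RCB -nc_eq0 nc_real normr_eq0 oppr0 expR0 expr1n subr_eq0 => /eqP H.
have : expR (- 1 : R) ^+ k < 1 by rewrite exprn_ilt1 ?expR_ge0// ?expR_lt1 ?ltrN10// -lt0n.
by rewrite H ltxx.
Qed.

Lemma cint_sum (N : nat) (f : nat -> R -> C) (a b : R) :
  (forall k, continuous (f k)) -> a <= b ->
  cint (fun t => \sum_(k < N) f k t) a b = \sum_(k < N) cint (f k) a b.
Proof.
move=> cf ab.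
have cs M : continuous (fun t => \sum_(k < M) f k t).
  elim: M => [|M IH]; first by under eq_fun do rewrite big_ord0; exact: contC.
  by under eq_fun do rewrite big_ord_recr /=; exact: (contD IH (cf M)).
elim: N => [|N IH].
  by under eq_cint do rewrite big_ord0; rewrite big_ord0 cint_cst// mul0r.
under eq_cint do rewrite big_ord_recr /=.
by rewrite (cintD _ _ (cs N) (cf N)) IH big_ord_recr.
Qed.

(** Multiplying the difference quotient by the truncated geometric series of the
    Cauchy kernel leaves a remainder with the factor [z ^+ N]. *)
Lemma geometric_circle (e e' z q : C) N : e * e' = 1 ->
  \sum_(k < N) z ^+ k * ((e - z) * q * e' ^+ k) = q * e - z ^+ N * (q * e * e' ^+ N).
Proof.
move=> ee; elim: N => [|N IH]; first by rewrite big_ord0 !expr0 mulr1 mul1r subrr.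
rewrite big_ord_recr /= IH !exprS.
have H : e' ^+ N = e * (e' * e' ^+ N) by rewrite mulrA ee mul1r.
rewrite {1 2}H; ring.
Qed.

(** Cauchy's formula, its kernel expanded into a finite geometric series; the
    coefficients are integrals over the circle of radius [r]. The estimate depends
    on [f] through the bound [M] alone, which makes it uniform in parameters. *)
Theorem cauchy_taylor (f : C -> C) (r M : R) : 0 < r ->
  (forall z, cderivable f z) -> (forall z, nc z <= r -> nc (f z) <= M) ->
  exists c : nat -> C, forall N z, (0 < N)%N -> nc z <= r / 2 ->
    nc (f z - \sum_(k < N) c k * z ^+ k) <= 8 * M * (nc z / r) ^+ N.
Proof.
move=> r0 df fM; pose s := ln r; have es : expR s = r by rewrite lnK.
have T0 := T_gt0; have TC : T%:C != 0 by rewrite -nc_eq0 nc_real normr_eq0 gt_eqF.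
have cf : continuous f by move=> z; exact: cderivable_continuous.
pose e t := cexp (s +i* t).
have ce : continuous e := @cont_circle s.
have nce t : nc (e t) = r by rewrite nc_cexp.
have nce' t : nc (einv s t) = r^-1 by rewrite nc_cexp /= expRN es.
have cfe : continuous (fun t => f (e t)).
  exact: (@cont_v R (fun w => f (cexp w)) s (cont_cexp cf)).
have cX k := contX (k := k) (@cont_einv s).
pose c k := T%:C^-1 * cint (fun t => f (e t) * einv s t ^+ k) 0 T.
exists c => N z N0 zr.
have M0 : 0 <= M by apply: le_trans (nc_ge0 (f 0)) (fM 0 _); rewrite nc0 ltW.
have [q [cq dq qE]] := difference_quotient z df.
pose h w := q w * w.
have ch : continuous h := contM cq (@cont_id R).
have I0 : circle_int h s = 0.
  apply: (circle_int_eq0 s (z0 := z) ch); first by rewrite /h mulr0.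
  move=> w wz; apply: cderivableM; last exact: cderivable_id.
  by apply: dq; apply: contraNneq wz => ->.
have cqe : continuous (fun t => q (e t) * e t).
  exact: (@cont_v R (fun w => h (cexp w)) s (cont_cexp ch)).
have cN : continuous (fun t => q (e t) * e t * einv s t ^+ N) := contM cqe (cX N).
have key : \sum_(k < N) z ^+ k * cint (fun t => (e t - z) * q (e t) * einv s t ^+ k) 0 T
    = - z ^+ N * cint (fun t => q (e t) * e t * einv s t ^+ N) 0 T.
  have cterm k : continuous (fun t => (e t - z) * q (e t) * einv s t ^+ k).
    have -> : (fun t => (e t - z) * q (e t) * einv s t ^+ k) =
       (fun t => (f (e t) - f z) * einv s t ^+ k) by apply/funext => t; rewrite qE.
    exact: (contM (contB cfe (@contC R R (f z))) (cX k)).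
  transitivity (cint (fun t => \sum_(k < N) z ^+ k * ((e t - z) * q (e t) * einv s t ^+ k)) 0 T).
    have ct2 k : continuous (fun t => z ^+ k * ((e t - z) * q (e t) * einv s t ^+ k)).
      exact: (contM (@contC R R (z ^+ k)) (cterm k)).
    have -> := @cint_sum N (fun k t => z ^+ k * ((e t - z) * q (e t) * einv s t ^+ k)) 0 T ct2 (ltW T0).
    by apply: eq_bigr => k _; rewrite (cintZ (z ^+ k) 0 T (cterm k)).
  under eq_cint => t _ do rewrite (geometric_circle z (q (e t)) N (einvP s t)).
  rewrite (cintB 0 T cqe (contM (@contC R R (z ^+ N)) cN)).
  rewrite (cintZ (z ^+ N) 0 T cN).
  have -> : cint (fun t => q (e t) * e t) 0 T = 0 := I0.
  by rewrite sub0r mulNr.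
have lhs : \sum_(k < N) z ^+ k * cint (fun t => (e t - z) * q (e t) * einv s t ^+ k) 0 T
    = T%:C * (\sum_(k < N) c k * z ^+ k - f z).
  have term k : cint (fun t => (e t - z) * q (e t) * einv s t ^+ k) 0 T =
      T%:C * c k - f z * (T%:C *+ (k == 0)%N).
    transitivity (cint (fun t => f (e t) * einv s t ^+ k - f z * einv s t ^+ k) 0 T).
      by apply: eq_cint => t _; rewrite -qE mulrBl.
    rewrite (cintB 0 T (contM cfe (cX k)) (contM (@contC R R (f z)) (cX k))).
    rewrite (cintZ (f z) 0 T (cX k)) /c mulrA divff// mul1r; congr (_ - _ * _).
    case: k => [|k] /=; last by rewrite int_einvX.
    by rewrite (cint_cst 1 (ltW T0)) mul1r subr0.
  under eq_bigr do rewrite term mulrBr.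
  rewrite sumrB mulrBr mulr_sumr; congr (_ - _).
    by apply: eq_bigr => k _; rewrite mulrCA [z ^+ k * _]mulrC.
  case: N N0 {key cN} => // N _; rewrite big_ord_recl /= expr0 mul1r mulr1n big1; last first.
    by move=> k _; rewrite mulr0 mulr0.
  by rewrite addr0 mulrC.
have bound : nc (cint (fun t => q (e t) * e t * einv s t ^+ N) 0 T) <= 8 * M * r^-1 ^+ N * T.
  have -> : 8 * M * r^-1 ^+ N * T = 2 * (4 * M * r^-1 ^+ N) * (T - 0) by rewrite subr0; ring.
  apply: (nc_cint_le (ltW T0) cN) => t _.
  rewrite ncM ncX nce' ler_wpM2r ?exprn_ge0 ?invr_ge0 ?(ltW r0)//.
  rewrite ncM nce.
  have d0 : r / 2 <= nc (e t - z).
    have := nc_sub_norm (e t) z; rewrite nce; have := ler_norm (r - nc z); lra.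
  have : nc (e t - z) * nc (q (e t)) <= M + M.
    rewrite -ncM -qE; apply: le_trans (ncB _ _) _.
    by apply: lerD; apply: fM; rewrite ?nce//; lra.
  have : (r / 2) * nc (q (e t)) <= nc (e t - z) * nc (q (e t)) by rewrite ler_wpM2r ?nc_ge0.
  lra.
have -> : f z - \sum_(k < N) c k * z ^+ k = T%:C^-1 * (z ^+ N * cint (fun t => q (e t) * e t * einv s t ^+ N) 0 T).
  apply: (mulfI TC); rewrite mulrA divff// mul1r -[f z - _]opprB mulrN -lhs key.
  by rewrite mulNr opprK.
rewrite !ncM ncV nc_real ncX gtr0_norm// mulrC ler_pdivrMr// exprMn.
apply: le_trans (ler_wpM2l (exprn_ge0 _ (nc_ge0 _)) bound) _.
by rewrite le_eqVlt; apply/orP; left; apply/eqP; ring.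
Qed.

End CauchyTaylor.

(** * The l1 norm of a complex vector *)

Section Ell1.
Variables (R : realType) (k : nat).
Local Notation C := R[i].
Implicit Types u v : 'rV[C]_k.

(** All estimates are made in this norm, whose triangle inequality is immediate;
    the Euclidean norm is compared with it. *)
Definition n1 v : R := \sum_(j < k) nc (v ord0 j).

Lemma n1_ge0 v : 0 <= n1 v.
Proof. by apply: sumr_ge0 => j _; exact: nc_ge0. Qed.

Lemma n1D u v : n1 (u + v) <= n1 u + n1 v.
Proof. by rewrite -big_split; apply: ler_sum => j _; rewrite mxE ncD. Qed.

Lemma n1Z c v : n1 (c *: v) = nc c * n1 v.
Proof. by rewrite mulr_sumr; apply: eq_bigr => j _; rewrite mxE ncM. Qed.

Lemma n1N v : n1 (- v) = n1 v.
Proof. by apply: eq_bigr => j _; rewrite mxE ncN. Qed.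

Lemma n1B u v : n1 (u - v) <= n1 u + n1 v.
Proof. by rewrite -(n1N v) n1D. Qed.

Lemma n1_0 : n1 0 = 0.
Proof. by apply: big1 => j _; rewrite mxE nc0. Qed.

Lemma nc_le_n1 v j : nc (v ord0 j) <= n1 v.
Proof. by rewrite /n1 (bigD1 j)//= lerDl sumr_ge0// => i _; exact: nc_ge0. Qed.

Lemma nc_le_enorm v j : nc (v ord0 j) <= enorm v.
Proof.
rewrite /enorm -[X in X <= _](ger0_norm (nc_ge0 _)) -sqrtr_sqr ler_wsqrtr//.
by rewrite (bigD1 j)//= lerDl sumr_ge0// => i _; exact: sqr_ge0.
Qed.

Lemma enorm_ge0 v : 0 <= enorm v.
Proof. exact: sqrtr_ge0. Qed.

Lemma n1_le_enorm v : n1 v <= k%:R * enorm v.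
Proof.
rewrite mulr_natl -[X in _ *+ X]card_ord -sumr_const.
by apply: ler_sum => j _; exact: nc_le_enorm.
Qed.

Lemma enorm_le_n1 v : enorm v <= n1 v.
Proof.
rewrite /enorm -(ger0_norm (n1_ge0 v)) -sqrtr_sqr ler_wsqrtr//.
rewrite expr2 [X in _ <= X * _]/n1 mulr_suml; apply: ler_sum => j _.
by rewrite expr2 ler_wpM2l ?nc_ge0// nc_le_n1.
Qed.

End Ell1.

(** * Polynomial functions of several variables *)

Section Polynomials.
Variables (R : realType) (n : nat).
Local Notation C := R[i].
Local Notation V := 'rV[C]_n.

(** Polynomial functions as a class of functions rather than as formal
    polynomials: induction over the class gives every estimate needed, and
    degrees or coefficients never appear. *)
Inductive polyf : (V -> C) -> Prop :=
| polyf_cst c : polyf (fun=> c)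
| polyf_var j : polyf (fun z => z ord0 j)
| polyfD f g : polyf f -> polyf g -> polyf (fun z => f z + g z)
| polyfM f g : polyf f -> polyf g -> polyf (fun z => f z * g z).

Lemma polyfB f g : polyf f -> polyf g -> polyf (fun z => f z - g z).
Proof.
move=> pf pg; have -> : (fun z => f z - g z) = (fun z => f z + -1 * g z).
  by apply/funext => z; rewrite mulN1r.
by apply: polyfD => //; apply: polyfM => //; exact: polyf_cst.
Qed.

Lemma polyfX f m : polyf f -> polyf (fun z => f z ^+ m).
Proof.
move=> pf; elim: m => [|m IH]; first by under eq_fun do rewrite expr0; exact: polyf_cst.
by under eq_fun do rewrite exprS; exact: polyfM.
Qed.

Lemma polyf_translate f (a : V) : polyf f -> polyf (fun z => f (z + a)).
Proof.
elim=> [c|j|g h _ IHg _ IHh|g h _ IHg _ IHh].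
- exact: polyf_cst.
- by under eq_fun do rewrite mxE; apply: polyfD; [exact: polyf_var|exact: polyf_cst].
- exact: (polyfD IHg IHh).
- exact: (polyfM IHg IHh).
Qed.

Lemma polyf_growth f : polyf f -> exists (K : R) (D : nat), 0 <= K /\
  forall z, nc (f z) <= K * (1 + n1 z) ^+ D.
Proof.
have ge1 (z : V) : 1 <= 1 + n1 z by rewrite lerDl n1_ge0.
have ge0 (z : V) : 0 <= 1 + n1 z by rewrite addr_ge0 ?n1_ge0.
elim=> [c|j|g h _ [K [D [K0 IHg]]] _ [L [E [L0 IHh]]]|g h _ [K [D [K0 IHg]]] _ [L [E [L0 IHh]]]].
- by exists (nc c), 0%N; split; rewrite ?nc_ge0// => z; rewrite expr0 mulr1.
- exists 1, 1%N; split => // z; rewrite mul1r expr1.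
  by apply: le_trans (nc_le_n1 _ _) _; rewrite lerDr.
- exists (K + L), (maxn D E); split; first exact: addr_ge0.
  move=> z; apply: le_trans (ncD _ _) _; rewrite mulrDl; apply: lerD.
    by apply: le_trans (IHg z) _; rewrite ler_wpM2l// ler_weXn2l// leq_maxl.
  by apply: le_trans (IHh z) _; rewrite ler_wpM2l// ler_weXn2l// leq_maxr.
- exists (K * L), (D + E)%N; split; first exact: mulr_ge0.
  by move=> z; rewrite ncM exprD mulrACA ler_pM ?nc_ge0.
Qed.

Lemma polyf_bounded f (r : R) : polyf f -> exists M : R, 0 <= M /\
  forall z, n1 z <= r -> nc (f z) <= M.
Proof.
move=> /polyf_growth [K [D [K0 KP]]]; exists (K * (1 + Num.max 0 r) ^+ D); split.
  by rewrite mulr_ge0// exprn_ge0// addr_ge0// le_max lexx.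
move=> z zr; apply: le_trans (KP z) _; rewrite ler_wpM2l// lerXn2r ?nnegrE ?addr_ge0 ?n1_ge0//.
  by rewrite le_max lexx.
by rewrite lerD2l le_max zr orbT.
Qed.

Lemma polyf_lipschitz f (r : R) : polyf f -> exists L : R, 0 <= L /\
  forall z z', n1 z <= r -> n1 z' <= r -> nc (f z - f z') <= L * n1 (z - z').
Proof.
elim=> [c|j|g h _ [K [K0 IHg]] _ [L [L0 IHh]]|g h pg [K [K0 IHg]] ph [L [L0 IHh]]].
- by exists 0; split => // z z' _ _; rewrite subrr nc0 mul0r.
- exists 1; split => // z z' _ _; rewrite mul1r.
  by have := nc_le_n1 (z - z') j; rewrite !mxE.
- exists (K + L); split; first exact: addr_ge0.
  move=> z z' zr z'r; rewrite opprD addrACA mulrDl.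
  by apply: le_trans (ncD _ _) _; apply: lerD; [exact: IHg|exact: IHh].
- have [A [A0 AP]] := polyf_bounded r pg; have [B [B0 BP]] := polyf_bounded r ph.
  exists (A * L + K * B); split; first by rewrite addr_ge0 ?mulr_ge0.
  move=> z z' zr z'r.
  have -> : g z * h z - g z' * h z' = g z * (h z - h z') + (g z - g z') * h z' by ring.
  apply: le_trans (ncD _ _) _; rewrite [X in _ <= X]mulrDl !ncM -[A * L * _]mulrA [K * B * _]mulrAC.
  by apply: lerD; apply: ler_pM; rewrite ?nc_ge0//; auto.
Qed.

Lemma polyf_differential f z : polyf f -> exists (l : 'I_n -> C) (K : R), 0 <= K /\
  forall h, n1 h <= 1 ->
    nc (f (z + h) - f z - \sum_j l j * h ord0 j) <= K * n1 h ^+ 2.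
Proof.
elim=> [c|j|f1 f2 _ [l [K [K0 IH1]]] _ [m [L [L0 IH2]]]|f1 f2 p1 [l [K [K0 IH1]]] p2 [m [L [L0 IH2]]]].
- exists (fun=> 0), 0; split => // h _.
  by rewrite subrr big1 ?subrr ?nc0 ?mul0r// => j _; rewrite mul0r.
- exists (fun i => (i == j)%:R), 0; split => // h _.
  rewrite (bigD1 j)//= eqxx mul1r big1 => [|i /negbTE ->]; last by rewrite mul0r.
  by rewrite mxE [_ + h _ _]addrC addrK addr0 subrr nc0 mul0r.
- exists (fun i => l i + m i), (K + L); split; first exact: addr_ge0.
  move=> h h1; under eq_bigr do rewrite mulrDl; rewrite big_split /=.
  have -> : f1 (z + h) + f2 (z + h) - (f1 z + f2 z) -
     (\sum_i l i * h ord0 i + \sum_i m i * h ord0 i) =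
     (f1 (z + h) - f1 z - \sum_i l i * h ord0 i) + (f2 (z + h) - f2 z - \sum_i m i * h ord0 i) by ring.
  by apply: le_trans (ncD _ _) _; rewrite mulrDl; apply: lerD; [exact: IH1|exact: IH2].
- have [A [A0 AP]] := polyf_lipschitz (n1 z + 1) p1.
  have [B [B0 BP]] := polyf_lipschitz (n1 z + 1) p2.
  exists (fun i => f1 z * m i + f2 z * l i), (nc (f1 z) * L + nc (f2 z) * K + A * B).
  split; first by rewrite !addr_ge0 ?mulr_ge0 ?nc_ge0.
  move=> h h1.
  have zh : n1 (z + h) <= n1 z + 1 by apply: le_trans (n1D _ _) _; rewrite lerD2l.
  have z1 : n1 z <= n1 z + 1 by rewrite lerDl.
  have a := AP _ _ zh z1; have b := BP _ _ zh z1.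
  rewrite [z + h - z]addrAC subrr add0r in a b.
  under eq_bigr do rewrite mulrDl -!mulrA; rewrite big_split /= -!mulr_sumr.
  have -> : f1 (z + h) * f2 (z + h) - f1 z * f2 z -
     (f1 z * (\sum_i m i * h ord0 i) + f2 z * (\sum_i l i * h ord0 i)) =
     f1 z * (f2 (z + h) - f2 z - \sum_i m i * h ord0 i) +
     f2 z * (f1 (z + h) - f1 z - \sum_i l i * h ord0 i) +
     (f1 (z + h) - f1 z) * (f2 (z + h) - f2 z) by ring.
  apply: le_trans (ncD _ _) _; rewrite [X in _ <= X]mulrDl; apply: lerD.
    apply: le_trans (ncD _ _) _; rewrite [X in _ <= X]mulrDl !ncM -!mulrA.
    by apply: lerD; apply: ler_wpM2l; rewrite ?nc_ge0//; [exact: IH2|exact: IH1].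
  by rewrite ncM expr2 mulrACA ler_pM ?nc_ge0.
Qed.

Lemma polyf_slice f z u l : polyf f -> cderivable (fun l => f (z + l *: u)) l.
Proof.
elim=> [c|j|g h _ IHg _ IHh|g h _ IHg _ IHh].
- exact: cderivable_cst.
- under eq_fun do rewrite !mxE; apply: cderivableD; first exact: cderivable_cst.
  by apply: cderivableM; [exact: cderivable_id|exact: cderivable_cst].
- exact: (cderivableD IHg IHh).
- exact: (cderivableM IHg IHh).
Qed.

(** The consequences of holomorphy from which the density of polynomials follows. *)
Definition entire (f : V -> C) :=
  (forall z u l, cderivable (fun l => f (z + l *: u)) l) /\
  (forall r : R, exists M : R, forall z, n1 z <= r -> nc (f z) <= M).

End Polynomials.

(** * A countable family of polynomials *)

Section RationalPolynomials.
Variable n : nat.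

Inductive rpoly :=
| RCst of rat & rat | RVar of 'I_n | RAdd of rpoly & rpoly | RMul of rpoly & rpoly.

Fixpoint rpoly_tree (p : rpoly) : GenTree.tree (rat * rat + 'I_n) :=
  match p with
  | RCst a b => GenTree.Leaf (inl (a, b))
  | RVar j => GenTree.Leaf (inr j)
  | RAdd p q => GenTree.Node 0 [:: rpoly_tree p; rpoly_tree q]
  | RMul p q => GenTree.Node 1 [:: rpoly_tree p; rpoly_tree q]
  end.

Fixpoint tree_rpoly (t : GenTree.tree (rat * rat + 'I_n)) : option rpoly :=
  match t with
  | GenTree.Leaf (inl (a, b)) => Some (RCst a b)
  | GenTree.Leaf (inr j) => Some (RVar j)
  | GenTree.Node 0 [:: t1; t2] =>
      if (tree_rpoly t1, tree_rpoly t2) is (Some p, Some q) then Some (RAdd p q) else None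
  | GenTree.Node _ [:: t1; t2] =>
      if (tree_rpoly t1, tree_rpoly t2) is (Some p, Some q) then Some (RMul p q) else None
  | _ => None
  end.

Lemma rpoly_treeK : pcancel rpoly_tree tree_rpoly.
Proof. by elim=> //= p -> q ->. Qed.

HB.instance Definition _ := Countable.copy rpoly (pcan_type rpoly_treeK).

End RationalPolynomials.

(** * Density of polynomials among entire functions *)

Section Density.
Variables (R : realType) (n : nat).
Local Notation C := R[i].
Local Notation V := 'rV[C]_n.

Fixpoint reval (p : rpoly n) (z : V) : C :=
  match p with
  | RCst a b => ratr a +i* ratr b
  | RVar j => z ord0 j
  | RAdd p q => reval p z + reval q z
  | RMul p q => reval p z * reval q z
  end.

Lemma reval_polyf p : polyf (reval p).
Proof.
elim: p => [a b|j|p pp q pq|p pp q pq].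
- exact: polyf_cst.
- exact: polyf_var.
- exact: polyfD.
- exact: polyfM.
Qed.

Variable rho : R.

(** The radius [rho] is fixed once and for all: the induction on the number of
    variables never changes it. *)
Definition approximable (f : V -> C) := forall e : R, 0 < e ->
  exists p, forall z, n1 z <= rho -> nc (f z - reval p z) <= e.

Lemma approximable_lim f : (forall e : R, 0 < e -> exists2 g, approximable g &
    forall z, n1 z <= rho -> nc (f z - g z) <= e) -> approximable f.
Proof.
move=> H e e0; have e2 : 0 < e / 2 by rewrite divr_gt0.
have [g ag gP] := H _ e2; have [p pP] := ag _ e2; exists p => z zr.
have -> : f z - reval p z = (f z - g z) + (g z - reval p z) by ring.
apply: le_trans (ncD _ _) _; have := gP z zr; have := pP z zr; lra.
Qed.

Lemma approximable_bounded f : approximable f ->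
  exists M : R, 0 <= M /\ forall z, n1 z <= rho -> nc (f z) <= M.
Proof.
move=> /(_ 1 ltr01) [p pP].
have [M [M0 MP]] := polyf_bounded rho (reval_polyf p).
exists (1 + M); split; first exact: addr_ge0.
move=> z zr; rewrite -(subrK (reval p z) (f z)); apply: le_trans (ncD _ _) _.
by apply: lerD; [exact: pP|exact: MP].
Qed.

Lemma approximableD f g : approximable f -> approximable g ->
  approximable (fun z => f z + g z).
Proof.
move=> af ag e e0; have e2 : 0 < e / 2 by rewrite divr_gt0.
have [p pP] := af _ e2; have [q qP] := ag _ e2; exists (RAdd p q) => z zr /=.
rewrite opprD addrACA; apply: le_trans (ncD _ _) _.
have := pP z zr; have := qP z zr; lra.
Qed.

(** Scalars are treated as constant functions, so that multiplication by a complex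
    number is covered by this lemma. *)
Lemma approximableM f g : approximable f -> approximable g ->
  approximable (fun z => f z * g z).
Proof.
move=> af ag e e0; have [B [B0 BP]] := approximable_bounded ag.
have e1 : 0 < e / 2 / (B + 1) by rewrite !divr_gt0// ltr_wpDl.
(* [p] first: the accuracy required of [q] depends on the size of [p]. *)
have [p pP] := af _ e1.
have [A [A0 AP]] := polyf_bounded rho (reval_polyf p).
have e2 : 0 < e / 2 / (A + 1) by rewrite !divr_gt0// ltr_wpDl.
have [q qP] := ag _ e2; exists (RMul p q) => z zr /=.
have -> : f z * g z - reval p z * reval q z =
  (f z - reval p z) * g z + reval p z * (g z - reval q z) by ring.
apply: le_trans (ncD _ _) _; rewrite !ncM.
have h1 : nc (f z - reval p z) * nc (g z) <= e / 2 / (B + 1) * (B + 1).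
  by rewrite ler_pM ?nc_ge0 ?pP// (le_trans (BP z zr))// lerDl.
have h2 : nc (reval p z) * nc (g z - reval q z) <= (A + 1) * (e / 2 / (A + 1)).
  by rewrite ler_pM ?nc_ge0 ?qP// (le_trans (AP z zr))// lerDl.
rewrite divfK ?gt_eqF ?ltr_wpDl// in h1.
rewrite [X in _ <= X]mulrC divfK ?gt_eqF ?ltr_wpDl// in h2.
lra.
Qed.

Lemma approximable_cst c : approximable (fun=> c).
Proof.
move=> e e0; have e2 : 0 < e / 2 by rewrite divr_gt0.
have appr (x : R) : exists a : rat, `|x - ratr a| <= e / 2.
  have [a] := @rat_in_itvoo R (x - e / 2) (x + e / 2) ltac:(lra).
  rewrite in_itv /= => ha; exists a; rewrite ler_norml; apply/andP; split; lra.
have [a aP] := appr (complex.Re c); have [b bP] := appr (complex.Im c).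
exists (RCst _ a b) => z _ /=; apply: le_trans (nc_le_ReIm _) _.
rewrite cReB cImB /=; lra.
Qed.

Lemma approximable_var j : approximable (fun z => z ord0 j).
Proof. by move=> e e0; exists (RVar j) => z _ /=; rewrite subrr nc0 ltW. Qed.

Lemma approximableX f m : approximable f -> approximable (fun z => f z ^+ m).
Proof.
move=> pf; elim: m => [|m IH]; first by under eq_fun do rewrite expr0; exact: approximable_cst.
by under eq_fun do rewrite exprS; exact: approximableM.
Qed.

Lemma approximable_sum (N : nat) (f : nat -> V -> C) :
  (forall i, (i < N)%N -> approximable (f i)) ->
  approximable (fun z => \sum_(i < N) f i z).
Proof.
elim: N => [|N IH] pf.
  by under eq_fun do rewrite big_ord0; exact: approximable_cst.
under eq_fun do rewrite big_ord_recr /=; apply: approximableD; last exact: pf.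
by apply: IH => i iN; apply: pf; rewrite ltnS ltnW.
Qed.

Definition upd (j : 'I_n) (l : C) (z : V) : V :=
  \row_i (if i == j then l else z ord0 i).

Lemma upd_line j l (z : V) : upd j l z = upd j 0 z + l *: delta_mx ord0 j.
Proof.
apply/rowP => i; rewrite !mxE eqxx /=.
by case: eqVneq => _; rewrite ?mulr1 ?mulr0 ?add0r ?addr0.
Qed.

Lemma upd_id j (z : V) : upd j (z ord0 j) z = z.
Proof. by apply/rowP => i; rewrite !mxE; case: eqVneq => [->|]. Qed.

Lemma n1_upd j l (z : V) : n1 (upd j l z) <= n1 z + nc l.
Proof.
rewrite upd_line; apply: le_trans (n1D _ _) _; apply: lerD.
  by apply: ler_sum => i _; rewrite mxE; case: eqP => _; rewrite ?nc0 ?nc_ge0.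
rewrite n1Z /n1 (bigD1 j)//= big1 ?addr0 => [|i /negbTE ij]; last first.
  by rewrite mxE ij andbF nc0.
by rewrite mxE !eqxx nc1 mulr1.
Qed.

Lemma entire_upd f j c : entire f -> entire (fun z => f (upd j c z)).
Proof.
move=> [df bf]; split.
  move=> z u l.
  have -> : (fun l => f (upd j c (z + l *: u))) = (fun l => f (upd j c z + l *: upd j 0 u)).
    apply/funext => m; congr f; apply/rowP => i; rewrite !mxE.
    by case: eqP => _; rewrite ?mulr0 ?addr0.
  exact: df.
move=> r; have [M MP] := bf (r + nc c); exists M => z zr; apply: MP.
by apply: le_trans (n1_upd _ _ _) _; rewrite lerD2r.
Qed.

Lemma small_pow2 (w e : R) : 0 < e -> exists k : nat, w * (1 / 2) ^+ k < e.
Proof.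
move=> /(half_pow_small w) [k kP]; exists k.
by rewrite div1r exprVn.
Qed.

(** Density of polynomials, one variable at a time: the Taylor coefficients of
    [f] in one variable are limits of combinations of restrictions of [f],
    which involve one variable fewer. *)
Lemma entire_approximable_step (f : V -> C) (j : 'I_n) : 0 <= rho -> entire f ->
  (forall c, approximable (fun z => f (upd j c z))) -> approximable f.
Proof.
move=> rho0 ef IH; have [df bf] := ef.
(* With this radius, [nc l <= rho] gives the ratio [nc l / r <= 1 / 2]. *)
pose r := 2 * (rho + 1); have r0 : 0 < r by rewrite mulr_gt0// ltr_wpDl.
have [M0 M0P] := bf (rho + r); pose M := Num.max 0 M0.
have M_ge0 : 0 <= M by rewrite le_max lexx.
have MP z : n1 z <= rho + r -> nc (f z) <= M.
  by move=> /M0P h; rewrite le_max h orbT.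
have : forall z, exists c : nat -> C, n1 z <= rho -> forall N l, (0 < N)%N -> nc l <= r / 2 ->
    nc (f (upd j l z) - \sum_(k < N) c k * l ^+ k) <= 8 * M * (nc l / r) ^+ N.
  move=> z; have [zr|zr] := leP (n1 z) rho; last by exists (fun=> 0).
  have := @cauchy_taylor R (fun l => f (upd j l z)) r M r0 _ _.
  case=> [l|l lr|c cP].
  - by under eq_fun do rewrite upd_line; exact: df.
  - by apply: MP; apply: le_trans (n1_upd _ _ _) _; exact: lerD.
  - by exists c => _.
move=> /choice [c cP].
have r2 : r / 2 = rho + 1 by rewrite /r mulrC mulKf.
have ac k : approximable (fun z => c z k).
  elim/ltn_ind: k => k IHk; apply: approximable_lim => e e0.
  (* Taylor's formula of order [k.+1] at the small point [h], solved for the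
     coefficient [c z k]; the error is at most [8 * M * h]. *)
  pose h := Num.min 1 (e / (8 * M + 1)).
  have h0 : 0 < h by rewrite lt_min ltr01 divr_gt0// ltr_wpDl// mulr_ge0.
  have h1 : h <= 1 by rewrite ge_min lexx.
  have he : h * (8 * M + 1) <= e.
    by rewrite -ler_pdivlMr ?ge_min ?lexx ?orbT// ltr_wpDl// mulr_ge0.
  have [hc nh] : exists hc : C, nc hc = h by exists h%:C; rewrite nc_real gtr0_norm.
  exists (fun z => (hc ^+ k)^-1 * (f (upd j hc z) + -1 * \sum_(i < k) c z i * hc ^+ i)).
    apply: approximableM; first exact: approximable_cst.
    apply: approximableD; first exact: IH.
    apply: approximableM; first exact: approximable_cst.
    apply: (@approximable_sum k (fun i z => c z i * hc ^+ i)) => i ik.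
    by apply: approximableM; [exact: IHk|exact: approximable_cst].
  move=> z zr.
  have hr : nc hc <= r / 2 by rewrite nh r2 (le_trans h1)// lerDr.
  have := cP z zr k.+1 hc isT hr; rewrite big_ord_recr /= nh.
  set S := \sum_(i < k) _ => H.
  have hk0 : hc ^+ k != 0 by rewrite expf_neq0// -nc_eq0 nh gt_eqF.
  have -> : c z k - (hc ^+ k)^-1 * (f (upd j hc z) + -1 * S) =
     - ((hc ^+ k)^-1 * (f (upd j hc z) - (S + c z k * hc ^+ k))).
    by field.
  rewrite ncN ncM ncV ncX nh.
  have hk : 0 < h ^+ k by rewrite exprn_gt0.
  rewrite mulrC ler_pdivrMr//; apply: le_trans H _.
  have r1 : 1 <= r by rewrite /r; lra.
  have : (h / r) ^+ k.+1 <= h ^+ k.+1.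
    rewrite lerXn2r ?nnegrE ?divr_ge0 ?ltW//.
    by rewrite ltr_pdivrMr// ltr_pMr//; rewrite /r; lra.
  rewrite [h ^+ k.+1]exprS => H1.
  have : 8 * M * (h / r) ^+ k.+1 <= 8 * M * (h * h ^+ k) by apply: ler_wpM2l H1; rewrite mulr_ge0.
  move=> /le_trans; apply; rewrite mulrA ler_wpM2r ?(ltW hk)//; lra.
apply: approximable_lim => e e0.
have [N NP] := small_pow2 (8 * M) e0.
exists (fun z => \sum_(k < N.+1) c z k * z ord0 j ^+ k).
  apply: (@approximable_sum N.+1 (fun k z => c z k * z ord0 j ^+ k)) => k _.
  by apply: approximableM; [exact: ac|exact/approximableX/approximable_var].
move=> z zr; have zj : nc (z ord0 j) <= rho := le_trans (nc_le_n1 _ _) zr.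
have := cP z zr N.+1 (z ord0 j) isT; rewrite r2 upd_id => /(_ _).
have zj1 : nc (z ord0 j) <= rho + 1 by rewrite (le_trans zj)// lerDl.
move=> /(_ zj1) /le_trans; apply; apply: le_trans (ltW NP).
rewrite ler_wpM2l ?mulr_ge0//.
have q0 : 0 <= nc (z ord0 j) / r by rewrite divr_ge0 ?nc_ge0 ?ltW.
have q1 : nc (z ord0 j) / r <= 1 / 2 by rewrite ler_pdivrMr// /r; lra.
apply: (@le_trans _ _ ((1 / 2) ^+ N.+1)); first by rewrite lerXn2r ?nnegrE//; lra.
by rewrite exprS ler_piMl ?exprn_ge0//; lra.
Qed.

(** Induction on the number of variables on which [f] depends. *)
Theorem entire_approximable (f : V -> C) : 0 <= rho -> entire f -> approximable f.
Proof.
move=> rho0.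
suff H k : (k <= n)%N -> forall f, entire f ->
   (forall z z' : V, (forall i : 'I_n, (i < k)%N -> z ord0 i = z' ord0 i) -> f z = f z') ->
   approximable f.
  move=> ef; apply: (H n (leqnn n) f ef) => z z' zz; congr f; apply/rowP => i.
  exact: zz.
elim: k => [_|k IH kn] {}f ef fdep.
  have -> : f = (fun=> f 0) by apply/funext => z; exact: fdep.
  exact: approximable_cst.
pose j := Ordinal kn.
apply: (entire_approximable_step (j := j)) => // c.
apply: (IH (ltnW kn)); first exact: entire_upd.
move=> z z' zz; apply: fdep => i; rewrite ltnS leq_eqVlt !mxE => /orP[/eqP ik|ik].
  by have -> : i = j; [exact: val_inj|rewrite eqxx].
by case: eqP => // _; exact: zz.
Qed.

End Density.

(** * Estimates on powers and cut-offs *)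

Section PowerEstimates.
Variable R : realType.
Local Notation C := R[i].

Lemma bernoulli (x : R) k : -1 <= x -> 1 + k%:R * x <= (1 + x) ^+ k.
Proof.
move=> x1; elim: k => [|k IH]; first by rewrite mul0r addr0 expr0.
have x1' : 0 <= 1 + x by lra.
rewrite exprS; apply: le_trans (ler_wpM2l x1' IH).
have : 0 <= k%:R * x ^+ 2 by rewrite mulr_ge0 ?sqr_ge0.
by rewrite -natr1; lra.
Qed.

Lemma expr_1D_le (u : R) k : 0 <= u <= 1 -> (1 + u) ^+ k <= 1 + (2 ^+ k - 1) * u.
Proof.
move=> /andP[u0 u1]; elim: k => [|k IH]; first by rewrite !expr0 subrr mul0r addr0.
have u1' : 0 <= 1 + u by lra.
rewrite exprS; apply: le_trans (ler_wpM2l u1' IH) _.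
have p1 : 0 <= 2 ^+ k - 1 :> R by rewrite subr_ge0 exprn_ege1// ler1n.
have : (2 ^+ k - 1) * u * u <= (2 ^+ k - 1) * u * 1 by rewrite ler_wpM2l// mulr_ge0.
by rewrite exprS; lra.
Qed.

Lemma nc_1BX (v : C) k : nc (1 - (1 - v) ^+ k) <= (1 + nc v) ^+ k - 1.
Proof.
elim: k => [|k IH]; first by rewrite !expr0 subrr nc0 subrr.
have -> : 1 - (1 - v) ^+ k.+1 = (1 - (1 - v) ^+ k) + v * (1 - v) ^+ k.
  by rewrite exprS; ring.
apply: le_trans (ncD _ _) _; rewrite ncM ncX.
have h : nc (1 - v) ^+ k <= (1 + nc v) ^+ k.
  rewrite lerXn2r ?nnegrE ?nc_ge0 ?addr_ge0 ?nc_ge0//.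
  by apply: le_trans (ncB _ _) _; rewrite nc1.
have := ler_wpM2l (nc_ge0 v) h; rewrite exprS; lra.
Qed.

Lemma nc_cutoff_small (v : C) (u : R) k : nc v <= u -> u <= 1 ->
  nc (1 - (1 - v) ^+ k) <= 2 ^+ k * u.
Proof.
move=> vu u1; apply: le_trans (nc_1BX _ _) _.
have u0 : 0 <= u := le_trans (nc_ge0 v) vu.
have h : (1 + nc v) ^+ k <= (1 + u) ^+ k.
  by rewrite lerXn2r ?nnegrE ?addr_ge0 ?nc_ge0// lerD2l.
have := @expr_1D_le u k; rewrite u0 u1 => /(_ isT); lra.
Qed.

Lemma nc_cutoff_large (v : C) (u : R) k : nc v <= u -> 1 <= u ->
  nc (1 - (1 - v) ^+ k) <= 2 ^+ k * u ^+ k.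
Proof.
move=> vu u1; apply: le_trans (nc_1BX _ _) _.
have u0 : 0 <= u := le_trans (nc_ge0 v) vu.
have h : (1 + nc v) ^+ k <= (2 * u) ^+ k.
  by rewrite lerXn2r ?nnegrE ?addr_ge0 ?mulr_ge0 ?nc_ge0//; lra.
rewrite -exprMn; lra.
Qed.

End PowerEstimates.

(** * Polynomial bumps along the real axis *)

Section Bump.
Variables (R : realType) (n : nat).
Local Notation C := R[i].
Local Notation V := 'rV[C]_n.

Definition preserves_polyf (ka : C -> C) :=
  forall f : V -> C, polyf f -> polyf (fun z => ka (f z)).

Definition sharpen (u : C) : C := 3%:R * u ^+ 2 - 2%:R * u ^+ 3.

Lemma sharpen_small u : nc u <= 1 / 4 -> nc (sharpen u) <= 7 / 8 * nc u.
Proof.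
move=> u4; have -> : sharpen u = u * (u * (3%:R - 2%:R * u)) by rewrite /sharpen; ring.
rewrite !ncM mulrC; apply: ler_wpM2r; first exact: nc_ge0.
have n2 : nc (2%:R : C) = 2 by have := nc_real (2 : R); rewrite rmorph_nat ger0_norm.
have n3 : nc (3%:R : C) = 3 by have := nc_real (3 : R); rewrite rmorph_nat ger0_norm.
have h : nc (3%:R - 2%:R * u) <= 7 / 2.
  by apply: le_trans (ncB _ _) _; rewrite ncM n2 n3; lra.
apply: le_trans (ler_pM (nc_ge0 _) (nc_ge0 _) u4 h) _; lra.
Qed.

Lemma sharpenC u : 1 - sharpen u = sharpen (1 - u).
Proof. by rewrite /sharpen; ring. Qed.

Lemma iter_sharpenC u q : 1 - iter q sharpen u = iter q sharpen (1 - u).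
Proof. by elim: q => // q IH; rewrite !iterS sharpenC IH. Qed.

Lemma iter_sharpen_small u q : nc u <= 1 / 4 -> nc (iter q sharpen u) <= (7 / 8) ^+ q * (1 / 4).
Proof.
move=> u4; elim: q => [|q IH]; first by rewrite expr0 mul1r.
have p1 : (7 / 8 : R) ^+ q <= 1 by rewrite exprn_ile1//; lra.
rewrite iterS; apply: le_trans (sharpen_small _) _; first by apply: le_trans IH _; lra.
by rewrite exprS -[X in _ <= X]mulrA ler_wpM2l//; lra.
Qed.

(** A polynomial model of a Gaussian is within 1 / 4 of 1 on the disc and of 0 far
    away in the strip; iterating [3 u^2 - 2 u^3], whose attracting fixed points are
    0 and 1, sharpens it. *)
Lemma bump_polynomial (r B e : R) : 0 < r -> 0 < e ->
  exists ka : C -> C, [/\ preserves_polyf ka,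
    forall u, nc u <= r -> nc (ka u - 1) <= e &
    forall u, `|complex.Im u| <= r -> 20 * r <= `|complex.Re u| -> `|complex.Re u| <= B ->
      nc (ka u) <= e].
Proof.
move=> r0 e0.
have r20 : 0 < r ^+ 2 by rewrite exprn_gt0.
have [M [M0 MB]] : exists M : nat, (0 < M)%N /\ 2 * B ^+ 2 / r ^+ 2 <= M%:R.
  exact: nat_above.
have MR0 : 0 < M%:R :> R by rewrite ltr0n.
(* [(1 - be * u ^+ 2) ^+ M] imitates [exp (- u ^+ 2 / (8 * r ^+ 2))] on the range
   where [be * u ^+ 2] is small, that is for [M] large compared with [B]. *)
pose be : R := (8 * M%:R * r ^+ 2)^-1.
have be0 : 0 < be by rewrite invr_gt0 !mulr_gt0.
have beE : M%:R * (be * r ^+ 2) = 1 / 8.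
  by rewrite /be; field; rewrite !gt_eqF.
have beB : be * B ^+ 2 <= 1 / 16.
  move: MB; rewrite ler_pdivrMr// => MB.
  have : be * (2 * B ^+ 2) <= be * (M%:R * r ^+ 2) by rewrite ler_wpM2l// ltW.
  lra.
have [q qe] : exists q, (7 / 8 : R) ^+ q <= e.
  have [k kP] := small_pow2 1 e0; exists (6 * k)%N; rewrite exprM.
  apply: (@le_trans _ _ ((1 / 2) ^+ k)); last by rewrite mul1r in kP; exact: ltW.
  by rewrite lerXn2r ?nnegrE ?exprn_ge0 ?divr_ge0//; lra.
pose g (u : C) := (1 - be%:C * u ^+ 2) ^+ M.
exists (fun u => iter q sharpen (g u)).
have final u : nc u <= 1 / 4 -> nc (iter q sharpen u) <= e.
  by move=> /(iter_sharpen_small q) h; have := nc_ge0 (iter q sharpen u); lra.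
split.
- move=> f pf.
  have pg : polyf (fun z => g (f z)).
    apply: polyfX; apply: polyfB; first exact: polyf_cst.
    by apply: polyfM; [exact: polyf_cst|exact: polyfX].
  elim: {qe final} q => // q IH.
  have -> : (fun z => iter q.+1 sharpen (g (f z))) =
    (fun z => 3%:R * iter q sharpen (g (f z)) ^+ 2 - 2%:R * iter q sharpen (g (f z)) ^+ 3) by [].
  by apply: polyfB; apply: polyfM; try exact: polyf_cst; exact: (polyfX _ IH).
- move=> u ur; rewrite ncBC iter_sharpenC; apply: final.
  set y := be * r ^+ 2.
  have y0 : 0 <= y by rewrite mulr_ge0 ?(ltW be0) ?sqr_ge0.
  have uy : nc (be%:C * u ^+ 2) <= y.
    rewrite ncM nc_real gtr0_norm// ncX ler_wpM2l ?(ltW be0)//.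
    by rewrite lerXn2r ?nnegrE ?nc_ge0 ?(ltW r0).
  apply: le_trans (nc_1BX _ _) _.
  have h1 : (1 + nc (be%:C * u ^+ 2)) ^+ M <= (1 + y) ^+ M.
    by rewrite lerXn2r ?nnegrE ?addr_ge0 ?nc_ge0// lerD2l.
  have M1 : 1 <= M%:R :> R by rewrite ler1n.
  have y1 : y <= 1 / 8.
    have : 1 * y <= M%:R * y by rewrite ler_wpM2r.
    rewrite /y beE; lra.
  have h2 : 1 - 1 / 8 <= (1 - y) ^+ M.
    have := @bernoulli _ (- y) M; rewrite mulrN beE; apply; lra.
  have h3 : (1 + y) ^+ M * (1 - y) ^+ M <= 1.
    rewrite -exprMn; apply: exprn_ile1.
      by rewrite mulr_ge0; lra.
    have : 0 <= y * y by rewrite mulr_ge0.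
    lra.
  have h4 : 0 <= (1 + y) ^+ M by rewrite exprn_ge0//; lra.
  have : (1 + y) ^+ M * (1 - 1 / 8) <= 1 by apply: le_trans h3; rewrite ler_wpM2l.
  lra.
- move=> u; set p := complex.Re u; set t := complex.Im u => tr p20 pB; apply: final.
  have P0 := sqr_ge0 p; have Q0 := sqr_ge0 t.
  have tr2 : t ^+ 2 <= r ^+ 2.
    by rewrite -real_normK ?num_real// lerXn2r ?nnegrE ?normr_ge0 ?(ltW r0).
  have pr2 : 400 * r ^+ 2 <= p ^+ 2.
    have -> : 400 * r ^+ 2 = (20 * r) ^+ 2 by ring.
    by rewrite -(real_normK (num_real p)) lerXn2r ?nnegrE ?normr_ge0 ?mulr_ge0 ?(ltW r0).
  have pB2 : p ^+ 2 <= B ^+ 2.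
    by rewrite -(real_normK (num_real p)) lerXn2r ?nnegrE ?normr_ge0// (le_trans _ pB).
  have sq : nc (1 - be%:C * u ^+ 2) ^+ 2 =
     1 - 2 * (be * p ^+ 2) + 2 * (be * t ^+ 2) + (be * p ^+ 2 + be * t ^+ 2) ^+ 2.
    have -> : 1 - be%:C * u ^+ 2 =
        (1 - be * (p ^+ 2 - t ^+ 2)) +i* (- (2 * be * p * t)).
      by rewrite expr2; apply: eq_ReIm; rewrite ?cReB ?cImB ?cReM ?cImM ?cReM ?cImM /= -/p -/t; ring.
    by rewrite ncE sqr_sqrtr ?addr_ge0 ?sqr_ge0//=; ring.
  pose P := be * p ^+ 2; pose Q := be * t ^+ 2.
  have bP0 : 0 <= P by rewrite mulr_ge0 ?(ltW be0).
  have bQ0 : 0 <= Q by rewrite mulr_ge0 ?(ltW be0).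
  have P16 : P <= 1 / 16 by apply: le_trans beB; rewrite ler_wpM2l ?(ltW be0).
  have QP : 400 * Q <= P.
    rewrite /P /Q mulrCA ler_wpM2l ?(ltW be0)//; lra.
  have sq1 : nc (1 - be%:C * u ^+ 2) ^+ 2 <= 1 - P.
    rewrite sq -/P -/Q.
    have : (P + Q) * (P + Q) <= (1 / 8) * (P + Q) by rewrite ler_wpM2r//; lra.
    rewrite expr2; lra.
  have MP : 50 <= M%:R * P.
    have : be * (400 * r ^+ 2) <= P by rewrite ler_wpM2l ?(ltW be0).
    move=> /(ler_wpM2l (ltW MR0)); lra.
  have h1 : (1 - P) ^+ M * (1 + P) ^+ M <= 1.
    rewrite -exprMn; apply: exprn_ile1.
      by rewrite mulr_ge0; lra.
    have : 0 <= P * P by rewrite mulr_ge0.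
    lra.
  have h2 : 51 <= (1 + P) ^+ M.
    apply: (@le_trans _ _ (1 + M%:R * P)); first lra.
    by apply: bernoulli; lra.
  have h3 : 0 <= (1 - P) ^+ M by rewrite exprn_ge0//; lra.
  have h4 : (1 - P) ^+ M * 51 <= 1 by apply: le_trans h1; rewrite ler_wpM2l.
  have h5 : nc (g u) ^+ 2 <= (1 - P) ^+ M.
    rewrite /g ncX exprAC lerXn2r ?nnegrE ?sqr_ge0//; lra.
  rewrite -(@ler_pXn2r _ 2) ?nnegrE ?nc_ge0//; lra.
Qed.

End Bump.

(** * Runge approximation on balls along a line *)

Section PolynomialMaps.
Variables (R : realType) (n m : nat).
Local Notation C := R[i].
Local Notation V := 'rV[C]_n.
Local Notation W := 'rV[C]_m.

Definition polymap (F : V -> W) := forall k, polyf (fun z => F z ord0 k).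

Lemma polymap_cst w : polymap (fun=> w).
Proof. by move=> k; exact: polyf_cst. Qed.

Lemma polymapD F G : polymap F -> polymap G -> polymap (fun z => F z + G z).
Proof. by move=> pF pG k; under eq_fun do rewrite mxE; exact: polyfD. Qed.

Lemma polymapB F G : polymap F -> polymap G -> polymap (fun z => F z - G z).
Proof. by move=> pF pG k; under eq_fun do rewrite !mxE; exact: polyfB. Qed.

Lemma polymapZ f F : polyf f -> polymap F -> polymap (fun z => f z *: F z).
Proof. by move=> pf pF k; under eq_fun do rewrite mxE; exact: polyfM. Qed.

Lemma polymap_sum N (F : nat -> V -> W) : (forall i, polymap (F i)) ->
  polymap (fun z => \sum_(i < N) F i z).
Proof.
move=> pF; elim: N => [|N IH].
  by under eq_fun do rewrite big_ord0; exact: polymap_cst.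
by under eq_fun do rewrite big_ord_recr /=; exact: polymapD.
Qed.

Lemma polymap_translate F a : polymap F -> polymap (fun z => F (z + a)).
Proof. by move=> pF k; exact: (polyf_translate a (pF k)). Qed.

Lemma polymap_growth F : polymap F -> exists (K : R) (D : nat), 0 <= K /\
  forall z, n1 (F z) <= K * (1 + n1 z) ^+ D.
Proof.
move=> pF; have /choice [K KP] : forall k, exists K : R, exists D : nat, 0 <= K /\
    forall z, nc (F z ord0 k) <= K * (1 + n1 z) ^+ D by move=> k; exact: polyf_growth.
have /choice [D DP] := KP.
exists (\sum_k K k), (\sum_k D k)%N; split; first by apply: sumr_ge0 => k _; case: (DP k).
move=> z; rewrite mulr_suml; apply: ler_sum => k _; have [K0 h] := DP k.
apply: le_trans (h z) _; rewrite ler_wpM2l// ler_weXn2l// ?lerDl ?n1_ge0//.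
by rewrite (bigD1 k)//= leq_addr.
Qed.

Lemma polymap_bounded F (r : R) : polymap F -> exists M : R, 0 <= M /\
  forall z, n1 z <= r -> n1 (F z) <= M.
Proof.
move=> pF; have /choice [M MP] := fun k => polyf_bounded r (pF k).
exists (\sum_k M k); split; first by apply: sumr_ge0 => k _; case: (MP k).
by move=> z zr; apply: ler_sum => k _; case: (MP k) => _; apply.
Qed.

Lemma polymap_lipschitz F (r : R) : polymap F -> exists L : R, 0 <= L /\
  forall z z', n1 z <= r -> n1 z' <= r -> n1 (F z - F z') <= L * n1 (z - z').
Proof.
move=> pF; have /choice [L LP] := fun k => polyf_lipschitz r (pF k).
exists (\sum_k L k); split; first by apply: sumr_ge0 => k _; case: (LP k).
move=> z z' zr z'r; rewrite mulr_suml; apply: ler_sum => k _.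
by rewrite !mxE; case: (LP k) => _; apply.
Qed.

Lemma n1_sum (N : nat) (F : nat -> W) : n1 (\sum_(i < N) F i) <= \sum_(i < N) n1 (F i).
Proof.
elim: N => [|N IH]; first by rewrite !big_ord0 n1_0.
by rewrite !big_ord_recr /=; apply: le_trans (n1D _ _) _; rewrite lerD2r.
Qed.

Variables (theta : V) (j0 : 'I_n).
Hypothesis theta_j0 : theta ord0 j0 != 0.

(** A linear form with value 1 at [theta]: any nonzero coordinate of [theta]
    provides one. *)
Definition along (z : V) : C := z ord0 j0 / theta ord0 j0.

Lemma along_translate (z : V) (a : C) : along (z + a *: theta) = along z + a.
Proof. by rewrite /along !mxE mulrDl mulfK. Qed.

Lemma polyf_along : polyf along.
Proof. by apply: polyfM; [exact: polyf_var|exact: polyf_cst]. Qed.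

(** A bound for the norm of [along theta]; adding 1 makes it at least 1, which
    saves case distinctions. *)
Definition along_norm : R := 1 + (nc (theta ord0 j0))^-1.

Lemma along_norm_ge1 : 1 <= along_norm.
Proof. by rewrite lerDl invr_ge0 nc_ge0. Qed.

Lemma nc_along (z : V) (x : R) : nc (z ord0 j0) <= x -> nc (along z) <= along_norm * x.
Proof.
move=> zx; rewrite ncM ncV mulrC; apply: ler_pM; rewrite ?invr_ge0 ?nc_ge0//.
by rewrite lerDr.
Qed.

(** Near the points [y i *: theta] the coordinate [along] stays near the real
    numbers [y i], so bumps in that one variable glue together the translates of
    [Q]. *)
Lemma runge_discs (Q : V -> W) (y : nat -> R) (L : nat) (r e : R) :
  polymap Q -> 0 < r -> 0 < e ->
  (forall i, y i + 21 * (along_norm * r) <= y i.+1) ->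
  exists G, polymap G /\ forall i z, (i <= L)%N -> n1 (z - (y i)%:C *: theta) <= r ->
    n1 (G z - Q (z - (y i)%:C *: theta)) <= e.
Proof.
move=> pQ r0 e0 y_incr; set c := 21 * (along_norm * r) in y_incr *.
have rho0 : 0 < along_norm * r by rewrite mulr_gt0// (lt_le_trans ltr01 along_norm_ge1).
have c0 : 0 < c by rewrite mulr_gt0.
have yM i j : (i <= j)%N -> y i <= y j.
  elim: j => [|j IH]; first by rewrite leqn0 => /eqP->.
  rewrite leq_eqVlt => /orP[/eqP->//|]; rewrite ltnS => /IH h.
  by apply: le_trans h _; have := y_incr j; lra.
have y_sep i j : (i < j)%N -> y i + c <= y j.
  by move=> /yM; apply: le_trans; exact: y_incr.
have y_far i j : i != j -> c <= `|y i - y j|.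
  rewrite neq_ltn => /orP[] /y_sep h.
    by rewrite distrC ger0_norm; lra.
  by rewrite ger0_norm; lra.
have y_near i j : (i <= L)%N -> (j <= L)%N -> `|y i - y j| <= y L - y 0%N.
  move=> iL jL; have := yM _ _ iL; have := yM _ _ jL.
  have := yM _ _ (leq0n i); have := yM _ _ (leq0n j) => *.
  by rewrite ler_norml; apply/andP; split; lra.
have [B [B0 BP]] := polymap_bounded (r + (y L - y 0%N) * n1 theta) pQ.
pose e' := e / (L.+1%:R * (B + 1)).
have LB0 : 0 < L.+1%:R * (B + 1) by rewrite mulr_gt0// ltr_wpDl.
have e'0 : 0 < e' by rewrite divr_gt0.
have [ka [pka ka1 ka0]] := @bump_polynomial R n (along_norm * r) (y L - y 0%N + along_norm * r) e' rho0 e'0.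
exists (fun z => \sum_(j < L.+1) ka (along z - (y j)%:C) *: Q (z - (y j)%:C *: theta)); split.
  apply: (polymap_sum _ (F := fun j z => ka (along z - (y j)%:C) *: Q (z - (y j)%:C *: theta))) => j.
  apply: polymapZ; last exact: polymap_translate.
  by apply: pka; apply: polyfB; [exact: polyf_along|exact: polyf_cst].
move=> i z iL zr.
pose v := z - (y i)%:C *: theta.
have zE (a : R) : z - a%:C *: theta = v + (y i - a)%:C *: theta.
  by rewrite /v RCB scalerBl addrA subrK.
have alE (a : R) : along z - a%:C = along v + (y i - a)%:C.
  have -> : z = v + (y i)%:C *: theta by rewrite subrK.
  by rewrite along_translate RCB addrA.
have av : nc (along v) <= along_norm * r by apply: nc_along; exact: le_trans (nc_le_n1 _ _) zr.
have QE : Q (z - (y i)%:C *: theta) =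
  \sum_(j < L.+1) ((j : nat) == i)%:R *: Q (z - (y j)%:C *: theta).
  have iL' : (i < L.+1)%N by rewrite ltnS.
  rewrite (bigD1 (Ordinal iL'))//= eqxx scale1r big1 ?addr0// => j ji.
  have /negbTE -> : (j : nat) != i by apply: contraNneq ji => ji; apply/eqP/val_inj.
  by rewrite scale0r.
rewrite QE -sumrB; apply: le_trans (n1_sum _ (fun j => ka (along z - (y j)%:C) *: Q (z - (y j)%:C *: theta) - ((j : nat) == i)%:R *: Q (z - (y j)%:C *: theta))) _.
apply: (@le_trans _ _ (\sum_(j < L.+1) e' * (B + 1))); last first.
  rewrite sumr_const card_ord -[X in X <= _]mulr_natl /e' mulrCA divfK// gt_eqF//.
apply: ler_sum => j _; rewrite -scalerBl n1Z.
have jL : (j <= L)%N by rewrite -ltnS.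
apply: ler_pM; rewrite ?nc_ge0 ?n1_ge0//; last first.
  apply: le_trans (BP _ _) _; last by rewrite lerDl.
  rewrite zE; apply: le_trans (n1D _ _) _; rewrite n1Z nc_real; apply: lerD => //.
  by apply: ler_wpM2r; [exact: n1_ge0|exact: y_near].
rewrite alE; have [ji|ji] := eqVneq (j : nat) i.
  by rewrite ji subrr addr0; exact: ka1.
rewrite subr0; apply: ka0; rewrite ?cReD ?cImD /= ?addr0.
- exact: le_trans (nc_Im _) av.
- have := y_far i j; rewrite eq_sym => /(_ ji).
  have := le_trans (nc_Re _) av.
  have := ler_normB (complex.Re (along v) + (y i - y j)) (complex.Re (along v)).
  rewrite addrAC subrr add0r /c; lra.
- apply: le_trans (ler_normD _ _) _; rewrite addrC; apply: lerD; first exact: y_near.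
  exact: le_trans (nc_Re _) av.
Qed.

End PolynomialMaps.

(** * Multiples of all step lengths of an interval *)

Section Ladder.
Variable R : realType.

(** Within a block of constant step, the residues of the rungs modulo [t] drift
    slowly upwards and must cross 0, wherever the ladder starts. This works when
    the step is slightly larger than a multiple of [t]; one block for each step of
    a fine enough arithmetic progression serves all [t] of a compact interval. *)
Lemma ladder (c eta t1 t2 : R) : 0 < eta -> 0 < t1 ->
  exists (y : nat -> R) (L : nat), [/\ y 0%N = 0, forall i, y i + c <= y i.+1 &
    forall N t, 0 <= N -> t1 <= t <= t2 ->
      exists i k : nat, (i <= L)%N /\ `|N + y i - k%:R * t| <= 2 * eta].
Proof.
move=> eta0 t10.
have [m [m0 mc]] := nat_above (`|c| / t1).
have {}mc : `|c| <= m%:R * t1 by rewrite -ler_pdivrMr.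
have [J [J0 JP]] := nat_above (t2 / eta).
have {}JP : t2 <= J%:R * eta by rewrite -ler_pdivrMr.
have [S [S0 SP]] := nat_above (m%:R * (t2 - t1) / eta).
pose sg (s : nat) : R := m%:R * t1 + (s.+2)%:R * eta.
pose y (i : nat) := \sum_(u < i) sg (u %/ J)%N.
have yS i : y i.+1 = y i + sg (i %/ J)%N by rewrite /y big_ord_recr.
have sg_ge0 s : 0 <= sg s by apply: addr_ge0; apply: mulr_ge0 => //; exact: ltW.
have y_ge0 i : 0 <= y i by apply: sumr_ge0 => u _; exact: sg_ge0.
have block s j : (j <= J)%N -> y (s * J + j)%N = y (s * J)%N + j%:R * sg s.
  elim: j => [|j IH] jJ; first by rewrite addn0 mul0r addr0.
  rewrite addnS yS IH; last exact: ltnW.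
  by rewrite divnMDl// divn_small// addn0 -natr1; ring.
exists y, ((S.+1) * J)%N; split; first by rewrite /y big_ord0.
  move=> i; rewrite yS lerD2l /sg; have := ler_norm c.
  have : 0 <= (i %/ J).+2%:R * eta by rewrite mulr_ge0 ?(ltW eta0).
  lra.
move=> N t N0 /andP[t1t tt2]; have t0 : 0 < t by exact: lt_le_trans t1t.
pose z := m%:R * (t - t1) / eta.
have z0 : 0 <= z by rewrite divr_ge0 ?mulr_ge0 ?subr_ge0 ?(ltW eta0).
have /andP[sz zs] := truncn_itv z0; set s := Num.truncn z in sz zs.
have sS : (s <= S)%N.
  rewrite -(ler_nat R); apply: le_trans sz _; apply: le_trans SP.
  by rewrite ler_wpM2r ?invr_ge0 ?(ltW eta0)// ler_wpM2l// lerD2r.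
rewrite ler_pdivlMr// in sz; rewrite ltr_pdivrMr// in zs.
pose x0 := N + y (s * J)%N.
have x00 : 0 <= x0 / t by rewrite divr_ge0 ?addr_ge0 ?(ltW t0).
have /andP[kx xk] := truncn_itv x00; set k0 := Num.truncn _ in kx xk.
rewrite ler_pdivlMr// in kx; rewrite ltr_pdivrMr// in xk.
pose d := sg s - m%:R * t.
have d1 : eta <= d by rewrite /d /sg -!natr1; rewrite -natr1 in zs; lra.
have d2 : d <= 2 * eta by rewrite /d /sg -!natr1; lra.
(* The distance of the [j]-th rung of block [s] to a multiple of [t]: it starts
   negative and increases by [d], between [eta] and [2 * eta], at each rung. *)
pose v (j : nat) := x0 - k0.+1%:R * t + j%:R * d.
have vJ : 0 <= v J.
  have : J%:R * eta <= J%:R * d by rewrite ler_wpM2l.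
  rewrite /v -natr1; lra.
have ex : exists j, 0 <= v j by exists J.
case: (ex_minnP ex) => j vj jmin.
have jJ : (j <= J)%N := jmin J vJ.
case: j vj jmin jJ => [|j] vj jmin jJ.
  by move: vj; rewrite /v mul0r addr0; lra.
have vj' : v j < 0.
  by rewrite ltNge; apply/negP => /jmin; rewrite ltnn.
exists (s * J + j.+1)%N, (k0.+1 + j.+1 * m)%N; split.
  apply: (@leq_trans (s * J + J)%N); first by rewrite leq_add2l.
  by rewrite addnC -mulSn leq_mul2r ltnS sS orbT.
have -> : N + y (s * J + j.+1)%N - (k0.+1 + j.+1 * m)%:R * t = v j.+1.
  by rewrite block// /v /d /x0 natrD natrM; ring.
rewrite ger0_norm//; move: vj'; rewrite /v -[j.+1%:R]natr1; lra.
Qed.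

End Ladder.

(** * Far corrections below a transcendental growth *)

Section Modification.
Variables (R : realType) (n m : nat).
Local Notation C := R[i].
Local Notation V := 'rV[C]_n.
Local Notation W := 'rV[C]_m.

(** The correction is the wanted difference damped by [1 - (1 - (w / a) ^+ M) ^+ K],
    [w] being the coordinate along [theta]: its degree does not depend on the
    distance [a] and all its coefficients tend to 0 as [a] grows, so that it falls
    below any multiple of [phi]. *)
Lemma far_modification (phi : R -> R) (theta : V) (F G : V -> W) (R0 R1 d : R) :
  (forall i : nat, exists2 c : R, 0 < c & forall x, 0 <= x -> c * x ^+ i <= phi x) ->
  theta != 0 -> polymap F -> polymap G -> 0 < d ->
  exists (a : R) (p : V -> W), [/\ 0 <= a, polymap p,
    forall z, n1 (p z) <= d * phi (enorm z),
    forall z, n1 z <= R0 -> n1 (p z) <= d &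
    forall z, n1 (z - a%:C *: theta) <= R1 ->
      n1 (F z + p z - G (z - a%:C *: theta)) <= d].
Proof.
move=> phiP theta0 pF pG d0.
have [j0 th0] : exists j0, theta ord0 j0 != 0.
  by apply/rV0Pn.
have [KF [DF [KF0 FP]]] := polymap_growth pF.
have [KG [DG [KG0 GP]]] := polymap_growth pG.
pose D := maxn DF DG.
pose T := 1 + n1 theta; have T1 : 1 <= T by rewrite lerDl n1_ge0.
have T0 : 0 < T := lt_le_trans ltr01 T1.
pose C1 := (KF + KG) * T ^+ D.
have C10 : 0 <= C1 by rewrite mulr_ge0 ?addr_ge0 ?exprn_ge0 ?(ltW T0).
pose q (a : R) (z : V) : W := G (z - a%:C *: theta) - F z.
have qP a z : 0 <= a -> n1 (q a z) <= C1 * (1 + a + n1 z) ^+ D.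
  move=> a0; apply: le_trans (n1B _ _) _.
  have z0 := n1_ge0 z; have th := n1_ge0 theta.
  have b1 : 1 + n1 z <= T * (1 + a + n1 z).
    have : 1 * (1 + a + n1 z) <= T * (1 + a + n1 z) by rewrite ler_wpM2r//; lra.
    lra.
  have b2 : 1 + n1 (z - a%:C *: theta) <= T * (1 + a + n1 z).
    have := n1B z (a%:C *: theta); rewrite n1Z nc_real ger0_norm// => h.
    have : 0 <= n1 theta * n1 z by rewrite mulr_ge0.
    rewrite /T; lra.
  have pw (b : R) (E : nat) : (E <= D)%N -> 1 <= b -> b <= T * (1 + a + n1 z) ->
      b ^+ E <= T ^+ D * (1 + a + n1 z) ^+ D.
    move=> ED b1' bT; rewrite -exprMn.
    apply: (@le_trans _ _ (b ^+ D)); first exact: ler_weXn2l.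
    by apply: lerXn2r; rewrite ?nnegrE; lra.
  rewrite /C1 -mulrA mulrDl addrC; apply: lerD.
    apply: le_trans (FP z) _; rewrite ler_wpM2l// pw ?leq_maxl//; lra.
  apply: le_trans (GP _) _; rewrite ler_wpM2l// pw ?leq_maxr//.
  by rewrite lerDl n1_ge0.
clearbody C1; clear T T1 T0 FP GP.
pose B := along_norm theta j0; have B1 : 1 <= B := along_norm_ge1 theta j0.
have B0 : 0 < B := lt_le_trans ltr01 B1.
(* Around the origin and around [a *: theta] the difference [q a] has size at most a
   constant times [a ^+ D]: the exponents are chosen so that the cut-off gains a
   factor [1 / a] more. *)
pose M := D.+1; pose K := D.+1.
pose N := n%:R : R; have N0 : 0 <= N by [].
pose C2 := C1 * (2 + N) ^+ D * 2 ^+ K.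
have C20 : 0 <= C2.
  apply: mulr_ge0; last by rewrite exprn_ge0.
  by apply: mulr_ge0 => //; rewrite exprn_ge0// addr_ge0.
have C2E : C2 = C1 * (2 + N) ^+ D * 2 ^+ K by [].
clearbody C2.
have [cM cM0 cMP] := phiP M.
have [cH cH0 cHP] := phiP (D + M * K)%N.
pose R0' := Num.max 0 R0; pose R1' := Num.max 0 R1.
have R0'0 : 0 <= R0' by rewrite le_max lexx.
have R1'0 : 0 <= R1' by rewrite le_max lexx.
pose C3 := C1 * (3 + n1 theta) ^+ D * (2 ^+ M * (B * R1')) ^+ K.
have C30 : 0 <= C3.
  apply: mulr_ge0; last by rewrite exprn_ge0// mulr_ge0 ?exprn_ge0// mulr_ge0 ?(ltW B0).
  by apply: mulr_ge0 => //; rewrite exprn_ge0// addr_ge0 ?n1_ge0.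
have C3E : C3 = C1 * (3 + n1 theta) ^+ D * (2 ^+ M * (B * R1')) ^+ K by [].
clearbody C3.
pose a1 := C2 * B ^+ M / (d * cM).
pose a2 := C2 * B ^+ (D + M * K) / (d * cH).
pose a3 := C2 * (B * R0') ^+ M / d.
pose a4 := B * R0'. pose a5 := B * R1'. pose a6 := C3 / d.
have a1_ge0 : 0 <= a1.
  by rewrite divr_ge0 ?mulr_ge0 ?exprn_ge0 ?(ltW B0) ?(ltW d0) ?(ltW cM0).
have a2_ge0 : 0 <= a2.
  by rewrite divr_ge0 ?mulr_ge0 ?exprn_ge0 ?(ltW B0) ?(ltW d0) ?(ltW cH0).
have a3_ge0 : 0 <= a3.
  by rewrite divr_ge0 ?mulr_ge0 ?exprn_ge0 ?mulr_ge0 ?(ltW B0) ?(ltW d0).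
have a4_ge0 : 0 <= a4 by rewrite mulr_ge0 ?(ltW B0).
have a5_ge0 : 0 <= a5 by rewrite mulr_ge0 ?(ltW B0).
have a6_ge0 : 0 <= a6 by rewrite divr_ge0 ?(ltW d0).
(* Each summand is the lower bound on [a] required by one of the estimates. *)
pose a := 1 + a1 + a2 + a3 + a4 + a5 + a6.
have a_ge1 : 1 <= a by rewrite /a; lra.
have a_gt0 : 0 < a by lra.
have aC : a%:C != 0 by rewrite -nc_eq0 nc_real normr_eq0 gt_eqF.
have dM : C2 * B ^+ M <= d * cM * a.
  by rewrite -ler_pdivrMl ?mulr_gt0// mulrC -/a1 /a; lra.
have dH : C2 * B ^+ (D + M * K) <= d * cH * a.
  by rewrite -ler_pdivrMl ?mulr_gt0// mulrC -/a2 /a; lra.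
have dR0 : C2 * (B * R0') ^+ M <= d * a.
  by rewrite -ler_pdivrMl// mulrC -/a3 /a; lra.
have d3 : C3 <= d * a by rewrite -ler_pdivrMl// mulrC -/a6 /a; lra.
have aR0 : B * R0' <= a by rewrite -/a4 /a; lra.
have aR1 : B * R1' <= a by rewrite -/a5 /a; lra.
clearbody a.
pose v z : C := (along theta j0 z * (a^-1)%:C) ^+ M.
pose chi z : C := 1 - (1 - v z) ^+ K.
pose p z := chi z *: q a z.
have vP z X : nc (along theta j0 z) <= X -> nc (v z) <= (X / a) ^+ M.
  move=> zX; rewrite ncX ncM nc_real gtr0_norm ?invr_gt0//.
  rewrite lerXn2r ?nnegrE ?mulr_ge0 ?nc_ge0 ?invr_ge0 ?(ltW a_gt0)//.
    by apply: le_trans zX; exact: nc_ge0.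
  by rewrite ler_wpM2r ?invr_ge0 ?(ltW a_gt0).
have MK : (0 < M * K)%N by [].
have alongE z : nc (along theta j0 z) <= B * enorm z.
  by apply: nc_along; exact: nc_le_enorm.
have qmax z X : n1 z <= N * X -> n1 (q a z) <= C1 * (2 + N) ^+ D * Num.max a X ^+ D.
  move=> zX; apply: le_trans (qP a z (ltW a_gt0)) _; rewrite -mulrA ler_wpM2l// -exprMn.
  have m1 : a <= Num.max a X by rewrite le_max lexx.
  have m2 : X <= Num.max a X by rewrite le_max lexx orbT.
  have NX : N * X <= N * Num.max a X by rewrite ler_wpM2l.
  have z_ge0 := n1_ge0 z.
  have le_max : 1 + a + n1 z <= (2 + N) * Num.max a X.
    by clear -a_ge1 m1 zX NX; lra.
  have ge_0 : 0 <= 1 + a + n1 z by rewrite !addr_ge0// ltW.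
  by apply: lerXn2r => //; rewrite nnegrE; exact: le_trans ge_0 le_max.
have pinner z : B * enorm z <= a -> n1 (p z) * a <= C2 * (B * enorm z) ^+ M.
  move=> xa; have x0 := enorm_ge0 z; set X := B * enorm z in xa *.
  have X0 : 0 <= X by rewrite mulr_ge0 ?(ltW B0).
  have nX : n1 z <= N * X.
    apply: le_trans (n1_le_enorm z) _; rewrite ler_wpM2l// /X.
    by rewrite -[X in X <= _]mul1r ler_wpM2r.
  have u1 : (X / a) ^+ M <= 1.
    by rewrite exprn_ile1 ?divr_ge0 ?(ltW a_gt0)// ler_pdivrMr// mul1r.
  have h1 : nc (chi z) <= 2 ^+ K * (X / a) ^+ M.
    by apply: nc_cutoff_small => //; apply: vP; exact: alongE.
  have h2 := qmax z X nX; rewrite max_l// in h2.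
  rewrite n1Z; apply: le_trans (ler_wpM2r (ltW a_gt0) (ler_pM (nc_ge0 _) (n1_ge0 _) h1 h2)) _.
  rewrite le_eqVlt; apply/orP; left; apply/eqP.
  rewrite C2E /M expr_div_n [a ^+ D.+1]exprS; field.
  by rewrite ?expf_neq0 gt_eqF.
have pouter z : a <= B * enorm z -> n1 (p z) * a <= C2 * (B * enorm z) ^+ (D + M * K).
  move=> xa; have x0 := enorm_ge0 z; set X := B * enorm z in xa *.
  have X0 : 0 <= X by rewrite mulr_ge0 ?(ltW B0).
  have nX : n1 z <= N * X.
    apply: le_trans (n1_le_enorm z) _; rewrite ler_wpM2l// /X.
    by rewrite -[X in X <= _]mul1r ler_wpM2r.
  have u1 : 1 <= (X / a) ^+ M by rewrite exprn_ege1// ler_pdivlMr// mul1r.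
  have h1 : nc (chi z) <= 2 ^+ K * ((X / a) ^+ M) ^+ K.
    by apply: nc_cutoff_large => //; apply: vP; exact: alongE.
  have h2 := qmax z X nX; rewrite max_r// in h2.
  rewrite n1Z; apply: le_trans (ler_wpM2r (ltW a_gt0) (ler_pM (nc_ge0 _) (n1_ge0 _) h1 h2)) _.
  rewrite -exprM expr_div_n.
  have e1 : a / a ^+ (M * K) <= 1.
    rewrite ler_pdivrMr ?exprn_gt0// mul1r -[X in X <= _]expr1.
    exact: ler_weXn2l.
  have -> : 2 ^+ K * (X ^+ (M * K) / a ^+ (M * K)) * (C1 * (2 + N) ^+ D * X ^+ D) * a =
     C2 * X ^+ (D + M * K) * (a / a ^+ (M * K)) by rewrite C2E exprD; ring.
  by rewrite ler_piMr// mulr_ge0 ?exprn_ge0.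
exists a, p; split; first exact: ltW.
- apply: polymapZ.
    apply: polyfB; first exact: polyf_cst.
    apply: polyfX; apply: polyfB; first exact: polyf_cst.
    apply: polyfX; apply: polyfM; last exact: polyf_cst.
    exact: polyf_along.
  apply: polymapB => //; exact: polymap_translate.
- move=> z; have x0 := enorm_ge0 z; rewrite -(ler_pM2r a_gt0).
  have [xa|/ltW xa] := leP (B * enorm z) a.
    apply: le_trans (pinner z xa) _; rewrite exprMn mulrA.
    apply: le_trans (ler_wpM2r (exprn_ge0 M x0) dM) _.
    by have := ler_wpM2l (mulr_ge0 (ltW d0) (ltW a_gt0)) (cMP _ x0); lra.
  apply: le_trans (pouter z xa) _; rewrite exprMn mulrA.
  apply: le_trans (ler_wpM2r (exprn_ge0 (D + M * K) x0) dH) _.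
  by have := ler_wpM2l (mulr_ge0 (ltW d0) (ltW a_gt0)) (cHP _ x0); lra.
- move=> z zR; have x0 := enorm_ge0 z; rewrite -(ler_pM2r a_gt0).
  have xR : enorm z <= R0' by rewrite (le_trans (enorm_le_n1 z))// le_max zR orbT.
  have BxR : B * enorm z <= B * R0' by rewrite ler_wpM2l ?(ltW B0).
  apply: le_trans (pinner z (le_trans BxR aR0)) _; apply: le_trans dR0.
  rewrite ler_wpM2l// lerXn2r ?nnegrE ?mulr_ge0 ?(ltW B0)//.
- move=> z; set y := z - a%:C *: theta => yR.
  have zE : z = y + a%:C *: theta by rewrite subrK.
  have -> : F z + p z - G y = (chi z - 1) *: q a z.
    have key (f g x : W) : f + x - g = x - (g - f).
      by rewrite opprB addrA [x + f]addrC.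
    by rewrite scalerBl scale1r; exact: key.
  rewrite n1Z.
  have yR' : n1 y <= R1' by rewrite le_max yR orbT.
  pose e := along theta j0 y * (a^-1)%:C.
  have vE : v z = (1 + e) ^+ M.
    rewrite /v zE along_translate// mulrDl -RCM divff ?gt_eqF//.
    by rewrite addrC.
  have ne : nc e <= B * R1' / a.
    rewrite ncM nc_real gtr0_norm ?invr_gt0// ler_wpM2r ?invr_ge0 ?(ltW a_gt0)//.
    by apply: nc_along; exact: le_trans (nc_le_n1 _ _) yR'.
  have u1 : B * R1' / a <= 1 by rewrite ler_pdivrMr// mul1r.
  have hchi : nc (chi z - 1) <= (2 ^+ M * (B * R1' / a)) ^+ K.
    have -> : chi z - 1 = - ((1 - v z) ^+ K) by rewrite /chi; ring.
    rewrite ncN ncX lerXn2r ?nnegrE ?nc_ge0 ?mulr_ge0 ?exprn_ge0 ?invr_ge0 ?(ltW B0) ?(ltW a_gt0)//.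
    rewrite vE -[e]opprK; apply: nc_cutoff_small => //; by rewrite ncN.
  have hq : n1 (q a z) <= C1 * (3 + n1 theta) ^+ D * a ^+ D.
    apply: le_trans (qP a z (ltW a_gt0)) _; rewrite -mulrA ler_wpM2l// -exprMn.
    have z_ge0 := n1_ge0 z.
    have zR1 : n1 z <= R1' + a * n1 theta.
      rewrite zE; apply: le_trans (n1D _ _) _.
      by rewrite n1Z nc_real gtr0_norm// lerD2r.
    have BR1 : 1 * R1' <= B * R1' by rewrite ler_wpM2r.
    have le_3a : 1 + a + n1 z <= (3 + n1 theta) * a.
      by clear -a_ge1 zR1 BR1 aR1; lra.
    have ge_0 : 0 <= 1 + a + n1 z by rewrite !addr_ge0// ltW.
    by apply: lerXn2r => //; rewrite nnegrE; exact: le_trans ge_0 le_3a.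
  apply: le_trans (ler_pM (nc_ge0 _) (n1_ge0 _) hchi hq) _.
  rewrite -(ler_pM2r a_gt0); apply: le_trans d3.
  rewrite le_eqVlt; apply/orP; left; apply/eqP.
  have -> : 2 ^+ M * (B * R1' / a) = 2 ^+ M * (B * R1') / a by rewrite mulrA.
  rewrite C3E expr_div_n /K [a ^+ D.+1]exprS; field.
  by rewrite ?expf_neq0 gt_eqF.
Qed.

End Modification.

(** * Growth functions *)

Section GrowthFunction.
Variable R : realType.

(** Comparison of the series with a geometric one; convergence matters because
    [limn] of a divergent sequence carries no information. *)
Lemma growth_fun_ge (A : nat -> R) (i : nat) (x : R) : transcendental_growth A ->
  0 <= x -> A i * x ^+ i <= growth_fun A x.
Proof.
move=> [A0 Alim] x0; set u := fun k => A k * x ^+ k.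
have u_ge0 k : 0 <= u k by rewrite mulr_ge0 ?exprn_ge0 ?(ltW (A0 k)).
have SS k : pseries A x k.+1 = pseries A x k + u k.
  by rewrite /pseries /series /= big_nat_recr.
have mono : nondecreasing_seq (pseries A x).
  by apply/nondecreasing_seqP => k; rewrite SS lerDl.
have x1 : 0 < 2 * (x + 1) by rewrite mulr_gt0// ltr_wpDl.
have [N NP] : exists N : nat, forall k, (N <= k)%N -> 2 * u k.+1 <= u k.
  have e0 : 0 < (2 * (x + 1))^-1 by rewrite invr_gt0.
  have /cvgrPdist_lt /(_ _ e0) [N _ NP] := Alim.
  exists N => k /NP /=; rewrite sub0r normrN gtr0_norm ?divr_gt0// => h.
  have {}h : A k.+1 * (2 * (x + 1)) <= A k.
    rewrite -ler_pdivlMr// mulrC -ler_pdivrMr//; exact: ltW.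
  have xk : 0 <= x ^+ k by rewrite exprn_ge0.
  have h2 : A k.+1 * (2 * x) <= A k.
    by apply: le_trans h; rewrite ler_wpM2l ?(ltW (A0 _))//; lra.
  by have := ler_wpM2r xk h2; rewrite /u exprS; lra.
have bound k : pseries A x (N + k)%N + 2 * u (N + k)%N <= pseries A x N + 2 * u N.
  elim: k => [|k IH]; first by rewrite addn0.
  by apply: le_trans IH; rewrite addnS SS; have := NP (N + k)%N (leq_addr _ _); lra.
have cv : cvgn (pseries A x).
  apply: nondecreasing_is_cvgn => //; exists (pseries A x N + 2 * u N) => _ [k _ <-].
  apply: le_trans (bound k); apply: (@le_trans _ _ (pseries A x (N + k)%N)).
    by apply: mono; rewrite leq_addl.
  by rewrite lerDl mulr_ge0.
apply: le_trans (nondecreasing_cvgn_le mono cv i.+1).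
rewrite SS lerDr; apply: sumr_ge0 => k _; exact: u_ge0.
Qed.

End GrowthFunction.

(** * Differentiability in coordinates *)

Section Bridges.
Variables (R : realType).
Local Notation C := R[i].

Lemma norm_rV_le (n : nat) (v : 'rV[C]_n) : `|v| <= (n1 v)%:C.
Proof.
have n1C : 0 <= (n1 v)%:C by rewrite lecR n1_ge0.
rewrite /Num.norm /= mx_normE.
have -> : (n1 v)%:C = (NngNum n1C)%:num by [].
rewrite num_le; apply/bigmax_leP; split => //= -[i j] _ /=.
by rewrite -num_le /= ord1 norm_nc lecR nc_le_n1.
Qed.

Lemma nc_le_norm_rV (n : nat) (v : 'rV[C]_n) j : (nc (v ord0 j))%:C <= `|v|.
Proof.
rewrite /Num.norm /= mx_normE -norm_nc.
have -> : `|v ord0 j| = (`|v ord0 j|%:nng)%:num by [].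
by rewrite num_le; apply/bigmax_geP; right => /=; exists (ord0, j).
Qed.

Lemma entire_slice_eps (n m : nat) (H : 'rV[C]_n -> 'rV[C]_m) (k : 'I_m) z u l :
  differentiable H (z + l *: u) -> cderivable (fun l => H (z + l *: u) ord0 k) l.
Proof.
set z0 := z + l *: u => dH.
have [_ dE] := (diff_locallyP _ _).1 dH.
move/eqaddoP: dE => dE.
apply: (@cderivable_eps _ _ ('d H z0 u ord0 k)) => e e0.
pose e' := e / (n1 u + 1); have u1 : 0 < n1 u + 1 by rewrite ltr_wpDl ?n1_ge0.
have e'0 : 0 < e' by rewrite divr_gt0.
have e'C : 0 < e'%:C by rewrite ltcR.
have := dE _ e'C => /nbhs_ballP[/= d d0 dP].
have [dE' d0'] := gt0_complexE d0.
exists (complex.Re d / (n1 u + 1)); first by rewrite divr_gt0.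
move=> y yd; set h := (y - l) *: u.
have hn : n1 h < complex.Re d.
  rewrite n1Z; move: yd; rewrite ltr_pdivlMr// => yd.
  by apply: le_lt_trans yd; rewrite ler_wpM2l ?nc_ge0// lerDl.
have hb : ball 0 d h.
  rewrite -ball_normE /ball_ /= sub0r normrN dE'.
  by apply: le_lt_trans (norm_rV_le h) _; rewrite ltcR.
have := dP h hb; rewrite /= => H1.
have := le_trans (nc_le_norm_rV _ k) H1.
have -> : H (z + y *: u) = H (h + z0).
  by congr H; rewrite /h /z0 scalerBl addrCA subrK.
move=> H2.
have H3 : (nc (((H \o shift z0 - (cst (H z0) + 'd H z0)) h : 'rV_m) ord0 k))%:C <= (e' * n1 h)%:C.
  apply: le_trans H2 _; rewrite RCM; apply: ler_wpM2l; last exact: norm_rV_le.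
  by rewrite lecR ltW.
move: H3; rewrite lecR => H3.
have -> : H (h + z0) ord0 k - H z0 ord0 k - 'd H z0 u ord0 k * (y - l) =
   ((H \o shift z0 - (cst (H z0) + 'd H z0)) h : 'rV_m) ord0 k.
  have -> : (H \o shift z0 - (cst (H z0) + 'd H z0)) h =
      H (h + z0) - H z0 - (y - l) *: 'd H z0 u.
    by rewrite !fctE /= opprD addrA /h linearZ.
  by rewrite !mxE mulrC.
apply: le_trans H3 _; rewrite n1Z mulrCA [X in _ <= X]mulrC ler_wpM2l ?nc_ge0//.
by rewrite /e' mulrAC ler_pdivrMr// ler_wpM2l ?(ltW e0)// lerDl.
Qed.

(** Bounded sets of complex vectors lie in compact boxes, products of squares that
    are continuous images of real squares. *)
Lemma box_compact (n : nat) (r : R) : compact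
  [set v : 'rV[C]_n | forall i, ([set x : C | `|complex.Re x| <= r /\ `|complex.Im x| <= r]) (v ord0 i)].
Proof.
apply: (@rV_compact _ n (fun _ => [set x : C | `|complex.Re x| <= r /\ `|complex.Im x| <= r])) => _.
pose f (p : R * R) : C := p.1 +i* p.2.
have -> : [set x : C | `|complex.Re x| <= r /\ `|complex.Im x| <= r] =
   f @` (`[- r, r]%classic `*` `[- r, r]%classic).
  apply/seteqP; split.
    case=> a b /= [ha hb]; exists (a, b) => //.
    by split; rewrite /= in_itv /= -ler_norml.
  by move=> _ [[a b] [/= ha hb] <-] /=; rewrite !in_itv /= -!ler_norml in ha hb.
apply: continuous_compact; last by apply: compact_setX; exact: segment_compact.
apply: continuous_subspaceT => p; apply/continuous_ncP => e e0.
have e2 : 0 < e / 2 by rewrite divr_gt0.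
apply: filterS (nbhsx_ballx p _ e2) => q [/= q1 q2].
rewrite -ball_normE /ball_ /= in q1; rewrite -ball_normE /ball_ /= in q2.
change (nc (f q - f p) < e); apply: le_lt_trans (nc_le_ReIm _) _ => /=.
rewrite distrC in q1; rewrite distrC in q2; lra.
Qed.

Lemma n1_continuous (n : nat) (z : 'rV[C]_n) (e : R) : 0 < e ->
  \forall y \near z, n1 (y - z) < e.
Proof.
move=> e0; have d0 : 0 < e / (n%:R + 1) by rewrite divr_gt0// ltr_wpDl.
have dC : 0 < (e / (n%:R + 1))%:C by rewrite ltcR.
apply: filterS (nbhsx_ballx z _ dC) => y.
rewrite -ball_normE /ball_ /= => yz.
have h j : nc ((y - z) ord0 j) <= e / (n%:R + 1).
  have := le_trans (nc_le_norm_rV (y - z) j) (ltW (_ : `|y - z| < (e / (n%:R + 1))%:C)).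
  by rewrite lecR; apply; rewrite distrC.
apply: (@le_lt_trans _ _ (n%:R * (e / (n%:R + 1)))).
  by rewrite mulr_natl -[X in _ *+ X]card_ord -sumr_const; apply: ler_sum.
rewrite mulrCA gtr_pMr// ltr_pdivrMr ?ltr_wpDl// mul1r; by rewrite ltrDl.
Qed.

Lemma continuous_n1 (n m : nat) (H : 'rV[C]_n -> 'rV[C]_m) z e : 0 < e ->
  {for z, continuous H} -> \forall y \near z, n1 (H y - H z) < e.
Proof. by move=> e0 cH; exact: cH (n1_continuous (H z) e0). Qed.

Lemma holomorphic_entire (n m : nat) (H : 'rV[C]_n -> 'rV[C]_m) (k : 'I_m) :
  holomorphic H -> entire (fun z => H z ord0 k).
Proof.
move=> dH; split=> [z u l|r]; first exact: entire_slice_eps.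
have := @box_compact n r => /compact_near_coveringP.
move=> /(_ nat \oo (fun N z => n1 (H z) <= N%:R) _) cov.
have [|N _ NP] := cov.
  move=> z _; have cz : {for z, continuous H} := differentiable_continuous (dH z).
  have [N0 [_ hN0]] := nat_above (n1 (H z) + 1).
  exists ([set y | n1 (H y - H z) < 1], [set N | (N0 <= N)%N]).
    by split; [exact: continuous_n1|exists N0].
  move=> [y N] /= [hy hN].
  have := n1D (H y - H z) (H z); rewrite subrK => h.
  have : N0%:R <= N%:R :> R by rewrite ler_nat.
  lra.
exists N%:R => z zr; apply: le_trans (nc_le_n1 _ _) _.
apply: (NP N) => //= i.
have := le_trans (nc_le_n1 z i) zr => h.
by split; [exact: le_trans (nc_Re _) h|exact: le_trans (nc_Im _) h].
Qed.

(** A quadratic remainder in coordinates yields differentiability for the sup norm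
    of the space of row vectors, which takes its values in the complex numbers. *)
Lemma differentiable_quadratic (n m : nat) (F : 'rV[C]_n -> 'rV[C]_m) z
    (M : 'M[C]_(n, m)) (K : R) : 0 <= K ->
  (forall h, n1 h <= 1 -> n1 (F (z + h) - F z - h *m M) <= K * n1 h ^+ 2) ->
  differentiable F z.
Proof.
move=> K0 FP.
have cM : continuous (mulmxr M : 'rV[C]_n -> 'rV[C]_m).
  move=> v; have Fv : Filter (nbhs v) := nbhs_filter v; apply/cvgrPdist_lt => e e0.
  have [eE e0'] := gt0_complexE e0.
  pose S := \sum_i \sum_j nc (M i j).
  have S0 : 0 <= S by apply: sumr_ge0 => i _; apply: sumr_ge0 => j _; exact: nc_ge0.
  have S1 : 0 < S + 1 by rewrite ltr_wpDl.
  have d0 : 0 < complex.Re e / (S + 1) by rewrite divr_gt0.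
  apply: filterS (n1_continuous v d0) => y /= yv.
  rewrite -mulmxBl; apply: le_lt_trans (norm_rV_le _) _; rewrite eE ltcR.
  apply: (@le_lt_trans _ _ (n1 (v - y) * S)).
    rewrite /n1 (@le_trans _ _ (\sum_j \sum_i nc ((v - y) ord0 i) * nc (M i j)))//.
      apply: ler_sum => j _; rewrite mxE; apply: le_trans (nc_sum _ _ _) _.
      by apply: ler_sum => i _; rewrite ncM.
    rewrite exchange_big /= mulr_suml; apply: ler_sum => i _; rewrite -mulr_sumr.
    apply: ler_wpM2l; first exact: nc_ge0.
    rewrite /S (bigD1 i)//= lerDl; apply: sumr_ge0 => i' _.
    by apply: sumr_ge0 => j _; exact: nc_ge0.
  have -> : n1 (v - y) = n1 (y - v) by rewrite -n1N opprB.
  rewrite ltr_pdivlMr// in yv; apply: le_lt_trans yv.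
  by rewrite ler_wpM2l ?n1_ge0// lerDl.
have oF : F \o shift z = cst (F z) + mulmxr M +o_ (0 : 'rV[C]_n) id.
  apply/eqaddoP => e e0.
  have [eE e0'] := gt0_complexE e0.
  pose d := Num.min 1 (complex.Re e / ((K + 1) * (n%:R + 1))).
  have Kn : 0 < (K + 1) * (n%:R + 1) by rewrite mulr_gt0// ltr_wpDl.
  have d0 : 0 < d by rewrite lt_min ltr01 divr_gt0.
  apply: filterS (n1_continuous 0 d0) => h; rewrite subr0 => hd.
  have h1 : n1 h <= 1 by apply: ltW; apply: lt_le_trans hd _; rewrite ge_min lexx.
  have hd2 : n1 h * ((K + 1) * (n%:R + 1)) <= complex.Re e.
    rewrite -ler_pdivlMr//; apply: ltW; apply: lt_le_trans hd _.
    by rewrite ge_min lexx orbT.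
  apply: le_trans (norm_rV_le _) _.
  have -> : (F \o shift z - (cst (F z) + mulmxr M)) h = F (z + h) - F z - h *m M.
    by rewrite !fctE /= [h + z]addrC opprD addrA.
  have hn : (n1 h)%:C <= (n%:R + 1) * `|h|.
    have nE : (n1 h)%:C = \sum_j (nc (h ord0 j))%:C by rewrite /n1 rmorph_sum.
    rewrite nE; apply: (@le_trans _ _ (\sum_(j < n) `|h|)).
      by apply: ler_sum => j _; exact: nc_le_norm_rV.
    by rewrite sumr_const card_ord -[X in X <= _]mulr_natl ler_wpM2r// lerDl.
  apply: (@le_trans _ _ ((complex.Re e / (n%:R + 1))%:C * (n1 h)%:C)).
    rewrite -RCM lecR; apply: le_trans (FP h h1) _.
    rewrite expr2 mulrA ler_wpM2r ?n1_ge0// ler_pdivlMr ?ltr_wpDl//.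
    apply: le_trans hd2; rewrite [K * _]mulrC -mulrA ler_wpM2l ?n1_ge0//.
    by rewrite ler_wpM2r ?addr_ge0// lerDl.
  apply: le_trans (ler_wpM2l _ hn) _.
    by rewrite lecR divr_ge0 ?(ltW e0')// addr_ge0.
  rewrite mulrA ler_wpM2r// eE.
  have -> : (n%:R + 1 : C) = (n%:R + 1)%:C by rewrite RCD rmorph_nat.
  by rewrite -RCM lecR divfK// gt_eqF// ltr_wpDl.
have dE : 'd F z = mulmxr M :> ('rV[C]_n -> 'rV[C]_m) by exact: diff_unique cM oF.
by apply/diff_locallyP; rewrite dE.
Qed.

End Bridges.

(** * The compact-open topology on holomorphic maps *)

Section HolTopology.
Variables (R : realType) (n m : nat).
Local Notation C := R[i].
Local Notation V := 'rV[C]_n.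
Local Notation W := 'rV[C]_m.

Lemma hol_continuous (H : hol R n m) : continuous (hol_fun H).
Proof. by move=> z; exact: differentiable_continuous (set_mem (valP H) z). Qed.

(** The neighbourhood filter of [h] for uniform convergence on balls, which will
    be shown to be finer than that of the compact-open topology. *)
Definition ball_filter (h : V -> W) : set_system (V -> W) :=
  [set P | exists (r e : R), 0 < e /\
     forall g : V -> W, (forall z, n1 z <= r -> n1 (g z - h z) < e) -> P g].

Lemma ball_filter_filter h : Filter (ball_filter h).
Proof.
split.
- by exists 0, 1.
- move=> P Q [r [e [e0 HP]]] [s [d [d0 HQ]]].
  exists (Num.max r s), (Num.min e d); split; first by rewrite lt_min e0.
  move=> g gh; split.
    apply: HP => z zr; have := gh z; rewrite le_max zr => /(_ isT).
    by rewrite lt_min => /andP[].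
  apply: HQ => z zr; have := gh z; rewrite le_max zr orbT => /(_ isT).
  by rewrite lt_min => /andP[].
- move=> P Q PQ [r [e [e0 HP]]]; exists r, e; split => // g /HP; exact: PQ.
Qed.

Lemma compact_n1_bounded (K : set V) : compact K -> exists N : nat, forall z, K z -> n1 z <= N%:R.
Proof.
move=> /compact_near_coveringP /(_ nat \oo (fun N z => n1 z <= N%:R) _) cov.
have [|N _ NP] := cov.
  move=> z _; have [N0 [_ hN0]] := nat_above (n1 z + 1).
  exists ([set y | n1 (y - z) < 1], [set N | (N0 <= N)%N]).
    by split; [exact: n1_continuous|exists N0].
  move=> [y N] /= [hy hN].
  have := n1D (y - z) z; rewrite subrK => h.
  have : N0%:R <= N%:R :> R by rewrite ler_nat.
  lra.
by exists N => z Kz; apply: (NP N) => /=.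
Qed.

Lemma ball_filter_cvg (h : V -> W) : continuous h ->
  {compact-open, ball_filter h --> h}.
Proof.
move=> ch; have FF := ball_filter_filter h.
apply/(compact_open_fam_compactP ch FF)/fam_cvgP => K cK.
move=> P /uniform_nbhs [E [entE EP]].
have [N NP] := compact_n1_bounded cK.
move: entE; rewrite -entourage_ballE => -[e /= e0 eE].
have [eC e0'] := gt0_complexE e0.
exists N%:R, (complex.Re e); split => //.
move=> g gh; apply: EP => z Kz; apply: eE => /=.
rewrite -ball_normE /ball_ /=; apply: le_lt_trans (norm_rV_le _) _.
rewrite eC ltcR -n1N opprB; apply: gh; exact: NP.
Qed.

(** The only property of the compact-open topology that the proof uses: its
    neighbourhoods contain those of uniform convergence on balls. *)
Lemma hol_nbhs (H : hol R n m) (O : set (hol R n m)) : nbhs H O ->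
  exists (r e : R), 0 < e /\
    forall G : hol R n m, (forall z, n1 z <= r -> n1 (hol_fun G z - hol_fun H z) < e) -> O G.
Proof.
rewrite nbhsE => -[A [[B oB BA] AH] AO].
have BH : nbhs (hol_fun H : {compact-open, V -> W}) B.
  by apply: open_nbhs_nbhs; split => //; rewrite -BA in AH.
have [r [e [e0 P]]] := ball_filter_cvg (@hol_continuous H) BH.
exists r, e; split => // G /P BG; apply: AO; rewrite -BA; exact: BG.
Qed.

End HolTopology.

(** * Geometrically convergent sequences *)

Section GeometricLimits.
Variable R : realType.
Local Notation C := R[i].

Lemma geom_le_lim (x B K : R) (k0 : nat) :
  (forall k, (k0 <= k)%N -> x <= B + K / 2 ^+ k) -> x <= B.
Proof.
move=> H; rewrite leNgt; apply/negP => Bx.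
have xB : 0 < x - B by rewrite subr_gt0.
have [j jP] := half_pow_small (K / 2 ^+ k0) xB.
have := H (k0 + j)%N (leq_addr _ _).
by rewrite exprD invfM mulrA; lra.
Qed.

(** The limit is the common point of the nested intervals of radius
    [K / 2 ^+ k] around [u k]. *)
Lemma real_geom_limit (u : nat -> R) (K : R) :
  (forall k, `|u k.+1 - u k| <= K / 2 ^+ k.+1) ->
  exists l, forall k, `|u k - l| <= K / 2 ^+ k.
Proof.
move=> uP.
have half k : K / 2 ^+ k = K / 2 ^+ k.+1 + K / 2 ^+ k.+1.
  by rewrite exprS; field; rewrite expf_neq0.
have [l lP] : exists l, forall k, u k - K / 2 ^+ k <= l <= u k + K / 2 ^+ k.
  apply: nested_intervals => k.
  - by have := uP k; rewrite ler_norml (half k) => /andP[h1 h2]; lra.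
  - by have := uP k; rewrite ler_norml (half k) => /andP[h1 h2]; lra.
  - have := uP k; have := normr_ge0 (u k.+1 - u k); rewrite (half k); lra.
exists l => k; have /andP[h1 h2] := lP k.
by rewrite ler_norml; apply/andP; split; lra.
Qed.

Lemma complex_geom_limit (u : nat -> C) (K : R) :
  (forall k, nc (u k.+1 - u k) <= K / 2 ^+ k.+1) ->
  exists l, forall k, nc (u k - l) <= 2 * K / 2 ^+ k.
Proof.
move=> uP.
have [a aP] : exists a, forall k, `|complex.Re (u k) - a| <= K / 2 ^+ k.
  apply: (@real_geom_limit (fun k => complex.Re (u k))) => k.
  by rewrite -cReB; apply: le_trans (nc_Re _) (uP k).
have [b bP] : exists b, forall k, `|complex.Im (u k) - b| <= K / 2 ^+ k.
  apply: (@real_geom_limit (fun k => complex.Im (u k))) => k.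
  by rewrite -cImB; apply: le_trans (nc_Im _) (uP k).
exists (a +i* b) => k; apply: le_trans (nc_le_ReIm _) _.
rewrite cReB cImB /=; have := aP k; have := bP k; rewrite -mulrA; lra.
Qed.

End GeometricLimits.

(** * Limits of polynomials are holomorphic *)

Section Weierstrass.
Variables (R : realType) (n : nat).
Local Notation C := R[i].
Local Notation V := 'rV[C]_n.

Lemma n1_delta (j : 'I_n) : n1 (delta_mx ord0 j : V) = 1.
Proof.
rewrite /n1 (bigD1 j)//= mxE !eqxx nc1 big1 ?addr0// => i /negbTE ij.
by rewrite mxE ij andbF nc0.
Qed.

Lemma n1_eq0 (v : V) : n1 v = 0 -> v = 0.
Proof.
move=> v0; apply/rowP => j; rewrite mxE; apply/eqP; rewrite -nc_eq0.
by apply/eqP/le_anti; rewrite nc_ge0 -v0 nc_le_n1.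
Qed.

(** Cauchy's estimates on complex lines turn a bound on a polynomial into a
    bound on its differential and on its second-order remainder. *)
Lemma polyf_cauchy (g : V -> C) (z : V) (d : R) : polyf g ->
  (forall y, n1 y <= n1 z + 4 -> nc (g y) <= d) ->
  exists l : 'I_n -> C,
    (forall h, n1 h <= 1 -> nc (g (z + h) - g z - \sum_j l j * h ord0 j) <= d * n1 h ^+ 2) /\
    forall j, nc (l j) <= 3 * d.
Proof.
move=> pg gd; have [l [K [K0 KP]]] := polyf_differential z pg.
have d0 : 0 <= d.
  by apply: le_trans (nc_ge0 _) (gd z _); rewrite lerDl.
have quad h : n1 h <= 1 -> nc (g (z + h) - g z - \sum_j l j * h ord0 j) <= d * n1 h ^+ 2.
  move=> h1; have [h0|h0] := eqVneq (n1 h) 0.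
    rewrite (n1_eq0 h0) addr0 subrr big1; last by move=> j _; rewrite mxE mulr0.
    by rewrite subrr nc0 n1_0 expr0n mulr0.
  have t0 : 0 < n1 h by rewrite lt_def h0 n1_ge0.
  set t := n1 h in h1 h0 t0 *.
  have tC : t%:C != 0 by rewrite -nc_eq0 nc_real normr_eq0.
  pose u := (t^-1)%:C *: h.
  have hu : h = t%:C *: u by rewrite scalerA -RCM divff// scale1r.
  have nu : n1 u = 1 by rewrite n1Z nc_real gtr0_norm ?invr_gt0// mulVf.
  have [c cP] : exists c : nat -> C, forall N x, (0 < N)%N -> nc x <= 4 / 2 ->
      nc (g (z + x *: u) - \sum_(k < N) c k * x ^+ k) <= 8 * d * (nc x / 4) ^+ N.
    apply: (@cauchy_taylor _ (fun x => g (z + x *: u))) => //.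
      by move=> x; exact: polyf_slice.
    move=> x x4; apply: gd; apply: le_trans (n1D _ _) _.
    by rewrite lerD2l n1Z nu mulr1.
  have c0 : c 0%N = g z.
    have := cP 1%N 0 isT; rewrite nc0 big_ord1 expr0 mulr1 mul0r expr1 mulr0 scale0r addr0.
    move=> /(_ ltac:(by [])) => H; apply/esym/eqP; rewrite -subr_eq0 -nc_eq0.
    by apply/eqP/le_anti; rewrite nc_ge0 H.
  have c2P x : nc x <= 1 -> nc (g (z + x *: u) - g z - c 1%N * x) <= d * nc x ^+ 2.
    move=> x1; have x2 : nc x <= 4 / 2 by lra.
    have := cP 2%N x isT x2; rewrite !big_ord_recl big_ord0 /= expr0 mulr1 c0 addr0 expr1.
    rewrite opprD addrA => /le_trans; apply.
    have : 0 <= d * nc x ^+ 2 by rewrite mulr_ge0 ?sqr_ge0.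
    rewrite expr_div_n; lra.
  pose La := \sum_j l j * u ord0 j.
  have lE x : \sum_j l j * (x *: u) ord0 j = La * x.
    by rewrite /La mulr_suml; apply: eq_bigr => j _; rewrite mxE mulrCA mulrC.
  (* Two expansions of the same function up to quadratic errors have the same
     slope. *)
  have c1La : c 1%N = La.
    apply/eqP; rewrite -subr_eq0 -nc_eq0; apply/eqP/le_anti; rewrite nc_ge0 andbT.
    apply: (@geom_le_lim _ _ 0 (d + K) 0) => k _; rewrite add0r.
    have s0 : 0 < (2 ^+ k)^-1 :> R by rewrite invr_gt0 exprn_gt0.
    have s1 : (2 ^+ k)^-1 <= 1 :> R by rewrite invf_le1 ?exprn_gt0// exprn_ege1// ler1n.
    have [x xs] : exists x : C, nc x = (2 ^+ k)^-1.
      by exists ((2 ^+ k)^-1)%:C; rewrite nc_real gtr0_norm.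
    have xh : n1 (x *: u) <= 1 by rewrite n1Z nu mulr1 xs.
    have H1 := c2P x; rewrite xs in H1; have {}H1 := H1 s1.
    have H2 := KP _ xh; rewrite n1Z nu mulr1 xs lE in H2.
    have H3 : nc ((c 1%N - La) * x) <= (d + K) * (2 ^+ k)^-1 ^+ 2.
      have -> : (c 1%N - La) * x = (g (z + x *: u) - g z - La * x) -
        (g (z + x *: u) - g z - c 1%N * x) by ring.
      by apply: le_trans (ncB _ _) _; lra.
    by rewrite ncM xs expr2 mulrA ler_pM2r in H3.
  have tn : nc t%:C = t by rewrite nc_real gtr0_norm.
  have := c2P t%:C; rewrite tn -hu c1La -lE -hu; exact.
exists l; split => // j.
have := quad (delta_mx ord0 j); rewrite n1_delta expr1n mulr1 => /(_ (lexx _)).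
have -> : \sum_i l i * (delta_mx ord0 j : V) ord0 i = l j.
  rewrite (bigD1 j)//= mxE !eqxx mulr1 big1 ?addr0// => i /negbTE ij.
  by rewrite mxE ij andbF mulr0.
move=> H.
have g1 : nc (g (z + delta_mx ord0 j)) <= d.
  by apply: gd; apply: le_trans (n1D _ _) _; rewrite n1_delta lerD2l; lra.
have g2 : nc (g z) <= d by apply: gd; lra.
have -> : l j = (g (z + delta_mx ord0 j) - g z) -
  (g (z + delta_mx ord0 j) - g z - l j) by ring.
apply: le_trans (ncB _ _) _; have := ncB (g (z + delta_mx ord0 j)) (g z); lra.
Qed.

(** Weierstrass' theorem at a point, for polynomials: differentials and their
    quadratic remainders pass to locally uniform limits. *)
Lemma weierstrass (F : nat -> V -> C) (f : V -> C) (z : V) (B : V -> R) :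
  (forall k, polyf (F k)) ->
  (forall k y, n1 y <= n1 z + 4 -> nc (F k.+1 y - F k y) <= 1 / 2 ^+ k.+1) ->
  (forall k y, nc (F k y - f y) <= B y / 2 ^+ k) ->
  exists (l : 'I_n -> C) (K : R), 0 <= K /\
    forall h, n1 h <= 1 -> nc (f (z + h) - f z - \sum_j l j * h ord0 j) <= K * n1 h ^+ 2.
Proof.
move=> pF dF Ff.
have [l0 [K0 [K00 K0P]]] := polyf_differential z (pF 0%N).
have /choice [L LP] := fun k => polyf_cauchy (polyfB (pF k.+1) (pF k)) (dF k).
pose La k j := l0 j + \sum_(i < k) L i j.
have LaS k j : La k.+1 j = La k j + L k j by rewrite /La big_ord_recr addrA.
have /choice [l lP] : forall j, exists x, forall k, nc (La k j - x) <= 2 * 3 / 2 ^+ k.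
  move=> j; apply: complex_geom_limit => k.
  by rewrite LaS addrAC subrr add0r; have [_ /(_ j)] := LP k; rewrite mul1r.
exists l, (K0 + 1); split; first exact: addr_ge0.
move=> h h1.
have step k : nc (F k (z + h) - F k z - \sum_j La k j * h ord0 j) <=
    (K0 + (1 - 1 / 2 ^+ k)) * n1 h ^+ 2.
  elim: k => [|k IH].
    rewrite expr0 divr1 subrr addr0; under eq_bigr do rewrite /La big_ord0 addr0.
    exact: K0P.
  under eq_bigr do rewrite LaS mulrDl; rewrite big_split /=.
  have [/(_ h h1) Lk _] := LP k.
  have -> : F k.+1 (z + h) - F k.+1 z -
      (\sum_j La k j * h ord0 j + \sum_j L k j * h ord0 j) =
    (F k (z + h) - F k z - \sum_j La k j * h ord0 j) +
    (F k.+1 (z + h) - F k (z + h) - (F k.+1 z - F k z) - \sum_j L k j * h ord0 j) by ring.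
  apply: le_trans (ncD _ _) _; apply: le_trans (lerD IH Lk) _.
  rewrite -mulrDl ler_wpM2r ?sqr_ge0// exprS.
  have -> : 1 / 2 ^+ k = 2 * (1 / (2 * 2 ^+ k)) :> R by field; rewrite expf_neq0.
  lra.
apply: (@geom_le_lim _ _ _ (B (z + h) + B z + 6 * n1 h) 0) => k _.
have t1 := step k; have t2 := Ff k (z + h); have t3 := Ff k z.
have t4 : nc (\sum_j (La k j - l j) * h ord0 j) <= 6 / 2 ^+ k * n1 h.
  apply: le_trans (nc_sum _ _ _) _; rewrite /n1 mulr_sumr; apply: ler_sum => j _.
  rewrite ncM ler_wpM2r ?nc_ge0//; apply: le_trans (lP j k) _; lra.
have -> : f (z + h) - f z - \sum_j l j * h ord0 j =
  (F k (z + h) - F k z - \sum_j La k j * h ord0 j) - (F k (z + h) - f (z + h))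
  + (F k z - f z) + \sum_j (La k j - l j) * h ord0 j.
  have -> : \sum_j (La k j - l j) * h ord0 j =
      \sum_j La k j * h ord0 j - \sum_j l j * h ord0 j.
    by rewrite -sumrB; apply: eq_bigr => j _; rewrite mulrBl.
  ring.
have t5 : (K0 + (1 - 1 / 2 ^+ k)) * n1 h ^+ 2 <= (K0 + 1) * n1 h ^+ 2.
  rewrite ler_wpM2r ?sqr_ge0// lerD2l gerBl divr_ge0// exprn_ge0//.
have i0 : 0 <= (2 ^+ k)^-1 :> R by rewrite invr_ge0 exprn_ge0.
apply: le_trans (ncD _ _) _; apply: le_trans (lerD (ncD _ _) t4) _.
apply: le_trans (lerD (lerD (ncB _ _) t3) (lexx _)) _.
apply: le_trans (lerD (lerD (lerD (le_trans t1 t5) t2) (lexx _)) (lexx _)) _.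
lra.
Qed.

End Weierstrass.

(** * Construction of the universal map *)

Section Construction.
Variables (R : realType) (n m : nat).
Local Notation C := R[i].
Local Notation V := 'rV[C]_n.
Local Notation W := 'rV[C]_m.
Variable phi : R -> R.
Hypothesis phiP : forall i : nat, exists2 c : R, 0 < c &
  forall x, 0 <= x -> c * x ^+ i <= phi x.

(** The ladder provides finitely many centres, Runge's approximation one polynomial
    map [G] that is good near all of them, and a far correction implants [G] at
    distance [a]. The ladder placed at height [a] then has, for each [t], a rung near
    a multiple of [t]. *)
Lemma approximation_step (theta : V) (Q F : V -> W) (r0 d t1 t2 s : R) :
  theta != 0 -> polymap Q -> polymap F -> 0 < d -> 0 < t1 -> 0 <= s ->
  exists (F' : V -> W) (r1 : R), [/\ polymap F', r0 + 1 <= r1,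
    forall z, n1 (F' z - F z) <= d * phi (enorm z),
    forall z, n1 z <= r0 -> n1 (F' z - F z) <= d &
    forall t, t1 <= t <= t2 -> exists k : nat, forall z, n1 z <= s ->
      n1 (z + (k%:R * t)%:C *: theta) <= r1 /\
      n1 (F' (z + (k%:R * t)%:C *: theta) - Q z) <= d].
Proof.
move=> theta0 pQ pF d0 t10 s0.
have [j0 th0] : exists j0, theta ord0 j0 != 0 by apply/rV0Pn.
pose e := Num.min 1 (d / 3).
have e0 : 0 < e by rewrite lt_min ltr01 divr_gt0.
have e1 : e <= 1 by rewrite ge_min lexx.
have ed : e <= d / 3 by rewrite ge_min lexx orbT.
pose r := s + 1; have r_gt0 : 0 < r by rewrite ltr_wpDl.
have [L [L0 LP]] := polymap_lipschitz r pQ.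
pose th := n1 theta; have th_ge0 : 0 <= th := n1_ge0 theta.
have den0 : 0 < 2 * ((L + 1) * (th + 1)) by rewrite !mulr_gt0// ltr_wpDl.
(* A displacement of length [2 * eta] along [theta] changes neither [Q], by the
   Lipschitz constant [L], nor the radius of the balls by more than [e]. *)
pose eta := e / (2 * ((L + 1) * (th + 1))).
have eta0 : 0 < eta by rewrite divr_gt0.
have etaE : 2 * eta * ((L + 1) * (th + 1)) = e.
  by rewrite [2 * eta]mulrC -mulrA /eta divfK// gt_eqF.
have [y [N [y0 y_incr yP]]] := @ladder R (21 * (along_norm theta j0 * r)) eta t1 t2 eta0 t10.
have [G [pG GP]] := @runge_discs R n m theta j0 th0 Q y N r e pQ r_gt0 e0 y_incr.
pose R1 := r + (\sum_(i < N.+1) `|y i|) * th.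
have [a [p [a0 pp pphi psmall pG']]] := far_modification r0 R1 phiP theta0 pF pG e0.
pose F' z := F z + p z.
have FF z : F' z - F z = p z by rewrite /F' addrAC subrr add0r.
exists F', (`|r0| + 1 + R1 + a * th).
have S0 : 0 <= \sum_(i < N.+1) `|y i| by apply: sumr_ge0.
have R10 : 0 <= R1 by rewrite addr_ge0 ?(ltW r_gt0)// mulr_ge0.
split.
- exact: polymapD.
- have := ler_norm r0; have : 0 <= a * th by rewrite mulr_ge0.
  lra.
- move=> z; rewrite FF; apply: le_trans (pphi z) _; apply: ler_wpM2r; last lra.
  have [c c0 cP] := phiP 0; apply: le_trans (cP _ (enorm_ge0 z)).
  by rewrite expr0 mulr1 ltW.
- by move=> z /psmall; rewrite FF; lra.
move=> t tP; have [i [k [iN kP]]] := yP a t a0 tP; exists k => z zs.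
set x := z + _; set tau := k%:R * t - a - y i.
have taueta : `|tau| <= 2 * eta by rewrite /tau -normrN; move: kP; congr (`|_| <= _); ring.
have tauth : `|tau| * th <= e.
  apply: le_trans (ler_wpM2r th_ge0 taueta) _; rewrite -etaE.
  rewrite ler_wpM2l//; first by rewrite mulr_ge0 ?(ltW eta0).
  have : 0 <= L * (th + 1) by rewrite mulr_ge0 ?addr_ge0.
  lra.
have Ltauth : L * (`|tau| * th) <= e.
  have h : `|tau| * th <= 2 * eta * (th + 1).
    by apply: ler_pM => //; lra.
  apply: le_trans (ler_wpM2l L0 h) _; rewrite -etaE.
  have : 0 <= 2 * eta * (th + 1).
    by apply: mulr_ge0; [rewrite mulr_ge0 ?(ltW eta0)|exact: addr_ge0].
  lra.
have xa : x - a%:C *: theta = (z + tau%:C *: theta) + (y i)%:C *: theta.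
  rewrite /x -!addrA; congr (_ + _); rewrite -scalerBl -scalerDl; congr (_ *: _).
  by rewrite -RCB -RCD; congr (_%:C); rewrite /tau; ring.
have ztau : n1 (z + tau%:C *: theta) <= r.
  apply: le_trans (n1D _ _) _; rewrite n1Z nc_real -/th /r; lra.
have zr : n1 z <= r by rewrite /r; lra.
have yi : `|y i| <= \sum_(i < N.+1) `|y i|.
  have iN' : (i < N.+1)%N by [].
  by rewrite (bigD1 (Ordinal iN'))//= lerDl; apply: sumr_ge0.
have xR1 : n1 (x - a%:C *: theta) <= R1.
  rewrite xa; apply: le_trans (n1D _ _) _; apply: lerD => //.
  by rewrite n1Z nc_real ler_wpM2r.
split.
  rewrite -[x](subrK (a%:C *: theta)); apply: le_trans (n1D _ _) _.
  by rewrite n1Z nc_real ger0_norm// -/th; have := normr_ge0 r0; lra.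
have A1 := pG' _ xR1.
have ze : x - a%:C *: theta - (y i)%:C *: theta = z + tau%:C *: theta by rewrite xa addrK.
have A2 : n1 (G (x - a%:C *: theta) - Q (z + tau%:C *: theta)) <= e.
  by rewrite -ze; apply: GP => //; rewrite ze.
have A3 : n1 (Q (z + tau%:C *: theta) - Q z) <= e.
  apply: le_trans (LP _ _ ztau zr) _.
  by rewrite addrAC subrr add0r n1Z nc_real.
have -> : F' x - Q z = (F x + p x - G (x - a%:C *: theta)) +
   (G (x - a%:C *: theta) - Q (z + tau%:C *: theta)) + (Q (z + tau%:C *: theta) - Q z).
  by rewrite !addrA !subrK.
apply: le_trans (n1D _ _) _; apply: le_trans (lerD (n1D _ _) (lexx _)) _; lra.
Qed.

(** For a fixed [x], the pairs [(j, x)] have arbitrarily large codes. *)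
Lemma recurrent_enumeration (T : countType) (x0 : T) : exists u : nat -> T,
  forall x S, exists2 s, (S <= s)%N & u s = x.
Proof.
exists (fun s => if @unpickle (nat * T)%type s is Some p then p.2 else x0) => x S.
have [j jS] : exists j : nat, (S <= pickle (j, x))%N.
  apply: contrapT => H.
  have lt (j : nat) : (pickle (j, x) < S)%N.
    by rewrite ltnNge; apply/negP => h; apply: H; exists j.
  have inj : injective (fun j : nat => pickle (j, x)).
    by move=> i j /(pcan_inj pickleK) [].
  have := @uniq_leq_size _ [seq pickle (j, x) | j <- iota 0 S.+1] (iota 0 S).
  rewrite map_inj_uniq// iota_uniq size_map !size_iota ltnn => /(_ isT).
  have sub : {subset [seq pickle (j, x) | j <- iota 0 S.+1] <= iota 0 S}.
    by move=> _ /mapP[j _ ->]; rewrite mem_iota /= add0n.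
  by move=> /(_ sub).
by exists (pickle (j, x)) => //; rewrite pickleK.
Qed.

Definition rmap (q : {ffun 'I_m -> rpoly n}) (z : V) : W := \row_k reval (q k) z.

Lemma rmap_polymap q : polymap (rmap q).
Proof. by move=> k; under eq_fun do rewrite mxE; exact: reval_polyf. Qed.

Lemma rmap_dense (H : V -> W) (r e : R) : holomorphic H -> 0 < e ->
  exists q, forall z, n1 z <= r -> n1 (rmap q z - H z) <= e.
Proof.
move=> hH e0; pose e' := e / (m%:R + 1).
have m0 : 0 < m%:R + 1 :> R by rewrite ltr_wpDl.
have e'0 : 0 < e' by rewrite divr_gt0.
have r'0 : 0 <= Num.max 0 r by rewrite le_max lexx.
have /choice [p pP] : forall k, exists p, forall z, n1 z <= r -> nc (H z ord0 k - reval p z) <= e'.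
  move=> k; have [p pP] := entire_approximable r'0 (holomorphic_entire k hH) e'0.
  by exists p => z zr; apply: pP; rewrite le_max zr orbT.
exists [ffun k => p k] => z zr.
apply: (@le_trans _ _ (\sum_(k < m) e')).
  by apply: ler_sum => k _; rewrite !mxE ffunE ncBC; exact: pP.
rewrite sumr_const card_ord -[X in X <= _]mulr_natl mulrCA ler_piMr ?(ltW e0)//.
by rewrite ler_pdivrMr// mul1r lerDl.
Qed.

(** [F] is the limit of polynomial maps [F s]. Stage [s] treats the direction and
    the target numbered [s], with error [1 / 2 ^+ s.+1] on the ball of radius [s];
    all later corrections together change [F s.+1] by at most [1 / 2 ^+ s.+1] on the
    ball of radius [r s.+1], which contains the translated balls of stage [s]. *)
Lemma universal_entire_map (theta : nat -> V) : (forall i, theta i != 0) ->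
  exists F : V -> W, [/\ holomorphic F,
    forall z, n1 (F z) <= phi (enorm z) &
    forall (i : nat) (t : R) (H : V -> W) (r e : R), 0 < t -> holomorphic H -> 0 < e ->
      exists k : nat, forall z, n1 z <= r -> n1 (F (z + (k%:R * t)%:C *: theta i) - H z) < e].
Proof.
move=> theta0.
have [tk tkP] := recurrent_enumeration ((0%N, [ffun _ => RCst n 0 0]) : nat * {ffun 'I_m -> rpoly n}).
pose good (s : nat) (x y : (V -> W) * R) := [/\ polymap y.1, x.2 + 1 <= y.2,
  forall z, n1 (y.1 z - x.1 z) <= 1 / 2 ^+ s.+1 * phi (enorm z),
  forall z, n1 z <= x.2 -> n1 (y.1 z - x.1 z) <= 1 / 2 ^+ s.+1 &
  forall t : R, s.+1%:R^-1 <= t <= s.+1%:R -> exists k : nat, forall z, n1 z <= s%:R ->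
    n1 (z + (k%:R * t)%:C *: theta (tk s).1) <= y.2 /\
    n1 (y.1 (z + (k%:R * t)%:C *: theta (tk s).1) - rmap (tk s).2 z) <= 1 / 2 ^+ s.+1].
have half0 s : 0 < 1 / 2 ^+ s :> R by rewrite divr_gt0 ?exprn_gt0.
have /choice [next nextP] : forall sx : nat * ((V -> W) * R), exists y,
    polymap sx.2.1 -> good sx.1 sx.2 y.
  case=> s [F r] /=; have [pF|npF] := pselect (polymap F); last by exists (F, r).
  have i0 : 0 < s.+1%:R^-1 :> R by rewrite invr_gt0.
  have s0 : 0 <= s%:R :> R by [].
  have [F' [r1 [h1 h2 h3 h4 h5]]] := @approximation_step (theta (tk s).1) (rmap (tk s).2) F r
    (1 / 2 ^+ s.+1) (s.+1%:R^-1) s.+1%:R s%:R (theta0 _) (rmap_polymap _) pF (half0 _) i0 s0.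
  by exists (F', r1).
pose u := fix u k := if k is k'.+1 then next (k', u k') else ((fun=> 0) : V -> W, 0 : R).
have pu k : polymap (u k).1.
  elim: k => [|k IH]; first exact: polymap_cst.
  by have [] := nextP (k, u k) IH.
have uP k : good k (u k) (u k.+1) := nextP (k, u k) (pu k).
pose F k := (u k).1; pose r k := (u k).2.
have rS k : r k + 1 <= r k.+1 by have [] := uP k.
have r_ge k : k%:R <= r k.
  by elim: k => [|k IH]; [rewrite lexx|rewrite -natr1; have := rS k; lra].
have rM j k : (j <= k)%N -> r j <= r k.
  elim: k => [|k IH]; first by rewrite leqn0 => /eqP->.
  rewrite leq_eqVlt => /orP[/eqP->//|]; rewrite ltnS => /IH h.
  by apply: le_trans h _; have := rS k; lra.
have dphi k z : n1 (F k.+1 z - F k z) <= phi (enorm z) / 2 ^+ k.+1.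
  by have [_ _ /(_ z) + _ _] := uP k; rewrite mulrC mulrA mulr1.
have dr k z : n1 z <= r k -> n1 (F k.+1 z - F k z) <= 1 / 2 ^+ k.+1.
  by move=> zr; have [_ _ _ /(_ z zr)] := uP k.
have /choice [f fP] : forall z, exists v : W, forall k j,
    nc (F k z ord0 j - v ord0 j) <= 2 * phi (enorm z) / 2 ^+ k.
  move=> z.
  have /choice [l lP] : forall j, exists x, forall k, nc (F k z ord0 j - x) <= 2 * phi (enorm z) / 2 ^+ k.
    move=> j; apply: complex_geom_limit => k; apply: le_trans (dphi k z).
    by have := nc_le_n1 (F k.+1 z - F k z) j; rewrite !mxE.
  by exists (\row_j l j) => k j; rewrite mxE.
have Ff k z : n1 (F k z - f z) <= m%:R * (2 * phi (enorm z)) / 2 ^+ k.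
  rewrite -mulrA mulr_natl -[X in _ *+ X]card_ord -sumr_const.
  by apply: ler_sum => j _; rewrite !mxE.
have limit_le z v (B : R) k0 : (forall k, (k0 <= k)%N -> n1 (F k z - v) <= B) -> n1 (f z - v) <= B.
  move=> H; apply: (@geom_le_lim _ _ _ (m%:R * (2 * phi (enorm z))) k0) => k kk.
  have -> : f z - v = (F k z - v) - (F k z - f z) by rewrite opprB [RHS]addrC addrA subrK.
  by apply: le_trans (n1B _ _) _; apply: lerD; [exact: H|exact: Ff].
have halfS k (c : R) : c / 2 ^+ k = c / 2 ^+ k.+1 + c / 2 ^+ k.+1.
  by rewrite exprS; field; rewrite expf_neq0.
have phi0 x : 0 <= x -> 0 <= phi x.
  move=> x0; have [c c0 /(_ x x0)] := phiP 0; rewrite expr0 mulr1; exact/le_trans/ltW.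
have f_phi z : n1 (f z) <= phi (enorm z).
  have := limit_le z 0 (phi (enorm z)) 0; rewrite subr0; apply => k _; rewrite subr0.
  have : n1 (F k z) <= phi (enorm z) - phi (enorm z) / 2 ^+ k.
    elim: k => [|k IH]; first by rewrite expr0 divr1 subrr /F /= n1_0.
    rewrite -[F k.+1 z](subrK (F k z)); apply: le_trans (n1D _ _) _.
    apply: le_trans (lerD (dphi k z) IH) _; rewrite (halfS k); lra.
  move=> /le_trans; apply; rewrite gerBl divr_ge0 ?exprn_ge0//.
  exact/phi0/enorm_ge0.
have f_near k z : n1 z <= r k -> n1 (f z - F k z) <= 1 / 2 ^+ k.
  move=> zr; apply: (limit_le _ _ _ k) => j kj.
  have : n1 (F j z - F k z) <= 1 / 2 ^+ k - 1 / 2 ^+ j.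
    elim: j kj => [|j IH]; first by rewrite leqn0 => /eqP->; rewrite !subrr n1_0.
    rewrite leq_eqVlt => /orP[/eqP->|]; first by rewrite !subrr n1_0.
    rewrite ltnS => kj; have zj : n1 z <= r j := le_trans zr (rM _ _ kj).
    have -> : F j.+1 z - F k z = (F j.+1 z - F j z) + (F j z - F k z) by rewrite addrA subrK.
    apply: le_trans (n1D _ _) _; apply: le_trans (lerD (dr j z zj) (IH kj)) _.
    rewrite (halfS j); lra.
  by move=> /le_trans; apply; rewrite gerBl ltW.
exists f; split => //.
- move=> z.
  have [k0 [_ k0P]] := nat_above (n1 z + 4).
  have /choice [l /choice [K KP]] : forall j : 'I_m, exists l : 'I_n -> C, exists K : R, 0 <= K /\
      forall h, n1 h <= 1 ->
      nc (f (z + h) ord0 j - f z ord0 j - \sum_i l i * h ord0 i) <= K * n1 h ^+ 2.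
    move=> j.
    apply: (@weierstrass _ _ (fun k y => F (k0 + k)%N y ord0 j) (fun y => f y ord0 j) z
      (fun y => 2 * phi (enorm y))).
    + by move=> k; exact: pu.
    + move=> k y yz.
      have yr : n1 y <= r (k0 + k)%N.
        apply: le_trans yz _; apply: le_trans k0P _; apply: le_trans (r_ge _) _.
        by apply: rM; rewrite leq_addr.
      have := le_trans (nc_le_n1 _ j) (dr _ _ yr); rewrite !mxE addnS => /le_trans; apply.
      rewrite !mul1r lef_pV2 ?posrE ?exprn_gt0// ler_eXn2l ?ltr1n//.
      by rewrite ltnS leq_addl.
    + move=> k y; apply: le_trans (fP y _ j) _.
      rewrite ler_wpM2l ?mulr_ge0 ?phi0 ?enorm_ge0// lef_pV2 ?posrE ?exprn_gt0//.
      by rewrite ler_eXn2l ?ltr1n// leq_addl.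
  apply: (@differentiable_quadratic _ _ _ _ _ (\matrix_(i, j) l j i) (\sum_j K j)).
    by apply: sumr_ge0 => j _; case: (KP j).
  move=> h h1; rewrite mulr_suml; apply: ler_sum => j _; have [_ /(_ h h1)] := KP j.
  rewrite !mxE; apply: le_trans; rewrite le_eqVlt; apply/orP; left; apply/eqP.
  by congr (nc (_ - _)); apply: eq_bigr => i _; rewrite mxE mulrC.
- move=> i t H rho e t0 hH e0.
  have e2 : 0 < e / 2 by rewrite divr_gt0.
  have [q qP] := rmap_dense rho hH e2.
  have [S1 [_ S1P]] := nat_above rho.
  have [S2 [_ S2P]] := nat_above t.
  have [S3 [_ S3P]] := nat_above (t^-1).
  have [S4 S4P] := half_pow_small 1 e2.
  have [s sS tks] := tkP (i, q) (S1 + S2 + S3 + S4)%N.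
  have sN : (S1 + S2 + S3 + S4)%:R <= s%:R :> R by rewrite ler_nat.
  rewrite !natrD in sN.
  have S10 : 0 <= S1%:R :> R by []. have S20 : 0 <= S2%:R :> R by [].
  have S30 : 0 <= S3%:R :> R by []. have S40 : 0 <= S4%:R :> R by [].
  have s1 : s.+1%:R = s%:R + 1 :> R by rewrite natr1.
  have tP : s.+1%:R^-1 <= t <= s.+1%:R.
    apply/andP; split; last by rewrite s1; lra.
    rewrite -[t]invrK lef_pV2 ?posrE ?invr_gt0//; rewrite s1; lra.
  have [_ _ _ _ /(_ t tP)] := uP s; rewrite tks /= => -[k kP].
  exists k => z zr; have zs : n1 z <= s%:R by lra.
  have [x_r x_Q] := kP z zs; set x := z + _ in x_r x_Q *.
  have x_f := f_near s.+1 x x_r.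
  have -> : f x - H z = (f x - F s.+1 x) + (F s.+1 x - rmap q z) + (rmap q z - H z).
    by rewrite !addrA !subrK.
  apply: le_lt_trans (n1D _ _) _.
  apply: le_lt_trans (lerD (n1D _ _) (qP z zr)) _.
  have : 1 / 2 ^+ s <= 1 / 2 ^+ S4 :> R.
    rewrite !mul1r lef_pV2 ?posrE ?exprn_gt0// ler_eXn2l ?ltr1n//.
    by apply: leq_trans sS; rewrite leq_addl.
  rewrite (halfS s); lra.
Qed.

End Construction.

(** * Translations of holomorphic maps *)

Section Translations.
Variables (R : realType) (n m : nat).
Local Notation C := R[i].

Lemma iter_translate (a : 'rV[C]_n) (F : hol R n m) k z :
  hol_fun (iter k (translate a) F) z = hol_fun F (z + k%:R *: a).
Proof.
elim: k z => [|k IH] z; first by rewrite scale0r addr0.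
rewrite iterS; change (hol_fun (iter k (translate a) F) (z + a) = hol_fun F (z + k.+1%:R *: a)); rewrite IH.
by rewrite -addrA -natr1 scalerDl scale1r [a + _]addrC.
Qed.

End Translations.

(** * The theorem *)

Theorem theoremA (R : realType) (n m : nat) (n_ge1 : (1 <= n)%N)
    (m_ge1 : (1 <= m)%N) (A : nat -> R) (hA : transcendental_growth A)
    (theta : nat -> 'rV[R[i]]_n) (theta_sphere : forall i, enorm (theta i) = 1) :
  exists F : hol R n m,
    [/\ universal F,
        forall z, enorm (hol_fun F z) <= growth_fun A (enorm z),
        forall i, hypercyclic_directions F (theta i) &
        forall (i : nat) (t : R), 0 < t -> hypercyclic (t%:C *: theta i) F].
Proof.
have theta0 i : theta i != 0.
  apply/eqP => th0; have := n1_ge0 (theta i); have := enorm_le_n1 (theta i).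
  by rewrite theta_sphere th0 n1_0; lra.
have phiP i : exists2 c : R, 0 < c & forall x, 0 <= x -> c * x ^+ i <= growth_fun A x.
  by exists (A i) => [|x]; [case: hA|exact: growth_fun_ge].
have [f [hf fphi fP]] := universal_entire_map m phiP theta0.
pose F : hol R n m := exist _ f (mem_set hf).
have hyper i t : 0 < t -> hypercyclic (t%:C *: theta i) F.
  move=> t0 O [H OH] oO.
  have [r [e [e0 P]]] := hol_nbhs (open_nbhs_nbhs (conj oO OH)).
  have [k kP] := fP i t (hol_fun H) r e t0 (set_mem (valP H)) e0.
  exists (iter k (translate (t%:C *: theta i)) F); split; last by exists k.
  apply: P => z zr; rewrite iter_translate scalerA.
  have -> : k%:R * t%:C = (k%:R * t)%:C :> R[i] by rewrite RCM rmorph_nat.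
  exact: kP.
exists F; split => //.
- (* Universality: multiples of the single vector [theta 0] suffice. *)
  move=> H.
  have /choice [k kP] : forall i : nat, exists k : nat, forall z, n1 z <= i%:R ->
      n1 (f (z + (k%:R * 1)%:C *: theta 0%N) - hol_fun H z) < i.+1%:R^-1.
    by move=> i; apply: fP => //; exact: set_mem (valP H).
  exists (fun i => ((k i)%:R * 1)%:C *: theta 0%N) => O /hol_nbhs [r [e [e0 P]]].
  have [N1 [_ N1P]] := nat_above r; have [N2 [_ N2P]] := nat_above (e^-1).
  exists (N1 + N2)%N => // i /= iN; apply: P => z zr.
  have iN' : (N1 + N2)%:R <= i%:R :> R by rewrite ler_nat.
  rewrite natrD in iN'.
  have N10 : 0 <= N1%:R :> R by []. have N20 : 0 <= N2%:R :> R by [].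
  have zi : n1 z <= i%:R by lra.
  apply: lt_le_trans (kP i z zi) _.
  rewrite -[e]invrK lef_pV2 ?posrE ?invr_gt0// -natr1; lra.
- by move=> z; apply: le_trans (enorm_le_n1 _) (fphi z).
- by move=> i; split => //; have := hyper i 1 ltr01; rewrite scale1r.
Qed.
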